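(* Let $Z$ be a bi-parameter Haar system Hardy space, let $\mathrm{HM}(Z)$ denote the set of bounded Haar multipliers on $Z$, and let $\mathcal C$ be the Capon projection. (i) If $\mathcal C$ is unbounded on $Z$, then $\mathrm{HM}(Z)$ approximately $1$-projectionally reduces to the class $\{\lambda\,\mathrm{Id}:\lambda\in\mathbb R\}$ of scalar operators. In particular, $\mathrm{HM}(Z)$ has the $C$-primary factorization property for every $C>2$. (ii) If $\mathcal C$ is bounded on $Z$, then $\mathrm{HM}(Z)$ approximately $1$-projectionally reduces to the two-dimensional subalgebra $\{\lambda\mathcal C+\mu(\mathrm{Id}-\mathcal C):\lambda,\mu\in\mathbb R\}$.
   Context: Haar functions. $\mathcal D$ is the set of dyadic intervals $[\frac{i-1}{2^j},\frac{i}{2^j})$, $j\ge 0$, $1\le i\le 2^j$. For $I\in\mathcal D$, $I^+$ and $I^-$ are its left and right halves and $h_I=\chi_{I^+}-\chi_{I^-}$; $(k_J)$ is a copy of $(h_I)$. $(h_I\otimes k_J)(s,t)=h_I(s)k_J(t)$, and $\mathcal V(\delta^2)$ is the linear span of all $h_I\otimes k_J$. $\mathcal V_1(\delta)=\mathrm{span}\{\chi_I:I\in\mathcal D\}$. Haar system spaces. A Haar system space is the completion of $\mathcal V_1(\delta)$ under a norm $\|\cdot\|$ such that $\|f\|=\|g\|$ whenever $|f|,|g|$ have the same distribution, and $\|\chi_{[0,1)}\|=1$. The class of these is $\mathcal H(\delta)$. Haar system Hardy spaces. Let $\boldsymbol\sigma$ be one of the four product sets $S_1\times S_2$ with $S_1,S_2\in\{\{1\}^{\mathcal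 D},\{\pm1\}^{\mathcal D}\}$, and let $\mathbb E$ be the expectation with respect to the Haar (uniform product) probability measure over $((\sigma^{(1)}_I)_{I\in\mathcal D},(\sigma^{(2)}_J)_{J\in\mathcal D})\in\boldsymbol\sigma$. For $X,Y\in\mathcal H(\delta)$, the bi-parameter Haar system Hardy space $Z(\boldsymbol\sigma,X,Y)$ is the completion of $\mathcal V(\delta^2)$ under the norm, for $f=\sum_{I,J}a_{I,J}h_I\otimes k_J$, $$\|f\|_Z=\Big\|s\mapsto\Big\|t\mapsto\mathbb E\Big|\sum_{I,J}\sigma^{(1)}_I\sigma^{(2)}_Ja_{I,J}h_I(s)k_J(t)\Big|\Big\|_Y\Big\|_X.$$ A Haar multiplier is a linear operator $D$ for which each $h_I\otimes k_J$ is an eigenvector; it is a bounded Haar multiplier on $Z$ if it is bounded for $\|\cdot\|_Z$ (and is then extended to $Z$). The Capon projection is the Haar multiplier $\mathcal C:\mathcal V(\delta^2)\to\mathcal V(\delta^2)$ with $\mathcal C(h_I\otimes k_J)=h_I\otimes k_J$ if $|I|\le|J|$ and $0$ if $|I|>|J|$; it is (un)bounded on $Z$ if it is (un)bounded with respect to $\|\cdot\|_Z$. Factorization. Let $S,T\in\mathcal L(Z)$ (bounded operators on $Z$). $T$ is a $C$-factor of $S$ if there are bounded $A,B:Z\to Z$ with $\|A\|\|B\|\le C$ and $S=ATB$. $T$ is a $C$-projectional factor of $S$ with error $\eta\ge0$ if there are bounded $A,B:Z\to Z$ with $\|A\|\|B\|\le C$, $AB=\mathrm{Id}$ and $\|S-ATB\|\le\eta$.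 For classes $\mathcal A,\mathcal B\subset\mathcal L(Z)$, $\mathcal A$ approximately $C$-projectionally reduces to $\mathcal B$ if for every $T\in\mathcal A$ and $\eta>0$ there is $S\in\mathcal B$ such that $T$ is a $C$-projectional factor of $S$ with error $\eta$. $\mathcal A$ has the $C$-primary factorization property if for every $T\in\mathcal A$, either $T$ or $\mathrm{Id}-T$ is a $C$-factor of $\mathrm{Id}$. *)

(* Defs.v *)
From mathcomp Require Import all_boot all_order all_algebra finmap.
From mathcomp Require Import all_classical all_reals all_analysis.
(* [monalg]'s notations clash with those of the analysis library: [malg K R] is
   the free [R]-module on [K], [mkmalgU k c] is [c] times the basis vector [k],
   and [mcoeff k f] is the coefficient of [f] at [k]. *)
From mathcomp Require Export -(notations) monalg.

Set Implicit Arguments.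
Unset Strict Implicit.
Unset Printing Implicit Defensive.

Import Order.TTheory GRing.Theory Num.Theory.
Import numFieldNormedType.Exports.

Local Open Scope classical_set_scope.
Local Open Scope ring_scope.

(* The pair (j, i), i < 2^j, stands for the interval [i / 2^j, (i+1) / 2^j). *)
Definition dyadic : choiceType := {j : nat & 'I_(2 ^ j)}.

Section HaarFunctions.
Variable R : realType.

Definition dyadic_itv (j i : nat) : set R :=
  [set x | i%:R / 2 ^+ j <= x < i.+1%:R / 2 ^+ j].

Definition itv_of (I : dyadic) : set R := dyadic_itv (tag I) (tagged I).

Definition len (I : dyadic) : R := 2 ^- tag I.

Definition haar (I : dyadic) (x : R) : R :=
  \1_(dyadic_itv (tag I).+1 (tagged I).*2) x
  - \1_(dyadic_itv (tag I).+1 (tagged I).*2.+1) x.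

End HaarFunctions.

(* Functions on [0,1) are represented by functions on R vanishing outside. *)
Definition V1 (R : realType) : set (R -> R) :=
  [set f | exists (A : {fset dyadic}) (a : dyadic -> R),
     f = fun x => \sum_(I <- A) a I * \1_(@itv_of R I) x].

Definition abs_equidistributed (R : realType) (f g : R -> R) : Prop :=
  forall B : set R, measurable B ->
    lebesgue_measure (`[0, 1[ `&` [set x | B `|f x|]) =
    lebesgue_measure (`[0, 1[ `&` [set x | B `|g x|]).

(* A Haar system space is given by its norm on [V1]; the values of [hs_norm]
   outside [V1] are irrelevant.  Bi-parameter Hardy norms only evaluate it on
   [V1], so that the completion is not needed. *)
Record haar_system_space (R : realType) := HaarSystemSpace {
  hs_norm :> (R -> R) -> R ;
  hs_norm_eq0 : forall f, V1 f -> hs_norm f = 0 -> f = (fun=> 0) ;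
  hs_normZ : forall (c : R) f, V1 f ->
    hs_norm (fun x => c * f x) = `|c| * hs_norm f ;
  hs_normD : forall f g, V1 f -> V1 g ->
    hs_norm (fun x => f x + g x) <= hs_norm f + hs_norm g ;
  hs_norm_rearrangement : forall f g, V1 f -> V1 g ->
    abs_equidistributed f g -> hs_norm f = hs_norm g ;
  hs_norm_unit : hs_norm (\1_`[0, 1[) = 1
}.

(* {-1, 1}^dyadic, with the sigma-algebra generated by the coordinates;
   [true] encodes the sign -1. *)
Definition coordinate_sets : set (set (dyadic -> bool)) :=
  [set A | exists I : dyadic, A = [set w : dyadic -> bool | w I = true]].

Definition signs := g_sigma_algebraType coordinate_sets.

Inductive sign_choice := AllOnes | AllSigns.

(* Mass of the cylinder {w | w = e on A} under the Haar probability measure of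
   the compact group {1}^dyadic, resp. {-1, 1}^dyadic. *)
Definition cylinder_mass (R : realType) (S : sign_choice)
    (A : {fset dyadic}) (e : dyadic -> bool) : R :=
  match S with
  | AllOnes => (all (fun I => ~~ e I) A)%:R
  | AllSigns => 2 ^- #|` A|
  end.

(* The Haar measure of S1 x S2, as a measure on {-1, 1}^dyadic x
   {-1, 1}^dyadic; it is determined by its values on cylinders. *)
Definition is_haar_measure (R : realType) (S1 S2 : sign_choice)
    (P : probability (signs * signs)%type R) : Prop :=
  forall (A B : {fset dyadic}) (e d : dyadic -> bool),
    P [set w | (forall I, I \in A -> w.1 I = e I) /\
               (forall J, J \in B -> w.2 J = d J)] =
    (cylinder_mass R S1 A e * cylinder_mass R S2 B d)%:E.

(* V(delta^2): the h_I (x) k_J are linearly independent, so that their span is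
   the free module on the pairs (I, J). *)
Definition V2 (R : realType) : lmodType R := malg (dyadic * dyadic)%type R.

Section HardySpaces.
Variable R : realType.

Definition hk (I J : dyadic) : V2 R := mkmalgU (I, J) 1.

Definition hardy_norm (P : probability (signs * signs)%type R)
    (X Y : haar_system_space R) (f : V2 R) : R :=
  X (fun s => Y (fun t => fine 'E_P[fun w =>
    `| \sum_(p <- msupp f)
         (-1) ^+ w.1 p.1 * (-1) ^+ w.2 p.2 * mcoeff p f
         * haar p.1 s * haar p.2 t |])).

Definition is_completion (N : V2 R -> R) (Z : completeNormedModType R)
    (iota : {linear V2 R -> Z}) : Prop :=
  (forall f, `|iota f| = N f) /\ closure (range iota) = setT.

Definition bounded_for (N : V2 R -> R) (D : V2 R -> V2 R) : Prop :=
  exists M : R, forall f, N (D f) <= M * N f.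

Definition haar_multiplier (D : {linear V2 R -> V2 R}) : Prop :=
  forall I J, exists d : R, D (hk I J) = d *: hk I J.

Definition capon (f : V2 R) : V2 R :=
  \sum_(p <- msupp f | len R p.1 <= len R p.2) mcoeff p f *: hk p.1 p.2.

End HardySpaces.

Record bounded_operator (R : realType) (Z : normedModType R) :=
  BoundedOperator {
    bop_linear :> {linear Z -> Z} ;
    bop_bounded : exists M : R, forall z, `|bop_linear z| <= M * `|z|
  }.

Section Factorization.
Variables (R : realType) (Z : normedModType R).

Definition opnorm (T : Z -> Z) : R :=
  sup [set `|T z| | z in [set z : Z | `|z| <= 1]].

Definition is_factor (C : R) (T S : Z -> Z) : Prop :=
  exists A B : bounded_operator Z,
    opnorm A * opnorm B <= C /\ forall z, S z = A (T (B z)).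

Definition is_projectional_factor (C eta : R) (T S : Z -> Z) : Prop :=
  exists A B : bounded_operator Z,
    [/\ opnorm A * opnorm B <= C,
        forall z, A (B z) = z
      & opnorm (fun z => S z - A (T (B z))) <= eta].

Definition approx_projectionally_reduces (C : R)
    (cA cB : set (bounded_operator Z)) : Prop :=
  forall T, cA T -> forall eta : R, 0 < eta ->
    exists2 S, cB S & is_projectional_factor C eta T S.

Definition primary_factorization_property (C : R)
    (cA : set (bounded_operator Z)) : Prop :=
  forall T, cA T ->
    is_factor C T idfun \/ is_factor C (fun z => z - T z) idfun.

End Factorization.

Section OperatorClasses.
Variables (R : realType) (N : V2 R -> R).
Variables (Z : completeNormedModType R) (iota : {linear V2 R -> Z}).

Definition extends (T : bounded_operator Z) (D : V2 R -> V2 R) : Prop :=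
  forall f, T (iota f) = iota (D f).

Definition HM : set (bounded_operator Z) :=
  [set T | exists D : {linear V2 R -> V2 R},
     [/\ haar_multiplier D, bounded_for N D & extends T D]].

Definition scalar_operators : set (bounded_operator Z) :=
  [set S | exists lambda : R, forall z, S z = lambda *: z].

Definition capon_algebra : set (bounded_operator Z) :=
  [set S | exists Cz : bounded_operator Z, extends Cz (@capon R) /\
     exists lambda mu : R,
       forall z, S z = lambda *: Cz z + mu *: (z - Cz z)].

End OperatorClasses.

(* Main.v *)
Require Import Defs.
From HB Require Import structures.
From mathcomp Require Import all_boot all_order all_algebra finmap.
From mathcomp Require Import all_classical all_reals all_analysis.
From mathcomp Require Import measurable_realfun zify ring lra.
Import Order.TTheory GRing.Theory Num.Theory.
Import numFieldNormedType.Exports.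

Set Implicit Arguments.
Unset Strict Implicit.
Unset Printing Implicit Defensive.

Local Open Scope classical_set_scope.
Local Open Scope ring_scope.

(** Coding the points of [0,1) by their binary digits, a bounded Haar multiplier d is
    conjugated to a stable one by the isometry [spread], which replaces the levels of
    the Haar system by sparse levels n_0 < n_1 < .. and m_0 < m_1 < .., and its left
    inverse [gather], a contraction because [spread] after [gather] is an average of
    isometries induced by automorphisms of the dyadic tree.  The conjugated multiplier
    has as entry at (I, J) the average of d over level (n_i, m_j) against Riesz
    products.  Along an ultrafilter these averages have two iterated limits.  Since a
    functional bounded in L^1 is nearly zero on late Rademacher functions, the levels
    can be chosen so that the entries with i >= j stay close to one iterated limit, and
    those with i < j close to the other, with increments so small that the differences
    are multipliers of small norm (Moebius inversion over dyadic rectangles).  Hence d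
    reduces to a combination of the Capon projection and its complement.  If the two
    limits differ, the Capon projection can be recovered from d and is bounded.  So if
    it is unbounded, they agree for every bounded multiplier, also after localization
    of d, and d reduces to a scalar. *)

(** * Binary digits and averages *)

(** The obstacle is that the Haar system need not be unconditional in [Z]: when both sign sets are
    trivial, a multiplier with tiny entries can have a large norm. What survives in every case is
    invariance under automorphisms of the dyadic tree, and its consequence that restriction to a
    dyadic rectangle has norm at most 4. As there are 2^(k+l) rectangles of levels (k, l), a
    multiplier is small once the mixed second differences of its entries decay like 4^-(k+l). Such a
    bound must hold on the whole array, since a cut along the diagonal is the Capon projection
    itself. So the entries on either side of the diagonal are continued across it by their iterated
    limits. The two continued arrays are cut and glued when the Capon projection is bounded. When it
    is not, both continuations use the same limits, and the entries are the sum of the two arrays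
    minus the array of limits, with no cut at all. In the primary factorization, 2 appears because
    [lam] or [1 - lam] has modulus at least 1/2. *)

Notation bits := (nat -> bool).

Definition lvl (I : dyadic) : nat := tag I.

Fixpoint bval (n : nat) (s : bits) : nat :=
  if n is k.+1 then ((bval k s).*2 + s k)%N else 0%N.

Lemma bval_lt n s : (bval n s < 2 ^ n)%N.
Proof.
elim: n => //= n IH; rewrite expnS mul2n.
by case: (s n); move: IH; lia.
Qed.

Definition pre (n : nat) (s : bits) : dyadic :=
  existT (fun j => 'I_(2 ^ j)) n (Ordinal (bval_lt n s)).

(** Digits are read from the most significant one, as in [bval]. For [k >= lvl I] the truncated
    subtraction makes this the last digit, a junk value. *)
Definition bit (I : dyadic) (k : nat) : bool :=
  odd (tagged I %/ 2 ^ (lvl I - k.+1)).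

Definition agree (n : nat) (s s' : bits) := forall k, (k < n)%N -> s k = s' k.

Lemma dyadic_eq (I J : dyadic) :
  tag I = tag J -> (tagged I : nat) = (tagged J : nat) -> I = J.
Proof.
case: I J => [i a] [j b] /= eij; subst j => e; congr existT; exact: val_inj.
Qed.

Lemma bval_bit I k : (k <= lvl I)%N ->
  bval k (bit I) = (tagged I %/ 2 ^ (lvl I - k))%N.
Proof.
elim: k => [|k IH] hk /=.
  by rewrite subn0 divn_small// ltn_ord.
rewrite IH; last exact: ltnW.
rewrite /bit.
have -> : (lvl I - k = (lvl I - k.+1).+1)%N by lia.
rewrite expnSr divnMA; set q := (_ %/ 2 ^ _)%N.
by rewrite divn2 addnC odd_double_half.
Qed.

Lemma pre_bit I : pre (lvl I) (bit I) = I.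
Proof.
apply: dyadic_eq => //=; by rewrite bval_bit// subnn expn0 divn1.
Qed.

Lemma bval_inj n s s' : bval n s = bval n s' -> agree n s s'.
Proof.
elim: n => [|n IH] //= e.
have eb : s n = s' n by move: e; case: (s n); case: (s' n); lia.
move=> k; rewrite ltnS leq_eqVlt => /orP[/eqP->//|].
by apply: IH; move: e; rewrite eb; lia.
Qed.

Lemma eq_bval n s s' : agree n s s' -> bval n s = bval n s'.
Proof.
by elim: n => [|n IH] //= h; rewrite IH ?h// => k kn; apply: h; exact: ltnW.
Qed.

Lemma lvl_pre n s : lvl (pre n s) = n. Proof. by []. Qed.

Lemma preP n s s' : pre n s = pre n s' <-> agree n s s'.
Proof.
split=> [e|h]; last by apply: dyadic_eq => //=; exact: eq_bval.
by apply: bval_inj; have := congr1 (fun I : dyadic => val (tagged I)) e.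
Qed.

Lemma eq_pre n s s' : agree n s s' -> pre n s = pre n s'.
Proof. by move/preP. Qed.

Lemma bit_pre n s k : (k < n)%N -> bit (pre n s) k = s k.
Proof. by move: k; apply/preP; rewrite -{1}(lvl_pre n s) pre_bit. Qed.

Lemma pre_le k n s s' : (k <= n)%N -> pre n s = pre n s' -> pre k s = pre k s'.
Proof. by move=> kn /preP h; apply/preP => i ik; apply: h; lia. Qed.

Lemma agreeS n s s' : agree n.+1 s s' -> agree n s s'.
Proof. by move=> h k kn; apply: h; lia. Qed.

Lemma agree_le m n s s' : (m <= n)%N -> agree n s s' -> agree m s s'.
Proof. by move=> mn h k km; apply: h; lia. Qed.

Section RealBits.
Variable R : realType.
Implicit Types x : R.

Definition rbit x (k : nat) : bool := odd (Num.truncn (2 ^+ k.+1 * x)).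

Definition unit_itv x : bool := (0 <= x < 1).

Lemma unit_itvP : [set` `[0, 1[%R] = [set x : R | unit_itv x].
Proof. by rewrite set_itvE. Qed.

Lemma dyadic_itvE n i x : 0 <= x ->
  @Defs.dyadic_itv R n i x <-> Num.truncn (2 ^+ n * x) = i.
Proof.
move=> x0; have p0 : (0 : R) < 2 ^+ n by rewrite exprn_gt0.
have px : 0 <= 2 ^+ n * x by rewrite mulr_ge0// ltW.
rewrite /Defs.dyadic_itv /= ler_pdivrMr// ltr_pdivlMr// (mulrC x).
split=> [h|<-]; last by exact: truncn_itv.
exact: truncn_def.
Qed.

Lemma bval_rbit n x : unit_itv x -> bval n (rbit x) = Num.truncn (2 ^+ n * x).
Proof.
move=> /andP[x0 x1]; elim: n => [|n IH] /=.
  by rewrite expr0 mul1r; apply/esym/truncn_def; rewrite x0 x1.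
rewrite IH /rbit; set q := Num.truncn (2 ^+ n.+1 * x).
suff -> : Num.truncn (2 ^+ n * x) = q./2.
  by rewrite -{3}(odd_double_half q) addnC.
have px : 0 <= 2 ^+ n.+1 * x by rewrite mulr_ge0// exprn_ge0.
apply: truncn_def; have /andP[h1 h2] := truncn_itv px; rewrite -/q in h1 h2.
move: h1 h2; rewrite -{1 2}(odd_double_half q) exprS => h1 h2.
set y := 2 ^+ n * x in h1 h2 *; rewrite -mulrA -/y in h1 h2.
move: h1 h2; rewrite -addn1 !natrD -muln2 !natrM.
by case: (odd q) => /= h1 h2; apply/andP; split; lra.
Qed.

Lemma dyadic_itv_sub n i x : (i < 2 ^ n)%N -> @Defs.dyadic_itv R n i x -> unit_itv x.
Proof.
move=> hi; rewrite /Defs.dyadic_itv /= => /andP[h1 h2]; apply/andP; split.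
  by apply: le_trans h1; rewrite divr_ge0// exprn_ge0.
apply: (lt_le_trans h2); rewrite ler_pdivrMr ?exprn_gt0// mul1r -natrX ler_nat.
exact: hi.
Qed.

Lemma itv_ofP (I : dyadic) x :
  @itv_of R I x <-> unit_itv x /\ pre (lvl I) (rbit x) = I.
Proof.
split=> [h|[ux e]].
  have ux : unit_itv x by apply: dyadic_itv_sub h; exact: ltn_ord.
  split=> //; apply: dyadic_eq => //=; rewrite bval_rbit//.
  by move: h; rewrite /itv_of => /dyadic_itvE; apply; case/andP: ux.
rewrite /itv_of; apply/dyadic_itvE; first by case/andP: ux.
rewrite -bval_rbit//; exact: (congr1 (fun J : dyadic => (tagged J : nat)) e).
Qed.

Lemma indic_dyadic n i x : unit_itv x ->
  (\1_(@Defs.dyadic_itv R n i) x : R) = (bval n (rbit x) == i)%:R.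
Proof.
move=> ux; rewrite indicE; congr (nat_of_bool _)%:R.
apply/idP/eqP => [|e].
  rewrite inE => /dyadic_itvE; rewrite bval_rbit//; apply; by case/andP: ux.
by rewrite inE; apply/dyadic_itvE; [case/andP: ux | rewrite -e bval_rbit].
Qed.

Lemma haar_out (I : dyadic) x : ~~ unit_itv x -> haar I x = 0.
Proof.
move=> ux; rewrite /haar !indicE.
rewrite !memNset ?subrr//; move: ux => /negP ux /dyadic_itv_sub h; apply: ux;
  apply: h; have := ltn_ord (tagged I); rewrite expnS; lia.
Qed.

(** The halves of [I] have indices [2i] and [2i + 1] one level down, so they are told apart by the
    digit of [x] at position [lvl I]. *)
Lemma haarE (I : dyadic) x : unit_itv x ->
  haar I x = (I == pre (lvl I) (rbit x))%:R * (-1) ^+ (rbit x (lvl I)).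
Proof.
move=> ux; rewrite /haar !indic_dyadic//=.
have [e|ne] := eqVneq I (pre (lvl I) (rbit x)).
  have -> : (tagged I : nat) = bval (tag I) (rbit x).
    exact: (congr1 (fun J : dyadic => (tagged J : nat)) e).
  rewrite mul1r /lvl; case: (rbit x (tag I)).
    by rewrite addn1 eqn_leq ltnn/= eqxx sub0r expr1.
  by rewrite addn0 eqxx ltn_eqF// subr0.
rewrite mul0r.
have nb : bval (tag I) (rbit x) <> tagged I.
  by move=> e; move/eqP: ne; apply; apply: dyadic_eq.
case: (rbit x (tag I)) => /=.
  have -> : ((bval (tag I) (rbit x)).*2 + 1 == (tagged I).*2)%N = false.
    by apply/eqP; lia.
  have -> : ((bval (tag I) (rbit x)).*2 + 1 == (tagged I).*2.+1)%N = false.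
    by apply/eqP; lia.
  by rewrite subrr.
have -> : ((bval (tag I) (rbit x)).*2 + 0 == (tagged I).*2)%N = false.
  by apply/eqP; lia.
have -> : ((bval (tag I) (rbit x)).*2 + 0 == (tagged I).*2.+1)%N = false.
  by apply/eqP; lia.
by rewrite subrr.
Qed.

(** One level contributes. Written as a sum over levels, a finite Haar expansion at [x] can be
    reorganized along the path of intervals containing [x]. *)
Lemma haar_sum (I : dyadic) x L : unit_itv x -> (lvl I < L)%N ->
  haar I x = \sum_(n < L) (I == pre n (rbit x))%:R * (-1) ^+ (rbit x n).
Proof.
move=> ux hL; rewrite haarE// (bigD1 (Ordinal hL))//= big1 ?addr0//.
move=> n nI; rewrite (_ : (_ == _) = false) ?mul0r//.
apply/eqP => e; move/eqP: nI; apply; apply: val_inj => /=.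
by rewrite e.
Qed.

Lemma rbit_surj (I : dyadic) : exists2 x : R, unit_itv x & pre (lvl I) (rbit x) = I.
Proof.
pose x : R := (tagged I)%:R / 2 ^+ lvl I.
have : @itv_of R I x.
  rewrite /itv_of /Defs.dyadic_itv /= lexx /= ltr_pM2r ?invr_gt0 ?exprn_gt0//.
  by rewrite ltr_nat.
by move=> /itv_ofP[? ?]; exists x.
Qed.

End RealBits.

(** * Uniform averages over finite binary words *)

Definition cube (L : nat) := {ffun 'I_L -> bool}.

Definition ext L (y : cube L) : bits := fun k => oapp y false (insub k).

Definition rest L (s : bits) : cube L := [ffun i : 'I_L => s i].

Lemma ext_ord L (y : cube L) (i : 'I_L) : ext y i = y i.
Proof. by rewrite /ext valK. Qed.

Lemma ext_rest L s : agree L (ext (rest L s)) s.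
Proof. by move=> k kL; rewrite -[k]/(val (Ordinal kL)) ext_ord ffunE. Qed.

Lemma rest_ext L (y : cube L) : rest L (ext y) = y.
Proof. by apply/ffunP => i; rewrite ffunE ext_ord. Qed.

Lemma rest_inj L s s' : rest L s = rest L s' -> agree L s s'.
Proof.
move=> e k kL; have := congr1 (fun y : cube L => y (Ordinal kL)) e.
by rewrite !ffunE.
Qed.

Lemma eq_rest L s s' : agree L s s' -> rest L s = rest L s'.
Proof. by move=> h; apply/ffunP => i; rewrite !ffunE h. Qed.

Lemma ext_inj L (y y' : cube L) : agree L (ext y) (ext y') -> y = y'.
Proof. by move/eq_rest; rewrite !rest_ext. Qed.

Definition setb (k : nat) (b : bool) (s : bits) : bits :=
  fun i => if i == k then b else s i.

Definition flipb (k : nat) (s : bits) : bits := setb k (~~ s k) s.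

Definition xorb_bits (u s : bits) : bits := fun i => s i (+) u i.

Lemma setb_eq k b s : setb k b s k = b.
Proof. by rewrite /setb eqxx. Qed.

Lemma setb_id k s : setb k (s k) s = s.
Proof. by apply/funext => i; rewrite /setb; case: eqP => // ->. Qed.

Section Mean.
Variable R : realType.
Implicit Types g h : bits -> R.

Definition mean (L : nat) g : R := 2 ^- L * \sum_(y : cube L) g (ext y).

Definition dep (A : Type) (L : nat) (g : bits -> A) :=
  forall s s', agree L s s' -> g s = g s'.

Lemma dep_le (A : Type) L L' (g : bits -> A) : (L <= L')%N -> dep L g -> dep L' g.
Proof. by move=> LL hg s s' h; apply: hg; exact: agree_le h. Qed.

Lemma p2gt0 L : (0 : R) < 2 ^+ L.
Proof. by rewrite exprn_gt0. Qed.

Lemma p2V L : 2 ^- L * 2 ^+ L = 1 :> R.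
Proof. by rewrite mulVf// gt_eqF// p2gt0. Qed.

Lemma card_cube L : #|{: cube L}| = (2 ^ L)%N.
Proof. by rewrite card_ffun card_bool card_ord. Qed.

Lemma eq_mean L g h : g =1 h -> mean L g = mean L h.
Proof. by move=> e; rewrite /mean; congr (_ * _); apply: eq_bigr => y _; exact: e. Qed.

Lemma mean_const L c : mean L (fun=> c) = c.
Proof.
rewrite /mean sumr_const card_cube -[c *+ _]mulr_natr natrX mulrCA p2V mulr1//.
Qed.

Lemma meanD L g h : mean L (fun s => g s + h s) = mean L g + mean L h.
Proof. by rewrite /mean big_split mulrDr. Qed.

Lemma meanZ L c g : mean L (fun s => c * g s) = c * mean L g.
Proof. by rewrite /mean -mulr_sumr mulrCA. Qed.

Lemma meanZr L c g : mean L (fun s => g s * c) = mean L g * c.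
Proof. by rewrite /mean -mulr_suml mulrA. Qed.

Lemma le_mean L g h : (forall s, g s <= h s) -> mean L g <= mean L h.
Proof.
move=> gh; rewrite ler_pM2l ?invr_gt0 ?p2gt0//; exact: ler_sum.
Qed.

Lemma mean_ge0 L g : (forall s, 0 <= g s) -> 0 <= mean L g.
Proof. by move=> g0; rewrite -(mean_const L 0); exact: le_mean. Qed.

Lemma norm_mean L g : `|mean L g| <= mean L (fun s => `|g s|).
Proof.
rewrite /mean normrM ger0_norm ?invr_ge0 ?exprn_ge0//.
by rewrite ler_pM2l ?invr_gt0 ?p2gt0// ler_norm_sum.
Qed.

Lemma mean_exchange L L' (g : bits -> bits -> R) :
  mean L (fun s => mean L' (g s)) = mean L' (fun t => mean L (fun s => g s t)).
Proof.
rewrite /mean.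
under eq_bigr do rewrite mulr_sumr.
under [in RHS]eq_bigr do rewrite mulr_sumr.
rewrite exchange_big !mulr_sumr; apply: eq_bigr => y _.
by rewrite !mulr_sumr; apply: eq_bigr => z _; rewrite mulrCA.
Qed.

(** Distinct positions of a uniform word carry independent uniform digits: restriction to them is a
    map between cubes all of whose fibres have the same size. *)
Lemma mean_push L L' (n : nat -> nat) g :
  (forall k l, (k < L)%N -> (l < L)%N -> n k = n l -> k = l) ->
  (forall k, (k < L)%N -> (n k < L')%N) ->
  dep L g -> mean L' (fun s => g (fun k => s (n k))) = mean L g.
Proof.
move=> ninj nlt hg.
pose q (w : cube L') : cube L := rest L (fun k => ext w (n k)).
(* Adding modulo 2 the word supported on the positions [n k] with [v k] true is an involution that
   exchanges the fibre over [v] and the one over 0. *)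
have fibre v : #|[pred w | q w == v]| = #|[pred w | q w == [ffun=> false]]|.
  pose lift v : cube L' :=
    [ffun i : 'I_L' => [exists k : 'I_L, (n k == i) && (v : cube L) k]].
  pose sh w : cube L' := [ffun i => (w : cube L') i (+) lift v i].
  have shK : involutive sh by move=> w; apply/ffunP => i; rewrite !ffunE addbK.
  have shq w : q (sh w) = [ffun k => q w k (+) v k].
    apply/ffunP => k; rewrite !ffunE.
    have nk : (n k < L')%N by exact: nlt.
    rewrite -[n k]/(val (Ordinal nk)) !ext_ord !ffunE; congr (_ (+) _).
    apply/existsP/idP => [[l /andP[/eqP /= e]]|vk].
      by move/ninj: e => e; rewrite (_ : l = k)//; apply: val_inj; apply: e.
    by exists k; rewrite eqxx.
  rewrite -!sum1_card (reindex_inj (inv_inj shK)) /=; apply: eq_bigl => w.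
  rewrite !inE shq; apply/eqP/eqP => e; apply/ffunP => k.
    have := congr1 (fun y : cube L => y k) e; rewrite ffunE.
    have -> : [ffun=> false] k = false :> bool by rewrite ffunE.
    by case: (v k); case: (q w k).
  by rewrite ffunE e ffunE.
set c := #|_| in fibre.
have key h : dep L h -> \sum_(w : cube L') h (fun k => ext w (n k)) =
    c%:R * \sum_(v : cube L) h (ext v).
  move=> hh; rewrite (partition_big q predT)//= mulr_sumr; apply: eq_bigr => v _.
  transitivity (\sum_(w | q w == v) h (ext v)).
    apply: eq_bigr => w /eqP <-; apply: hh => k kL.
    by rewrite ext_rest.
  by rewrite sumr_const -(fibre v) mulr_natl.
(* The test function 1 gives the common fibre size without counting. *)
have := key (fun=> 1) (fun _ _ _ => erefl).
rewrite !sumr_const !card_cube !natrX => e.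
rewrite /mean key// e mulrA; congr (_ * _).
rewrite invfM -mulrA mulrC -mulrA mulfV ?mulr1//.
apply/eqP => c0; move: e; rewrite c0 mul0r => /eqP.
by rewrite gt_eqF// p2gt0.
Qed.

Lemma mean_dep L L' g : (L <= L')%N -> dep L g -> mean L' g = mean L g.
Proof.
move=> LL hg; rewrite -(@mean_push L L' id)// => k kL; exact: leq_trans LL.
Qed.

Lemma mean_inj L (tau : bits -> bits) g :
  (forall s s', agree L (tau s) (tau s') -> agree L s s') ->
  dep L g -> mean L (fun s => g (tau s)) = mean L g.
Proof.
move=> ti hg; rewrite /mean; congr (_ * _).
pose q (y : cube L) : cube L := rest L (tau (ext y)).
have qi : injective q by move=> y y' /rest_inj /ti /ext_inj.
rewrite [RHS](reindex_inj qi)/=; apply: eq_bigr => y _.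
by apply: hg => k kL; rewrite ext_rest.
Qed.

Lemma mean_flip L k g : dep L g -> mean L (fun s => g (flipb k s)) = mean L g.
Proof.
move=> hg; apply: mean_inj => // s s' h i iL.
have := h i iL; rewrite /flipb /setb; case: eqP => // -> .
by move=> /(congr1 negb); rewrite !negbK.
Qed.

Lemma mean_xor L u g :
  dep L g -> mean L (fun s => g (xorb_bits u s)) = mean L g.
Proof.
move=> hg; apply: mean_inj => // s s' h i iL.
by have := h i iL; rewrite /xorb_bits => /(congr1 (addb ^~ (u i))); rewrite !addbK.
Qed.

(** The factor is twice the indicator of [s k = b], the density of the conditional law. In the proof
    each integrand is paired with its flip at [k], and exactly one of the two weights is nonzero. *)
Lemma mean_setb L k b g : (k < L)%N -> dep L g ->
  mean L (fun s => g (setb k b s)) =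
  mean L (fun s => (1 + (-1) ^+ b * (-1) ^+ s k) * g s).
Proof.
move=> kL hg; set h := fun s => _ * g s.
have hh : dep L h by move=> s s' e; rewrite /h (hg _ _ e) e.
apply: (@mulfI _ (2 : R)); first by rewrite pnatr_eq0.
rewrite [RHS]mulr_natl [RHS]mulr2n -{2}(mean_flip k hh) -meanD -meanZ.
apply: eq_mean => s; rewrite /h /flipb setb_eq.
have [e|e] := boolP (s k == b).
  rewrite -(eqP e) setb_id -signr_addb addbb expr0 -signr_addb.
  by rewrite addbN addbb/= expr1; ring.
have e' : b = ~~ s k by move: e; clear; case: (s k); case: b.
by rewrite e' -!signr_addb addbb addNb addbb/= expr1 expr0; ring.
Qed.

Lemma mean_ge_dep L g : dep L g -> forall s, `|g s| <= \sum_(y : cube L) `|g (ext y)|.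
Proof.
move=> hg s; rewrite (bigD1 (rest L s))//= (hg _ _ (@ext_rest L s)).
by rewrite lerDl sumr_ge0.
Qed.

End Mean.

Section RearrangementInvariance.
Variable R : realType.

Definition lift (g : bits -> R) (x : R) : R :=
  if unit_itv x then g (rbit x) else 0.

Lemma big_fset_pre L (G : dyadic -> R) (s : bits) :
  \sum_(I <- [fset pre L (ext y) | y : cube L]%fset) G I * (I == pre L s)%:R
  = G (pre L s).
Proof.
have inA : pre L s \in [fset pre L (ext y) | y : cube L]%fset.
  apply/imfsetP; exists (rest L s) => //; apply: eq_pre => k kL.
  by rewrite ext_rest.
rewrite (bigD1_seq _ inA (fset_uniq _))/= eqxx mulr1 big1 ?addr0// => I.
by move=> /negbTE ->; rewrite mulr0.
Qed.

Lemma lift_V1 L g : dep L g -> V1 (lift g).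
Proof.
move=> hg; exists [fset pre L (ext y) | y : cube L]%fset, (g \o bit).
apply/funext => x; rewrite /lift; case: ifPn => ux.
  transitivity (\sum_(I <- [fset pre L (ext y) | y : cube L]%fset)
     g (bit I) * (I == pre L (rbit x))%:R).
    rewrite (big_fset_pre L (g \o bit))/=.
    by apply: hg => k kL; rewrite bit_pre.
  rewrite big_seq [in RHS]big_seq; apply: eq_bigr => I /imfsetP[y _ eI].
  congr (_ * _); rewrite indicE; congr (nat_of_bool _)%:R.
  apply/eqP/idP => [e|].
    by rewrite inE; apply/itv_ofP; split=> //; rewrite e lvl_pre.
  by rewrite inE => /itv_ofP[_]; rewrite eI lvl_pre => <-.
rewrite big1// => I _; rewrite indicE memNset ?mulr0// => /itv_ofP[h].
by rewrite h in ux.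
Qed.

Lemma measurable_itv_of (I : dyadic) : measurable (@itv_of R I).
Proof.
rewrite (_ : itv_of I = [set` `[(tagged I)%:R / 2 ^+ tag I,
  (tagged I).+1%:R / 2 ^+ tag I[%R]); first exact: measurable_itv.
by apply/seteqP; split=> x; rewrite /itv_of /Defs.dyadic_itv /= in_itv.
Qed.

Lemma lebesgue_itv_of (I : dyadic) :
  lebesgue_measure (@itv_of R I) = (2 ^- lvl I)%:E.
Proof.
rewrite (_ : itv_of I = [set` `[(tagged I)%:R / 2 ^+ tag I,
  (tagged I).+1%:R / 2 ^+ tag I[%R]); last first.
  by apply/seteqP; split=> x; rewrite /itv_of /Defs.dyadic_itv /= in_itv.
rewrite lebesgue_measure_itv /= lte_fin ltr_pM2r ?invr_gt0 ?exprn_gt0//.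
rewrite ltr_nat ltnSn -EFinB -mulrBl -natrB// subSnn mul1r//.
Qed.

(** The unit interval splits into the intervals of level [L], of length 2^-L, on which [lift g] is
    constant. *)
Lemma lebesgue_lift L g (B : set R) : dep L g ->
  lebesgue_measure (`[0, 1[ `&` [set x | B `|lift g x|]) =
  (mean L (fun s => `[< B `|g s| >]%:R))%:E.
Proof.
move=> hg.
pose F (y : cube L) : set R := [set x | @itv_of R (pre L (ext y)) x /\ B `|g (ext y)|].
have FE y : F y = if `[< B `|g (ext y)| >] then @itv_of R (pre L (ext y)) else set0.
  by apply/seteqP; split=> x; rewrite /F /=; case: asboolP => //= ? [].
have -> : `[0, 1[ `&` [set x | B `|lift g x|] = \bigcup_(y in [set: cube L]) F y.
  rewrite unit_itvP; apply/seteqP; split=> x /=.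
    case=> ux; rewrite /lift ux => Bx; exists (rest L (rbit x)) => //.
    split; first by apply/itv_ofP; split=> //; rewrite lvl_pre;
      apply: eq_pre => k kL; rewrite ext_rest.
    by rewrite (hg _ (rbit x))// => k kL; rewrite ext_rest.
  case=> y _ [/itv_ofP[ux /preP e] By]; split=> //; rewrite /lift ux.
  by rewrite (hg _ (ext y)).
rewrite measure_fin_bigcup//; last 2 first.
- move=> y y' _ _ [x [[/itv_ofP[_ /preP e] _] [/itv_ofP[_ /preP e'] _]]].
  by apply: ext_inj => k kL; rewrite -e// -e'.
- by move=> y _; rewrite FE; case: ifP => // _; exact: measurable_itv_of.
rewrite (fsbigE (index_enum (cube L))) ?index_enum_uniq//; last first.
  by move=> y _; rewrite mem_index_enum.
rewrite /mean mulr_sumr -sumEFin.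
apply: eq_big => [y|y _]; first by rewrite in_setT.
rewrite FE; case: asboolP => _; rewrite ?mulr1 ?mulr0 ?measure0//.
exact: lebesgue_itv_of.
exact: finite_finset.
Qed.

Definition NX (X : haar_system_space R) (g : bits -> R) : R := X (lift g).

Lemma NX_equidistributed X L L' g h : dep L g -> dep L' h ->
  (forall u : R -> R, mean L' (fun s => u (h s)) = mean L (fun s => u (g s))) ->
  NX X h = NX X g.
Proof.
move=> hg hh e; apply: hs_norm_rearrangement; [exact: lift_V1 hh|exact: lift_V1 hg|].
move=> B _.
by rewrite (lebesgue_lift B hh) (lebesgue_lift B hg) (e (fun r => `[< B `|r| >]%:R)).
Qed.

Lemma hs_norm0 (X : haar_system_space R) : X (fun=> 0) = 0.
Proof.
have V0 : V1 (fun=> 0 : R).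
  by exists fset0, (fun=> 0); apply/funext => x; rewrite big_seq_fset0.
have := hs_normZ X 0 V0; rewrite normr0.
have -> : (fun x : R => 0 * (fun=> 0) x) = (fun=> 0 : R).
  by apply/funext => x; rewrite mul0r.
by rewrite mul0r.
Qed.

Lemma NX_eq0 X L g : dep L g -> NX X g = 0 -> forall x : R, unit_itv x -> g (rbit x) = 0.
Proof.
move=> hg /(hs_norm_eq0 (lift_V1 hg)) e x ux.
by have := congr1 (fun f => f x) e; rewrite /lift ux.
Qed.

End RearrangementInvariance.

(** * The norm in terms of binary digits *)

Section SignExpectation.
Variable R : realType.

(** The law of the first [L] signs along a path of the tree: they sit at distinct intervals, so they
    are either all 1 or independent and uniform. *)
Definition cms (S : sign_choice) (L : nat) (e : cube L) : R :=
  match S with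
  | AllOnes => (e == [ffun=> false])%:R
  | AllSigns => 2 ^- L
  end.

Definition sign_mean (S : sign_choice) (L : nat) (g : bits -> R) : R :=
  \sum_(e : cube L) cms S e * g (ext e).

Lemma eq_sign_mean S L g h : g =1 h -> sign_mean S L g = sign_mean S L h.
Proof. by move=> e; apply: eq_bigr => y _; rewrite e. Qed.

Lemma sign_mean_all L g : sign_mean AllSigns L g = mean L g.
Proof. by rewrite /sign_mean -mulr_sumr. Qed.

Lemma sign_mean_one L g : dep L g -> sign_mean AllOnes L g = g (fun=> false).
Proof.
move=> hg; rewrite /sign_mean (bigD1 [ffun=> false])//= eqxx mul1r big1 ?addr0.
  by apply: hg => k kL; rewrite -[k]/(val (Ordinal kL)) ext_ord ffunE.
by move=> e /negbTE ->; rewrite mul0r.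
Qed.

Lemma sign_mean_push S L L' (n : nat -> nat) g :
  (forall k l, (k < L)%N -> (l < L)%N -> n k = n l -> k = l) ->
  (forall k, (k < L)%N -> (n k < L')%N) ->
  dep L g -> sign_mean S L' (fun s => g (fun k => s (n k))) = sign_mean S L g.
Proof.
move=> ninj nlt hg; case: S; last by rewrite !sign_mean_all (mean_push ninj).
rewrite !sign_mean_one// => s s' h; apply: hg => k kL; apply: h; exact: nlt.
Qed.

Lemma sign_mean_const S L c : sign_mean S L (fun=> c) = c.
Proof. by case: S; rewrite ?sign_mean_one// sign_mean_all mean_const. Qed.

Definition path_signs L (s : bits) (w : signs) : cube L :=
  [ffun i : 'I_L => (w : dyadic -> bool) (pre i s)].

Lemma measurable_coordinate (I : dyadic) (b : bool) :
  measurable [set w : signs | (w : dyadic -> bool) I = b].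
Proof.
have mt : measurable [set w : signs | (w : dyadic -> bool) I = true].
  by apply: sub_sigma_algebra; exists I.
case: b => //.
rewrite (_ : mkset _ = ~` [set w : signs | (w : dyadic -> bool) I = true]).
  exact: measurableC.
by apply/seteqP; split=> w /=; case: (w I).
Qed.

Lemma measurable_path_signs L s (e : cube L) :
  measurable [set w : signs | path_signs L s w = e].
Proof.
rewrite (_ : mkset _ = \bigcap_(i in [set: 'I_L])
    [set w : signs | (w : dyadic -> bool) (pre i s) = e i]).
  by apply: fin_bigcap_measurable => [|i _];
    [exact: finite_finset|exact: measurable_coordinate].
apply/seteqP; split=> w /= => [<- i _|h] /=; first by rewrite ffunE.
by apply/ffunP => i; rewrite ffunE; exact: h.
Qed.

Lemma cylinder_mass_path S L s (e : cube L) :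
  cylinder_mass R S [fset pre (nat_of_ord i) s | i : 'I_L]%fset (fun I => ext e (lvl I))
  = cms S e.
Proof.
case: S => /=.
  congr (nat_of_bool _)%:R; apply/allP/eqP => [h|-> I].
    apply/ffunP => i; rewrite ffunE; apply/negbTE.
    by rewrite -(ext_ord e) -(lvl_pre i s); apply: h; apply/imfsetP; exists i.
  move=> /imfsetP[i _ ->]; rewrite lvl_pre ext_ord ffunE//.
have inj : injective (fun i : 'I_L => pre i s).
  by move=> i j /(congr1 lvl); rewrite !lvl_pre; exact: val_inj.
by rewrite (card_imfset _ _ inj)/= -cardE card_ord.
Qed.

Section Expectation.
Variables (S1 S2 : sign_choice) (P : probability (signs * signs)%type R).
Hypothesis hP : is_haar_measure S1 S2 P.

Lemma haar_measure_cylinder L s t (e d : cube L) :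
  P [set w | path_signs L s w.1 = e /\ path_signs L t w.2 = d] =
  (cms S1 e * cms S2 d)%:E.
Proof.
rewrite -(cylinder_mass_path S1 s) -(cylinder_mass_path S2 t) -hP; congr (P _).
apply/seteqP; split=> w /= [h1 h2]; split.
- by move=> I /imfsetP[i _ ->]; rewrite lvl_pre ext_ord -h1 ffunE.
- by move=> I /imfsetP[i _ ->]; rewrite lvl_pre ext_ord -h2 ffunE.
- by apply/ffunP => i; rewrite ffunE h1 ?lvl_pre ?ext_ord//; apply/imfsetP; exists i.
- by apply/ffunP => i; rewrite ffunE h2 ?lvl_pre ?ext_ord//; apply/imfsetP; exists i.
Qed.

(** Only the signs on two paths of length [L] enter, so the integrand is a finite combination of
    indicators of cylinders, whose masses are prescribed. *)
Lemma expectation_path_signs L s t (G : cube L -> cube L -> R) :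
  (forall e d, 0 <= G e d) ->
  ('E_P[fun w => G (path_signs L s w.1) (path_signs L t w.2)])%E =
  (\sum_(p : cube L * cube L) cms S1 p.1 * cms S2 p.2 * G p.1 p.2)%:E.
Proof.
move=> G0; rewrite unlock.
pose C (p : cube L * cube L) := [set w : signs * signs |
  path_signs L s w.1 = p.1 /\ path_signs L t w.2 = p.2].
have mC p : measurable (C p).
  rewrite (_ : C p = [set w | path_signs L s w = p.1] `*`
    [set w | path_signs L t w = p.2]); last by apply/seteqP; split=> w.
  by apply: measurableX; exact: measurable_path_signs.
transitivity (\int[P]_w (\sum_(p : cube L * cube L) (G p.1 p.2 * \1_(C p) w)%:E))%E.
  apply: eq_integral => w _; rewrite sumEFin; congr (_%:E).
  rewrite (bigD1 (path_signs L s w.1, path_signs L t w.2))//= big1 ?addr0.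
    by rewrite indicE mem_set// mulr1.
  move=> p np; rewrite indicE memNset ?mulr0// => -[e1 e2].
  by move/eqP: np; apply; case: p e1 e2 => /= a b -> ->.
rewrite ge0_integral_sum//; last 2 first.
- move=> p; apply/measurable_EFinP; apply: measurable_funM => //.
- by move=> p w _; rewrite lee_fin mulr_ge0// indicE.
rewrite -sumEFin; apply: eq_bigr => p _.
rewrite (integralZl_indic _ (fun=> C p))//.
  rewrite integral_indic// setIT [RHS]EFinM muleC; congr (_ * _)%E.
  exact: haar_measure_cylinder.
by move=> /(le_lt_trans (G0 _ _)); rewrite ltxx.
Qed.

End Expectation.
End SignExpectation.

Section NormFormula.
Variable R : realType.
Local Notation V := (V2 R).

Definition supp_lt (L : nat) (f : V) :=
  forall K M, (L <= lvl K)%N || (L <= lvl M)%N -> mcoeff (K, M) f = 0.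

Lemma supp_lt_msupp L f p : supp_lt L f -> p \in msupp f ->
  (lvl p.1 < L)%N /\ (lvl p.2 < L)%N.
Proof.
case: p => K M h; rewrite -mcoeff_neq0 => f0 /=.
by split; rewrite ltnNge; apply: contraNN f0 => hL; apply/eqP; apply: h;
  rewrite hL ?orbT.
Qed.

Lemma supp_lt_exists f : exists L, supp_lt L f.
Proof.
pose lv (p : dyadic * dyadic) := maxn (lvl p.1) (lvl p.2).
exists (\max_(p <- msupp f) lv p).+1%N => K M h.
apply/eqP; rewrite mcoeff_eq0; apply/negP => pf.
have := leq_bigmax_seq (P := predT) (F := lv) _ pf isT.
set b := (\max_(_ <- _) _)%N in h *; rewrite /lv /=.
by move: h; lia.
Qed.

(** The term of levels [(n, m)] in the Haar expansion of [f] at the point with digits [s], [t]. *)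
Definition path_coef (f : V) (s t : bits) (n m : nat) : R :=
  mcoeff (pre n s, pre m t) f * ((-1) ^+ s n * (-1) ^+ t m).

(** For [f] supported below level [L], this is [|f|] when the signs are trivial and, by Khintchine's
    inequality, comparable to the square function of [f] when both are random. *)
Definition square_fun (S1 S2 : sign_choice) (L : nat) (f : V) (s t : bits) : R :=
  sign_mean S1 L (fun e => sign_mean S2 L (fun d =>
    `| \sum_(n < L) \sum_(m < L) (-1) ^+ e n * (-1) ^+ d m * path_coef f s t n m |)).

Lemma msupp_sum (f : V) (G : dyadic * dyadic -> R) q :
  \sum_(p <- msupp f) mcoeff p f * (p == q)%:R * G p = mcoeff q f * G q.
Proof.
have [qf|qf] := boolP (q \in msupp f).
  rewrite (bigD1_seq _ qf (fset_uniq _))/= eqxx mulr1 big1 ?addr0// => p.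
  by move=> /negbTE ->; rewrite mulr0 mul0r.
rewrite mcoeff_outdom// mul0r big_seq big1// => p pf.
rewrite (_ : (p == q) = false) ?mulr0 ?mul0r//.
by apply/eqP => e; rewrite -e pf in qf.
Qed.

Lemma haar_expansion L (f : V) (x y : R) (w1 w2 : dyadic -> bool) :
  supp_lt L f -> unit_itv x -> unit_itv y ->
  \sum_(p <- msupp f) (-1) ^+ w1 p.1 * (-1) ^+ w2 p.2 * mcoeff p f
     * haar p.1 x * haar p.2 y =
  \sum_(n < L) \sum_(m < L) (-1) ^+ w1 (pre n (rbit x)) * (-1) ^+ w2 (pre m (rbit y))
     * path_coef f (rbit x) (rbit y) n m.
Proof.
move=> hf ux uy; set s := rbit x; set t := rbit y.
transitivity (\sum_(p <- msupp f) \sum_(n < L) \sum_(m < L)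
   mcoeff p f * (p == (pre n s, pre m t))%:R *
   ((-1) ^+ w1 p.1 * (-1) ^+ w2 p.2 * ((-1) ^+ s n * (-1) ^+ t m))).
  rewrite big_seq [RHS]big_seq; apply: eq_bigr => p /(supp_lt_msupp hf)[h1 h2].
  rewrite (haar_sum ux h1) (haar_sum uy h2) -mulrA big_distrlr mulr_sumr.
  apply: eq_bigr => n _; rewrite mulr_sumr.
  apply: eq_bigr => m _; case: p h1 h2 => K M _ _ /=.
  rewrite xpair_eqE -mulnb natrM /s /t; ring.
rewrite exchange_big; apply: eq_bigr => n _.
rewrite exchange_big; apply: eq_bigr => m _.
rewrite msupp_sum /path_coef; ring.
Qed.

Lemma path_coef_agree f n m s s' t t' : agree n.+1 s s' -> agree m.+1 t t' ->
  path_coef f s t n m = path_coef f s' t' n m.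
Proof.
move=> hs ht; rewrite /path_coef (eq_pre (agreeS hs)) (eq_pre (agreeS ht)).
by rewrite hs// ht.
Qed.

Lemma square_fun_agree S1 S2 L f s s' t t' : agree L s s' -> agree L t t' ->
  square_fun S1 S2 L f s t = square_fun S1 S2 L f s' t'.
Proof.
move=> hs ht; apply: eq_sign_mean => e; apply: eq_sign_mean => d.
congr (`| _ |); apply: eq_bigr => n _; apply: eq_bigr => m _; congr (_ * _).
by apply: path_coef_agree; [apply: agree_le hs|apply: agree_le ht].
Qed.

Variables (X Y : haar_system_space R) (S1 S2 : sign_choice).
Variable P : probability (signs * signs)%type R.
Hypothesis hP : is_haar_measure S1 S2 P.

Lemma hardy_normE L f : supp_lt L f -> hardy_norm P X Y f =
  NX X (fun s => NX Y (fun t => square_fun S1 S2 L f s t)).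
Proof.
move=> hf; rewrite /hardy_norm /NX; congr (X _); apply/funext => x.
rewrite {1}/lift; case: ifPn => ux; last first.
  rewrite -[RHS](hs_norm0 Y); congr (Y _); apply/funext => y.
  rewrite [X in fine X](_ : _ = 0)%E// unlock integral0_eq// => w _.
  rewrite big1 ?normr0// => p _.
  by rewrite (haar_out _ ux) mulr0 mul0r.
congr (Y _); apply/funext => y; rewrite /lift; case: ifPn => uy; last first.
  rewrite [X in fine X](_ : _ = 0)%E// unlock integral0_eq// => w _.
  rewrite big1 ?normr0// => p _.
  by rewrite (haar_out _ uy) mulr0.
pose G (e d : cube L) := `| \sum_(n < L) \sum_(m < L)
   (-1) ^+ e n * (-1) ^+ d m * path_coef f (rbit x) (rbit y) n m |.
rewrite [X in fine X](_ : _ = 'E_P[fun w => G (path_signs L (rbit x) w.1)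
  (path_signs L (rbit y) w.2)])%E; last first.
  congr expectation; apply/funext => w; rewrite /G (haar_expansion _ _ hf)//.
  congr (`| _ |); apply: eq_bigr => n _; apply: eq_bigr => m _.
  by rewrite /path_signs !ffunE.
rewrite (expectation_path_signs hP)/=; last by move=> e d; exact: normr_ge0.
rewrite /square_fun /sign_mean -(pair_bigA _ (fun e d =>
  cms R S1 e * cms R S2 d * G e d))/=.
apply: eq_bigr => e _; rewrite mulr_sumr; apply: eq_bigr => d _.
rewrite mulrA; congr (_ * `| _ |); apply: eq_bigr => n _; apply: eq_bigr => m _.
by rewrite !ext_ord.
Qed.

(* [mp L L' phi]: [phi] maps the uniform measure on words of length [L'] to the
   uniform measure on words of length [L]. *)
Definition mp (L L' : nat) (phi : bits -> bits) :=
  (forall s s', agree L' s s' -> agree L (phi s) (phi s')) /\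
  forall g : bits -> R, dep L g -> mean L' (fun s => g (phi s)) = mean L g.

Lemma NX_mp (W : haar_system_space R) L L' phi (g : bits -> R) :
  mp L L' phi -> dep L g -> NX W (fun s => g (phi s)) = NX W g.
Proof.
move=> [h1 h2] hg; apply: (@NX_equidistributed R W L L') => //.
  by move=> s s' /h1; exact: hg.
by move=> u; rewrite (h2 (u \o g))// => s s' /hg /= ->.
Qed.

(** Rearrangement invariance is applied to the outer norm and then, at each fixed [s], to the inner
    one. Both kinds of isometries, the tree automorphisms and [spread], come from this lemma. *)
Lemma hardy_norm_mp L L' phi psi f f' :
  supp_lt L f -> supp_lt L' f' -> mp L L' phi -> mp L L' psi ->
  (forall s t, square_fun S1 S2 L' f' s t = square_fun S1 S2 L f (phi s) (psi t)) ->
  hardy_norm P X Y f' = hardy_norm P X Y f.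
Proof.
move=> hf hf' hphi hpsi e; rewrite (hardy_normE hf) (hardy_normE hf').
rewrite -(@NX_mp X L L' phi (fun s => NX Y (fun t => square_fun S1 S2 L f s t)))//; last first.
  move=> s s' h /=; congr (NX Y _); apply/funext => t.
  exact: (square_fun_agree _ _ _ h (fun _ _ => erefl)).
congr (NX X _); apply/funext => s.
rewrite -(@NX_mp Y L L' psi (fun t => square_fun S1 S2 L f (phi s) t))//; last by move=> t t' h; exact: (square_fun_agree _ _ _ (fun _ _ => erefl) h).
by congr (NX Y _); apply/funext => t; rewrite e.
Qed.

End NormFormula.

HB.lock Definition lin (R : realType) (W : lmodType R)
    (g : dyadic * dyadic -> W) (f : V2 R) : W :=
  \sum_(p <- msupp f) mcoeff p f *: g p.

HB.lock Definition coef (R : realType) (f : V2 R) (K M : dyadic) : R :=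
  mcoeff (K, M) f.

Section LinearMaps.
Variable R : realType.
Local Notation V := (V2 R).

Definition lin_map (U W : lmodType R) (phi : U -> W) :=
  forall (a : R) u v, phi (a *: u + v) = a *: phi u + phi v.

Section LinMapTheory.
Variables (U W : lmodType R) (phi : U -> W).
Hypothesis hphi : lin_map phi.

Lemma lin_map0 : phi 0 = 0.
Proof. by have := hphi (-1) 0 0; rewrite scaler0 addr0 scaleN1r addNr. Qed.

Lemma lin_mapZ a u : phi (a *: u) = a *: phi u.
Proof. by rewrite -[a *: u]addr0 hphi lin_map0 addr0. Qed.

Lemma lin_mapD u v : phi (u + v) = phi u + phi v.
Proof. by have := hphi 1 u v; rewrite !scale1r. Qed.

Lemma lin_mapB u v : phi (u - v) = phi u - phi v.
Proof. by rewrite lin_mapD -scaleN1r lin_mapZ scaleN1r. Qed.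

Lemma lin_map_sum (I : Type) (r : seq I) (Q : pred I) (F : I -> U) :
  phi (\sum_(i <- r | Q i) F i) = \sum_(i <- r | Q i) phi (F i).
Proof. exact: (big_morph phi lin_mapD lin_map0). Qed.

End LinMapTheory.

Lemma lin_map_comp (U1 U2 U3 : lmodType R) (phi : U2 -> U3) (psi : U1 -> U2) :
  lin_map phi -> lin_map psi -> lin_map (phi \o psi).
Proof. by move=> h1 h2 a u v; rewrite /= h2 h1. Qed.

Lemma lin_widen (W : lmodType R) (g : dyadic * dyadic -> W) (f : V)
    (A : {fset dyadic * dyadic}) : (msupp f `<=` A)%fset ->
  lin g f = \sum_(p <- A) mcoeff p f *: g p.
Proof.
move=> fA; rewrite unlock (big_fset_incl _ fA)// => p _ /mcoeff_outdom ->.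
by rewrite scale0r.
Qed.

Lemma lin_lin_map (W : lmodType R) (g : dyadic * dyadic -> W) : lin_map (lin g).
Proof.
move=> a u v; pose A := (msupp u `|` msupp v `|` msupp (a *: u + v))%fset.
have uA : (msupp u `<=` A)%fset by rewrite /A -fsetUA fsubsetUl.
have vA : (msupp v `<=` A)%fset by rewrite /A -fsetUA fsetUCA fsubsetUl.
have wA : (msupp (a *: u + v) `<=` A)%fset by rewrite /A fsubsetUr.
rewrite (lin_widen _ uA) (lin_widen _ vA) (lin_widen _ wA) scaler_sumr -big_split.
by apply: eq_bigr => p _ /=; rewrite mcoeffD mcoeffZ scalerDl scalerA.
Qed.

Lemma mcoeff_hk I J K M : mcoeff (K, M) (hk R I J) = ((I == K) && (J == M))%:R.
Proof. by rewrite /hk mcoeffU xpair_eqE. Qed.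

Lemma lin_hk (W : lmodType R) (g : dyadic * dyadic -> W) I J :
  lin g (hk R I J) = g (I, J).
Proof.
rewrite unlock /hk msuppU oner_eq0 big_seq_fset1 mcoeffUU scale1r//.
Qed.

Lemma hk_expansion (f : V) :
  f = \sum_(p <- msupp f) mcoeff p f *: hk R p.1 p.2.
Proof.
apply/malgP => q; rewrite (raddf_sum (mcoeff q)).
rewrite -[LHS]mulr1 -(msupp_sum f (fun=> 1)); apply: eq_bigr => -[K M] _ /=.
rewrite mcoeffZ; case: q => K' M'; rewrite mcoeff_hk mulr1 xpair_eqE//.
Qed.

Lemma lin_map_ext (W : lmodType R) (phi psi : V -> W) (f : V) :
  lin_map phi -> lin_map psi ->
  (forall p, p \in msupp f -> phi (hk R p.1 p.2) = psi (hk R p.1 p.2)) ->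
  phi f = psi f.
Proof.
move=> h1 h2 e; rewrite [f]hk_expansion (lin_map_sum h1) (lin_map_sum h2).
rewrite big_seq [RHS]big_seq; apply: eq_bigr => p pf.
by rewrite (lin_mapZ h1) (lin_mapZ h2) e.
Qed.

Lemma coefE (f : V) K M : coef f K M = mcoeff (K, M) f.
Proof. by rewrite unlock. Qed.

Lemma coef_lin K M : lin_map (fun f : V => coef f K M : R^o).
Proof. by move=> a u v; rewrite !coefE mcoeffD mcoeffZ. Qed.

Lemma coefD (f g : V) K M : coef (f + g) K M = coef f K M + coef g K M.
Proof. exact: (lin_mapD (coef_lin K M)). Qed.

Lemma coefB (f g : V) K M : coef (f - g) K M = coef f K M - coef g K M.
Proof. exact: (lin_mapB (coef_lin K M)). Qed.

Lemma coefZ a (f : V) K M : coef (a *: f) K M = a * coef f K M.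
Proof. exact: (lin_mapZ (coef_lin K M)). Qed.

Lemma coef0 K M : coef (0 : V) K M = 0.
Proof. exact: (lin_map0 (coef_lin K M)). Qed.

Lemma coef_sum (I : Type) (r : seq I) (Q : pred I) (F : I -> V) K M :
  coef (\sum_(i <- r | Q i) F i) K M = \sum_(i <- r | Q i) coef (F i) K M.
Proof. exact: (lin_map_sum (coef_lin K M)). Qed.

Lemma coef_hk I J K M : coef (hk R I J) K M = ((I == K) && (J == M))%:R.
Proof. by rewrite coefE mcoeff_hk. Qed.

Lemma coef_ext (f g : V) : (forall K M, coef f K M = coef g K M) -> f = g.
Proof. by move=> h; apply/malgP => -[K M]; rewrite -!coefE. Qed.

Lemma supp_lt_coef L (f : V) K M : supp_lt L f -> (L <= lvl K)%N || (L <= lvl M)%N ->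
  coef f K M = 0.
Proof. by move=> h /h; rewrite coefE. Qed.

Lemma lin_map_path_coef s t n m :
  lin_map (fun f : V => path_coef f s t n m : R^o).
Proof.
by move=> a u v; rewrite /path_coef mcoeffD mcoeffZ mulrDl -mulrA.
Qed.

Lemma path_coef_hk I J s t n m : path_coef (hk R I J) s t n m =
  (I == pre n s)%:R * (-1) ^+ s n * ((J == pre m t)%:R * (-1) ^+ t m).
Proof. rewrite /path_coef mcoeff_hk -mulnb natrM; ring. Qed.

Lemma supp_lt_hk I J L : (lvl I < L)%N -> (lvl J < L)%N -> supp_lt L (hk R I J).
Proof.
move=> iL jL K M h; rewrite mcoeff_hk.
case: eqP => [e|//]; case: eqP => [e'|//]; subst; move: h; lia.
Qed.

Lemma supp_lt0 L : supp_lt L (0 : V).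
Proof. by move=> K M _; rewrite mcoeff0. Qed.

Lemma supp_ltD L (f g : V) : supp_lt L f -> supp_lt L g -> supp_lt L (f + g).
Proof. by move=> h1 h2 K M h; rewrite mcoeffD h1// h2// addr0. Qed.

Lemma supp_ltZ L a (f : V) : supp_lt L f -> supp_lt L (a *: f).
Proof. by move=> h1 K M h; rewrite mcoeffZ h1// mulr0. Qed.

Lemma supp_lt_sum L (I : Type) (r : seq I) (Q : pred I) (F : I -> V) :
  (forall i, Q i -> supp_lt L (F i)) -> supp_lt L (\sum_(i <- r | Q i) F i).
Proof.
by move=> h; apply: (big_ind (supp_lt L)) => //;
  [exact: supp_lt0|exact: supp_ltD].
Qed.

Lemma supp_lt_lin L L' (g : dyadic * dyadic -> V) f : supp_lt L f ->
  (forall p, (lvl p.1 < L)%N -> (lvl p.2 < L)%N -> supp_lt L' (g p)) ->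
  supp_lt L' (lin g f).
Proof.
move=> hf hg; rewrite unlock big_seq; apply: supp_lt_sum => p /(supp_lt_msupp hf)[? ?].
exact/supp_ltZ/hg.
Qed.

End LinearMaps.

(** * Tree automorphisms and multipliers *)

Definition act_stream (gam : dyadic -> bool) (s : bits) : bits :=
  fun k => s k (+) gam (pre k s).

Definition act (gam : dyadic -> bool) (I : dyadic) : dyadic :=
  pre (lvl I) (act_stream gam (bit I)).

Lemma act_stream_agree gam n s s' :
  agree n s s' -> agree n (act_stream gam s) (act_stream gam s').
Proof.
move=> h k kn; rewrite /act_stream h//; congr (_ (+) gam _).
by apply: eq_pre; apply: agree_le h; exact: ltnW.
Qed.

(** Digits are decoded in turn: the first [n] of them determine the swap applied to the next. *)
Lemma act_stream_agree_inj gam n s s' :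
  agree n (act_stream gam s) (act_stream gam s') -> agree n s s'.
Proof.
elim: n => [|n IH] h //= k; rewrite ltnS leq_eqVlt => /orP[/eqP ->|kn].
  have := h n (ltnSn n); rewrite /act_stream (eq_pre (IH (agreeS h))).
  by move=> /(congr1 (addb ^~ (gam (pre n s')))); rewrite !addbK.
exact: IH (agreeS h) k kn.
Qed.

Lemma act_pre gam n s : act gam (pre n s) = pre n (act_stream gam s).
Proof.
apply: eq_pre; apply: act_stream_agree => k; rewrite lvl_pre; exact: bit_pre.
Qed.

Lemma lvl_act gam I : lvl (act gam I) = lvl I. Proof. by []. Qed.

Lemma act_inj gam : injective (act gam).
Proof.
move=> I J e; have el : lvl I = lvl J := congr1 lvl e.
rewrite -(pre_bit I) -(pre_bit J) el; apply: eq_pre.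
apply: (@act_stream_agree_inj gam); apply/preP.
by move: e; rewrite /act el.
Qed.

(* Composition with the automorphism of the dyadic tree that swaps the two
   halves of every interval in [gam], in the first variable, and in [gam'], in
   the second one; a Haar function changes sign when its halves are swapped. *)
HB.lock Definition tree_op (R : realType) (gam gam' : dyadic -> bool) (f : V2 R) :
    V2 R :=
  lin (fun p => ((-1) ^+ gam p.1 * (-1) ^+ gam' p.2)
                  *: hk R (act gam p.1) (act gam' p.2)) f.

Section TreeAutomorphism.
Variable R : realType.
Local Notation V := (V2 R).
Variables (X Y : haar_system_space R) (S1 S2 : sign_choice).
Variable P : probability (signs * signs)%type R.
Hypothesis hP : is_haar_measure S1 S2 P.

Lemma tree_op_lin gam gam' : lin_map (@tree_op R gam gam').
Proof. by move=> a u v; rewrite unlock lin_lin_map. Qed.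

Lemma tree_op_hk gam gam' I J : tree_op gam gam' (hk R I J) =
  ((-1) ^+ gam I * (-1) ^+ gam' J) *: hk R (act gam I) (act gam' J).
Proof. by rewrite unlock lin_hk. Qed.

Lemma mp_act_stream gam L : mp R L L (act_stream gam).
Proof.
split=> [s s'|g hg]; first exact: act_stream_agree.
by apply: mean_inj => // s s'; exact: act_stream_agree_inj.
Qed.

(** The sign that [tree_op] puts on a coefficient cancels the one from the flipped digit. *)
Lemma path_coef_tree_op gam gam' (f : V) s t n m :
  path_coef (tree_op gam gam' f) (act_stream gam s) (act_stream gam' t) n m =
  path_coef f s t n m.
Proof.
apply: (@lin_map_ext _ R^o
  (fun f => path_coef (tree_op gam gam' f) (act_stream gam s) (act_stream gam' t) n m)
  (fun f => path_coef f s t n m) f).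
- exact: (lin_map_comp (lin_map_path_coef _ _ _ _) (@tree_op_lin _ _)).
- exact: lin_map_path_coef.
move=> -[I J] _; rewrite tree_op_hk (lin_mapZ (lin_map_path_coef _ _ _ _)).
rewrite !path_coef_hk /= -!act_pre !(inj_eq (@act_inj _)).
rewrite /act_stream !signr_addb.
have [->|_] := eqVneq I (pre n s); last by rewrite !mul0r scaler0.
have [->|_] := eqVneq J (pre m t); last by rewrite !(mul0r, mulr0) scaler0.
rewrite !mul1r; case: (gam _); case: (gam' _);
  rewrite ?(expr0, expr1) /GRing.scale /=; ring.
Qed.

Lemma tree_op_isometry gam gam' (f : V) :
  hardy_norm P X Y (tree_op gam gam' f) = hardy_norm P X Y f.
Proof.
have [L hf] := supp_lt_exists f.
apply/esym; apply: (@hardy_norm_mp R X Y S1 S2 P hP L L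
  (act_stream gam) (act_stream gam') (tree_op gam gam' f) f) => //;
  [|exact: mp_act_stream..|].
  rewrite unlock; apply: supp_lt_lin hf _ => -[I J] /= iL jL; apply: supp_ltZ.
  by apply: supp_lt_hk; rewrite lvl_act.
move=> s t; apply: eq_sign_mean => e; apply: eq_sign_mean => d.
congr (`| _ |); apply: eq_bigr => n _; apply: eq_bigr => m _.
by rewrite path_coef_tree_op.
Qed.

End TreeAutomorphism.

(** Inclusion of the interval [K] in [I]. *)
Definition below (I K : dyadic) : bool :=
  (lvl I <= lvl K)%N && (pre (lvl I) (bit K) == I).

HB.lock Definition mult (R : realType) (e : dyadic -> dyadic -> R) (f : V2 R) :
    V2 R :=
  lin (fun p => e p.1 p.2 *: hk R p.1 p.2) f.

Section Multipliers.
Variable R : realType.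
Local Notation V := (V2 R).
Implicit Types (e : dyadic -> dyadic -> R) (f : V).

Lemma mult_lin e : lin_map (mult e).
Proof. by move=> a u v; rewrite unlock lin_lin_map. Qed.

Lemma mult_hk e I J : mult e (hk R I J) = e I J *: hk R I J.
Proof. by rewrite unlock lin_hk. Qed.

Lemma coef_mult e f K M : coef (mult e f) K M = e K M * coef f K M.
Proof.
apply: (@lin_map_ext _ R^o (fun f => coef (mult e f) K M)
  (fun f => e K M * coef f K M : R^o) f).
- exact: (lin_map_comp (@coef_lin R K M) (@mult_lin e)).
- by move=> a u v; rewrite coefD coefZ mulrDr mulrCA.
move=> [I J] _; rewrite mult_hk coefZ coef_hk.
by case: eqP => [->|_]; [case: eqP => [->|_]|]; rewrite ?mulr0.
Qed.

Lemma multD e e' f : mult (fun K M => e K M + e' K M) f = mult e f + mult e' f.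
Proof. by apply: coef_ext => K M; rewrite coefD !coef_mult mulrDl. Qed.

Lemma multZ a e f : mult (fun K M => a * e K M) f = a *: mult e f.
Proof. by apply: coef_ext => K M; rewrite coefZ !coef_mult mulrA. Qed.

Lemma mult_comp e e' f : mult e (mult e' f) = mult (fun K M => e K M * e' K M) f.
Proof. by apply: coef_ext => K M; rewrite !coef_mult mulrA. Qed.

Lemma mult1 f : mult (fun _ _ => 1) f = f.
Proof. by apply: coef_ext => K M; rewrite coef_mult mul1r. Qed.

Lemma mult_local L e e' f : supp_lt L f ->
  (forall K M, (lvl K < L)%N -> (lvl M < L)%N -> e K M = e' K M) ->
  mult e f = mult e' f.
Proof.
move=> hf h; apply: coef_ext => K M; rewrite !coef_mult.
have [hK|hK] := ltnP (lvl K) L; last by rewrite (supp_lt_coef hf) ?hK// !mulr0.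
have [hM|hM] := ltnP (lvl M) L; last by rewrite (supp_lt_coef hf) ?hM ?orbT// !mulr0.
by rewrite h.
Qed.

Lemma eq_mult e e' f : (forall K M, e K M = e' K M) -> mult e f = mult e' f.
Proof. by move=> h; apply: coef_ext => K M; rewrite !coef_mult h. Qed.

Section Bounds.
Variable N : V -> R.
Hypothesis ND : forall f g : V, N (f + g) <= N f + N g.
Hypothesis NZ : forall a f, N (a *: f) = `|a| * N f.
Hypothesis NT : forall gam gam' f, N (tree_op gam gam' f) = N f.

Lemma N0 : N 0 = 0.
Proof. by rewrite -(scale0r (0 : V)) NZ normr0 mul0r. Qed.

Lemma N_ge0 f : 0 <= N f.
Proof.
have := ND f (- f); rewrite subrr N0 -scaleN1r NZ normrN normr1 mul1r.
by move=> h; rewrite -(@pmulrn_lge0 _ _ 2)// mulr2n.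
Qed.

Lemma N_sum (I : Type) (r : seq I) (Q : pred I) (F : I -> V) :
  N (\sum_(i <- r | Q i) F i) <= \sum_(i <- r | Q i) N (F i).
Proof.
apply: (big_ind2 (fun f x => N f <= x)) => //; first by rewrite N0.
by move=> f x g y h1 h2; apply: (le_trans (ND _ _)); exact: lerD.
Qed.

Definition mult_bound e (c : R) := forall f, N (mult e f) <= c * N f.

Lemma mult_bound_le e c c' : c <= c' -> mult_bound e c -> mult_bound e c'.
Proof. by move=> cc h f; apply: (le_trans (h f)); rewrite ler_wpM2r ?N_ge0. Qed.

Lemma eq_mult_bound e e' c :
  (forall K M, e K M = e' K M) -> mult_bound e c -> mult_bound e' c.
Proof. by move=> ee h f; rewrite -(eq_mult f ee). Qed.

(** Every [f] involves finitely many levels; what matters is that [c] does not depend on [L]. *)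
Lemma mult_bound_local e c :
  (forall L, exists2 e', mult_bound e' c &
     forall K M, (lvl K < L)%N -> (lvl M < L)%N -> e K M = e' K M) ->
  mult_bound e c.
Proof.
move=> h f; have [L hf] := supp_lt_exists f; have [e' he' ee] := h L.
by rewrite (mult_local hf ee).
Qed.

Lemma mult_boundD e e' c c' : mult_bound e c -> mult_bound e' c' ->
  mult_bound (fun K M => e K M + e' K M) (c + c').
Proof.
move=> h h' f; rewrite multD mulrDl; apply: (le_trans (ND _ _)).
by apply: lerD.
Qed.

Lemma mult_boundZ a e c : mult_bound e c ->
  mult_bound (fun K M => a * e K M) (`|a| * c).
Proof. by move=> h f; rewrite multZ NZ -mulrA ler_wpM2l. Qed.

Lemma mult_bound1 : mult_bound (fun _ _ => 1) 1.
Proof. by move=> f; rewrite mult1 mul1r. Qed.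

Lemma mult_boundM e e' c c' : 0 <= c -> mult_bound e c -> mult_bound e' c' ->
  mult_bound (fun K M => e K M * e' K M) (c * c').
Proof.
move=> c0 h h' f; rewrite -mult_comp; apply: (le_trans (h _)).
by rewrite -mulrA ler_wpM2l.
Qed.

Lemma mult_bound_sum (I : Type) (r : seq I) (F : I -> dyadic -> dyadic -> R)
    (c : I -> R) : (forall i, mult_bound (F i) (c i)) ->
  mult_bound (fun K M => \sum_(i <- r) F i K M) (\sum_(i <- r) c i).
Proof.
move=> h; elim: r => [|i r IH].
  rewrite big_nil; move=> f; rewrite mul0r.
  have -> : mult (fun K M => \sum_(i <- [::]) F i K M) f = 0.
    by apply: coef_ext => K M; rewrite coef_mult big_nil mul0r coef0.
  by rewrite N0.
rewrite big_cons; apply: eq_mult_bound (mult_boundD (h i) IH) => K M.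
by rewrite big_cons.
Qed.

Definition avg_op L (gam gam' : bits -> dyadic -> bool) (f : V) : V :=
  2 ^- L *: \sum_(y : cube L) tree_op (gam (ext y)) (gam' (ext y)) f.

Lemma avg_op_lin L gam gam' : lin_map (avg_op L gam gam').
Proof.
move=> a u v; rewrite /avg_op scalerA mulrC -scalerA -scalerDr; congr (_ *: _).
by rewrite scaler_sumr -big_split; apply: eq_bigr => y _; rewrite /= tree_op_lin.
Qed.

(** A mean of isometries is a contraction. *)
Lemma N_avg_op L gam gam' f : N (avg_op L gam gam' f) <= N f.
Proof.
rewrite /avg_op NZ ger0_norm ?invr_ge0 ?exprn_ge0//.
rewrite -ler_pdivlMl ?invr_gt0 ?exprn_gt0// invrK.
apply: (le_trans (N_sum _ _ _)).
under eq_bigr do rewrite NT.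
by rewrite sumr_const card_cube -[leLHS]mulr_natl natrX.
Qed.

(** In one variable, the coefficient at [K'] of the averaged image of the Haar function of [K]. *)
Definition flip_kernel L (gam : bits -> dyadic -> bool) (K K' : dyadic) : R :=
  mean L (fun y => (-1) ^+ gam y K * (act (gam y) K == K')%:R).

Lemma act0 K : act (fun=> false) K = K.
Proof. by rewrite -[RHS]pre_bit; apply: eq_pre => k _; rewrite /act_stream addbF. Qed.

Lemma coef_avg_op1 L gam K M K' M' :
  coef (avg_op L gam (fun _ _ => false) (hk R K M)) K' M' =
  flip_kernel L gam K K' * (M == M')%:R.
Proof.
rewrite /avg_op coefZ coef_sum /flip_kernel /mean -mulrA.
congr (_ * _); rewrite mulr_suml; apply: eq_bigr => y _.
rewrite tree_op_hk coefZ coef_hk /= act0 expr0 mulr1 -mulnb natrM mulrA//.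
Qed.

Lemma coef_avg_op2 L gam K M K' M' :
  coef (avg_op L (fun _ _ => false) gam (hk R K M)) K' M' =
  (K == K')%:R * flip_kernel L gam M M'.
Proof.
rewrite /avg_op coefZ coef_sum /flip_kernel /mean mulrCA.
congr (_ * _); rewrite mulr_sumr; apply: eq_bigr => y _.
rewrite tree_op_hk coefZ coef_hk /= act0 expr0 mul1r -mulnb natrM mulrCA//.
Qed.

Lemma mean_odd L k (h : bits -> R) : dep L h ->
  (forall s, h (flipb k s) = - h s) -> mean L h = 0.
Proof.
move=> hh o; have e : mean L h = - mean L h.
  rewrite -{1}(mean_flip k hh) -mulN1r -meanZ.
  by apply: eq_mean => s; rewrite o mulN1r.
lra.
Qed.

(** Random swaps inside [I], with a single choice per level. *)
Definition subtree_flip (I : dyadic) (y : bits) (K : dyadic) : bool :=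
  below I K && y (lvl K).

Lemma below_pre I K k : (k <= lvl K)%N -> below I (pre k (bit K)) -> below I K.
Proof.
move=> kK /andP[h1 /eqP h2]; rewrite /below (leq_trans h1 kK)/=.
apply/eqP; rewrite -[RHS]h2; apply: eq_pre => i iI.
by rewrite bit_pre// (leq_trans iI).
Qed.

(** An interval not inside [I] has no ancestor inside [I], so it is never moved. One inside [I] is
    killed: its new position depends on the swaps at smaller levels only, while its sign is decided
    by the independent digit [y (lvl K)]. *)
Lemma subtree_flip_kernel L I K K' : (lvl K < L)%N ->
  flip_kernel L (subtree_flip I) K K' = (~~ below I K && (K == K'))%:R.
Proof.
move=> KL; rewrite /flip_kernel; have [b|nb] := boolP (below I K); last first.
  rewrite -[RHS](mean_const L); apply: eq_mean => y.
  rewrite {1}/subtree_flip (negbTE nb) expr0 mul1r.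
  congr (nat_of_bool (_ == _))%:R; rewrite -[RHS]pre_bit; apply: eq_pre => k kK.
  rewrite /act_stream /subtree_flip; have [b|_] := boolP (below I _); last exact: addbF.
  have {}b := below_pre (ltnW kK) b.
  by rewrite b in nb.
have actE y y' : agree (lvl K) y y' ->
    act (subtree_flip I y) K = act (subtree_flip I y') K.
  move=> h; apply: eq_pre => k kK; rewrite /act_stream /subtree_flip lvl_pre h//.
apply: (@mean_odd _ (lvl K)) => [y y' h|y].
  rewrite /subtree_flip h// -/(subtree_flip I y) (actE y y')//.
  by apply: agree_le h; exact: ltnW.
rewrite (actE (flipb (lvl K) y) y); last first.
  by move=> k kK; rewrite /flipb /setb ltn_eqF.
rewrite /subtree_flip b /flipb setb_eq /=; case: (y (lvl K)) => /=;
  rewrite ?expr0 ?expr1; ring.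
Qed.

(** The averages over [subtree_flip] are contractions equal to the identity minus a one-variable
    restriction. Each restriction thus has norm at most 2, and the product gives 4. *)
Lemma mult_bound_below I J :
  mult_bound (fun K M => (below I K)%:R * (below J M)%:R) 4.
Proof.
have b1 : mult_bound (fun K M => (~~ below I K)%:R) 1.
  move=> f; have [L hf] := supp_lt_exists f; rewrite mul1r.
  suff -> : mult (fun K M => (~~ below I K)%:R) f =
      avg_op L (subtree_flip I) (fun _ _ => false) f by exact: N_avg_op.
  apply: lin_map_ext; [exact: mult_lin|exact: avg_op_lin|].
  move=> [K M] /(supp_lt_msupp hf)[/= KL ML]; apply: coef_ext => K' M'.
  rewrite coef_avg_op1 subtree_flip_kernel// mult_hk coefZ coef_hk.
  by rewrite -!natrM !mulnb andbA.
have b2 : mult_bound (fun K M => (~~ below J M)%:R) 1.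
  move=> f; have [L hf] := supp_lt_exists f; rewrite mul1r.
  suff -> : mult (fun K M => (~~ below J M)%:R) f =
      avg_op L (fun _ _ => false) (subtree_flip J) f by exact: N_avg_op.
  apply: lin_map_ext; [exact: mult_lin|exact: avg_op_lin|].
  move=> [K M] /(supp_lt_msupp hf)[/= KL ML]; apply: coef_ext => K' M'.
  rewrite coef_avg_op2 subtree_flip_kernel// mult_hk coefZ coef_hk.
  by rewrite -!natrM !mulnb andbCA.
have c (b : dyadic -> dyadic -> bool) : mult_bound (fun K M => (~~ b K M)%:R) 1 ->
    mult_bound (fun K M => (b K M)%:R) 2.
  move=> hb; have h := mult_boundD mult_bound1 (mult_boundZ (-1) hb).
  rewrite normrN normr1 mulr1 in h; apply: eq_mult_bound h => K M.
  by case: (b K M) => /=; rewrite ?mulr0 ?mulr1 ?addr0 ?subrr.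
have := mult_boundM _ (c (fun K M => below I K) b1) (c (fun K M => below J M) b2).
rewrite -natrM; exact.
Qed.

(** The value before index 0 is taken to be 0, so that the increments sum to [g] itself. *)
Definition incr (g : nat -> R) (k : nat) : R :=
  g k - (if k is k'.+1 then g k' else 0).

Lemma sum_incr g i : \sum_(k < i.+1) incr g k = g i.
Proof.
elim: i => [|i IH]; first by rewrite big_ord1 /incr subr0.
by rewrite big_ord_recr/= IH /incr addrC subrK.
Qed.

Definition incr2 (E : nat -> bits -> nat -> bits -> R) k w l v :=
  incr (fun k => incr (fun l => E k w l v) l) k.

Lemma sum_below k (G : bits -> R) K : dep k G ->
  \sum_(y : cube k) G (ext y) * (below (pre k (ext y)) K)%:R =
  (k <= lvl K)%:R * G (bit K).
Proof.
move=> hG; under eq_bigr do rewrite /below lvl_pre.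
case: leqP => kK /=; last first.
  by rewrite mul0r big1// => y _; rewrite mulr0.
rewrite (bigD1 (rest k (bit K)))//= big1 ?addr0 => [|y ny].
  rewrite (_ : pre k (bit K) = pre k (ext (rest k (bit K)))) ?eqxx; last first.
    by apply: eq_pre => i ik; rewrite ext_rest.
  by rewrite mulr1 mul1r; apply: hG; exact: ext_rest.
rewrite (_ : (_ == _) = false) ?mulr0//; apply/eqP => /preP h.
by move/eqP: ny; apply; rewrite -[LHS]rest_ext; apply/esym/eq_rest.
Qed.

(** There are 2^k intervals of level [k], each of weight 4^-(k+1). *)
Lemma sum_geometric L : \sum_(k < L) (2 ^+ k / 4 ^+ k.+1 : R) <= 2^-1.
Proof.
suff -> : \sum_(k < L) (2 ^+ k / 4 ^+ k.+1 : R) = 2^-1 - 2 ^- L.+1.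
  by rewrite gerBl invr_ge0 exprn_ge0.
elim: L => [|L IH]; first by rewrite big_ord0 expr1 subrr.
rewrite big_ord_recr/= IH.
have -> : (4 : R) = 2 * 2 by rewrite -natrM.
rewrite exprMn !exprS; have := p2gt0 R L => /lt0r_neq0 h; field; exact: h.
Qed.

(* [incr2 E k _ l _] is the Moebius transform of the entries of the multiplier,
   which is thus a combination of restrictions to dyadic rectangles. *)
Lemma mult_bound_incr2 (E : nat -> bits -> nat -> bits -> R) (kappa : R) :
  0 <= kappa ->
  (forall k w w' l v v', agree k w w' -> agree l v v' -> E k w l v = E k w' l v') ->
  (forall k w l v, `|incr2 E k w l v| <= kappa * (4 ^- k.+1 * 4 ^- l.+1)) ->
  mult_bound (fun K M => E (lvl K) (bit K) (lvl M) (bit M)) kappa.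
Proof.
move=> k0 hE hb; apply: mult_bound_local => L.
have dE k w w' l v v' : agree k w w' -> agree l v v' ->
    incr2 E k w l v = incr2 E k w' l v'.
  move=> hw hv; have hwS k' : k = k'.+1 -> agree k' w w'.
    by move=> e; apply: agree_le hw; rewrite e.
  have hvS l' : l = l'.+1 -> agree l' v v'.
    by move=> e; apply: agree_le hv; rewrite e.
  rewrite /incr2 /incr; case: k hw hwS => [|k] hw hwS; case: l hv hvS => [|l] hv hvS;
    rewrite ?(hE _ _ _ _ _ _ hw hv) ?(hE _ _ _ _ _ _ (hwS _ erefl) hv)
    ?(hE _ _ _ _ _ _ hw (hvS _ erefl)) ?(hE _ _ _ _ _ _ (hwS _ erefl) (hvS _ erefl))//.
exists (fun K M => \sum_(k < L) \sum_(l < L) \sum_(y : cube k) \sum_(z : cube l)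
  incr2 E k (ext y) l (ext z) *
    ((below (pre k (ext y)) K)%:R * (below (pre l (ext z)) M)%:R)).
  (* Each rectangle costs 4 and the weights sum to at most 1/2 in each variable, which gives exactly
     [kappa]. *)
  apply: (@mult_bound_le _ (\sum_(k < L) \sum_(l < L) \sum_(y : cube k) \sum_(z : cube l)
     kappa * (4 ^- k.+1 * 4 ^- l.+1) * 4)); last first.
    do 4 ! [apply: mult_bound_sum => ?].
    apply: mult_bound_le (mult_boundZ _ (mult_bound_below _ _)).
    by rewrite ler_wpM2r.
  have -> : \sum_(k < L) \sum_(l < L) \sum_(y : cube k) \sum_(z : cube l)
      kappa * (4 ^- k.+1 * 4 ^- l.+1) * 4 =
      kappa * 4 * ((\sum_(k < L) (2 ^+ k / 4 ^+ k.+1)) *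
                   (\sum_(k < L) (2 ^+ k / 4 ^+ k.+1))).
    rewrite big_distrlr/= mulr_sumr; apply: eq_bigr => k _.
    rewrite mulr_sumr; apply: eq_bigr => l _.
    rewrite !sumr_const !card_cube -!mulrnA -[LHS]mulr_natl natrM !natrX.
    ring.
  have h := sum_geometric L; set x := \sum_(k < L) _ in h *.
  have x0 : 0 <= x by apply: sumr_ge0 => k _; rewrite divr_ge0 ?exprn_ge0.
  have : x * x <= 2^-1 * 2^-1 by apply: ler_pM.
  by move=> hx; nra.
move=> K M KL ML.
(* Only the rectangles containing [K] times [M] contribute, one for each pair of levels up to those
   of [K] and [M]; the resulting double sum telescopes. *)
transitivity (\sum_(k < L) \sum_(l < L) (k <= lvl K)%:R * ((l <= lvl M)%:R *
   incr2 E k (bit K) l (bit M))); last first.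
  apply: eq_bigr => k _; apply: eq_bigr => l _.
  rewrite -(@sum_below k (fun s => (l <= lvl M)%:R * incr2 E k s l (bit M))).
    apply: eq_bigr => y _.
    rewrite -(@sum_below l (fun t => incr2 E k (ext y) l t)).
      by rewrite mulr_suml; apply: eq_bigr => z _; ring.
    by move=> t t' h; apply: dE.
  by move=> s s' h; congr (_ * _); apply: dE.
have trunc i (G : nat -> R) : (i < L)%N ->
    \sum_(k < L) (k <= i)%:R * G k = \sum_(k < i.+1) G k.
  move=> iL; rewrite (big_ord_widen L G iL) [RHS]big_mkcond; apply: eq_bigr => k _ /=.
  by rewrite ltnS; case: leqP => _; rewrite ?mul1r ?mul0r.
transitivity (\sum_(k < L) (k <= lvl K)%:R *
   incr (fun k => E k (bit K) (lvl M) (bit M)) k).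
  by rewrite (trunc (lvl K)) // sum_incr.
apply: eq_bigr => k _; rewrite -mulr_sumr; congr (_ * _).
rewrite (trunc (lvl M) (fun l => incr2 E k (bit K) l (bit M)))//.
rewrite /incr2 [LHS]/incr.
transitivity (\sum_(l < (lvl M).+1) (incr (fun l => E k (bit K) l (bit M)) l
   - (if nat_of_ord k is k'.+1 then incr (fun l => E k' (bit K) l (bit M)) l else 0))).
  rewrite big_split/= sumrN sum_incr; congr (_ - _).
  by case: (nat_of_ord k) => [|k'] /=; [rewrite big1|rewrite sum_incr].
by apply: eq_bigr => l _.
Qed.

End Bounds.
End Multipliers.

(** * Sparse levels *)

Definition sel (n : nat -> nat) (s : bits) : bits := fun k => s (n k).

Definition strict_incr (n : nat -> nat) := forall k, (n k < n k.+1)%N.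

(* The position of [l] in the range of [n], when there is one. *)
Definition rank (n : nat -> nat) (l : nat) : nat :=
  index l [seq n k | k <- iota 0 l.+1].

(** For [n] increasing, a value [l] of [n] is taken at an index at most [l], so the search in [rank]
    is long enough. If [l] is missed, [rank] returns [l.+1], where [n] exceeds [l], and the test
    fails. *)
Definition in_range_of (n : nat -> nat) (l : nat) : bool := n (rank n l) == l.

Section IncreasingSeq.
Variable n : nat -> nat.
Hypothesis hn : strict_incr n.

Lemma iseq_lt i j : (i < j)%N -> (n i < n j)%N.
Proof.
elim: j => [//|j IH]; rewrite ltnS leq_eqVlt => /orP[/eqP ->|/IH h]; first exact: hn.
exact: ltn_trans (hn j).
Qed.

Lemma iseq_ltE i j : (n i < n j)%N = (i < j)%N.
Proof.
have [ij|ji] := ltnP i j; first by rewrite iseq_lt.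
apply/negbTE; rewrite -leqNgt; move: ji; rewrite leq_eqVlt => /orP[/eqP ->//|].
by move=> /iseq_lt /ltnW.
Qed.

Lemma iseq_inj : injective n.
Proof.
move=> i j e; apply/eqP; rewrite eqn_leq leqNgt -iseq_ltE e ltnn/=.
by rewrite leqNgt -iseq_ltE e ltnn.
Qed.

Lemma iseq_ge i : (i <= n i)%N.
Proof. by elim: i => // i IH; exact: leq_ltn_trans (hn i). Qed.

Lemma rankK i : rank n (n i) = i.
Proof.
rewrite /rank index_map; last exact: iseq_inj.
have iN : (i < (n i).+1)%N by rewrite ltnS iseq_ge.
by rewrite -{1}[i]add0n -(nth_iota 0 0 iN) index_uniq ?size_iota ?iota_uniq.
Qed.

Lemma in_range_of_seq i : in_range_of n (n i). Proof. by rewrite /in_range_of rankK. Qed.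

End IncreasingSeq.

Fixpoint overwrite (n : nat -> nat) (w : bits) (i : nat) (s : bits) : bits :=
  if i is i'.+1 then setb (n i') (w i') (overwrite n w i' s) else s.

Section Riesz.
Variable R : realType.
Variable n : nat -> nat.

(** The density of the uniform law conditioned on the digits at [n 0], .., [n (i - 1)] being those
    of [w], see [rieszE]. The product form shows that passing from [i] to [i.+1] adds a Rademacher
    multiple of the previous product. *)
Definition riesz (i : nat) (w s : bits) : R :=
  \prod_(k < i) (1 + (-1) ^+ w k * (-1) ^+ s (n k)).

Lemma rieszS i w s :
  riesz i.+1 w s = riesz i w s * (1 + (-1) ^+ w i * (-1) ^+ s (n i)).
Proof. by rewrite /riesz big_ord_recr. Qed.

Lemma riesz_agree i w w' s s' : agree i w w' ->
  (forall k, (k < i)%N -> s (n k) = s' (n k)) -> riesz i w s = riesz i w' s'.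
Proof. by move=> h h'; apply: eq_bigr => k _; rewrite h// h'. Qed.

Lemma rieszE i w s : riesz i w s = 2 ^+ i * (pre i (sel n s) == pre i w)%:R.
Proof.
elim: i => [|i IH]; first by rewrite /riesz big_ord0 (eq_pre (s' := w))// eqxx mul1r.
rewrite rieszS IH; have [e|ne] := eqVneq (pre i (sel n s)) (pre i w); last first.
  rewrite (_ : (pre i.+1 _ == _) = false) ?mulr0 ?mul0r//.
  by apply/eqP => /(pre_le (leqnSn i)) e; rewrite e eqxx in ne.
rewrite mulr1 -signr_addb; have [ei|ni] := eqVneq (s (n i)) (w i).
  rewrite ei addbb expr0 (_ : pre i.+1 _ = pre i.+1 w) ?eqxx.
    by rewrite exprSr mulr1.
  apply: eq_pre => k; rewrite ltnS leq_eqVlt => /orP[/eqP -> //|].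
  by move: k; apply/preP.
rewrite (_ : (pre i.+1 _ == _) = false); last first.
  by apply/eqP => /preP /(_ i (ltnSn i)) h; rewrite /sel in h; rewrite h eqxx in ni.
have -> : w i (+) s (n i) by move: ni; case: (w i); case: (s (n i)).
by rewrite expr1 subrr !mulr0.
Qed.

Hypothesis hn : strict_incr n.

Lemma riesz_dep i w L : (forall k, (k < i)%N -> (n k < L)%N) -> dep L (riesz i w).
Proof. by move=> h s s' e; apply: riesz_agree => // k ki; apply: e; exact: h. Qed.

Lemma overwriteE w i s k : overwrite n w i s k =
  if in_range_of n k && (rank n k < i)%N then w (rank n k) else s k.
Proof.
elim: i => [|i IH] /=; first by rewrite andbF.
rewrite /setb IH [in RHS]ltnS [in RHS]leq_eqVlt; have [->|ne] := eqVneq k (n i).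
  by rewrite in_range_of_seq// rankK// eqxx.
have [sk|//] := boolP (in_range_of n k); rewrite /=.
have [e|//] := eqVneq (rank n k) i.
by move/eqP: sk ne; rewrite e => ->; rewrite eqxx.
Qed.

Lemma mean_overwrite L w i (g : bits -> R) : (forall k, (k < i)%N -> (n k < L)%N) ->
  dep L g -> mean L (fun s => g (overwrite n w i s)) =
  mean L (fun s => riesz i w s * g s).
Proof.
elim: i g => [|i IH] g hL hg.
  by apply: eq_mean => s; rewrite /riesz big_ord0 mul1r.
have hLi k : (k < i)%N -> (n k < L)%N by move=> ki; apply: hL; exact: ltnW.
rewrite /= (IH (fun s => g (setb (n i) (w i) s)))//; last first.
  by move=> s s' e; apply: hg => k kL; rewrite /setb; case: eqP => // _; exact: e.
have := @mean_setb R L (n i) (w i) (fun s => riesz i w s * g s) (hL i (ltnSn i)).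
move=> h; have hd : dep L (fun s => riesz i w s * g s).
  by move=> s s' e; rewrite (@riesz_dep i w L hLi _ _ e) (hg _ _ e).
(* Position [n i] lies beyond the earlier ones, so [riesz i] does not see the overwritten digit. *)
transitivity (mean L (fun s => riesz i w (setb (n i) (w i) s) * g (setb (n i) (w i) s))).
  apply: eq_mean => s; congr (_ * _); apply: riesz_agree => // k ki.
  by rewrite /setb ltn_eqF// iseq_lt.
by rewrite (h hd); apply: eq_mean => s; rewrite rieszS; ring.
Qed.

End Riesz.

(* [h_I] is sent to the sum of the Haar functions [h_K] over the intervals [K] of
   level [n (lvl I)] whose binary digits at the positions [n 0], [n 1], .. are
   those of [I]. *)
HB.lock Definition spread (R : realType) (n m : nat -> nat) (f : V2 R) : V2 R :=
  lin (fun p => \sum_(y : cube (n (lvl p.1))) \sum_(z : cube (m (lvl p.2)))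
    ((pre (lvl p.1) (sel n (ext y)) == p.1)%:R *
     (pre (lvl p.2) (sel m (ext z)) == p.2)%:R) *:
    hk R (pre (n (lvl p.1)) (ext y)) (pre (m (lvl p.2)) (ext z))) f.

Definition collapse (n : nat -> nat) (K : dyadic) : dyadic :=
  pre (rank n (lvl K)) (sel n (bit K)).

(** For a given interval of level [i], [spread] uses 2^(n i - i) intervals of level [n i]; the
    weight is the reciprocal of this number, so that [gather] takes means. Intervals of unselected
    levels are dropped. *)
Definition collapse_weight (R : realType) (n : nat -> nat) (K : dyadic) : R :=
  if in_range_of n (lvl K) then 2 ^+ rank n (lvl K) / 2 ^+ lvl K else 0.

HB.lock Definition gather (R : realType) (n m : nat -> nat) (f : V2 R) : V2 R :=
  lin (fun p => (collapse_weight R n p.1 * collapse_weight R m p.2) *: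
    hk R (collapse n p.1) (collapse m p.2)) f.

Section Spread.
Variable R : realType.
Local Notation V := (V2 R).
Variables n m : nat -> nat.
Hypotheses (hn : strict_incr n) (hm : strict_incr m).

Lemma spread_lin : lin_map (@spread R n m).
Proof. by move=> a u v; rewrite unlock lin_lin_map. Qed.

Lemma gather_lin : lin_map (@gather R n m).
Proof. by move=> a u v; rewrite unlock lin_lin_map. Qed.

Definition averaged (d : dyadic -> dyadic -> R) (I J : dyadic) : R :=
  mean (n (lvl I)) (fun s => mean (m (lvl J)) (fun t =>
    riesz R n (lvl I) (bit I) s * riesz R m (lvl J) (bit J) t *
    d (pre (n (lvl I)) s) (pre (m (lvl J)) t))).

Lemma collapse_pre (n' : nat -> nat) i s : strict_incr n' ->
  collapse n' (pre (n' i) s) = pre i (sel n' s).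
Proof.
move=> hn'; rewrite /collapse lvl_pre rankK//; apply: eq_pre => k ki.
by rewrite /sel bit_pre// iseq_lt.
Qed.

(** The sums agree word by word: the Riesz product is 2^i times the indicator in [spread], and the
    weight in [gather] is that 2^i times the normalization of the mean over level [n i]. *)
Lemma gather_mult_spread d f :
  gather n m (mult d (spread n m f)) = mult (averaged d) f.
Proof.
apply: (@lin_map_ext R V (fun f => gather n m (mult d (spread n m f)))
  (mult (averaged d)) f).
- exact: (lin_map_comp gather_lin (lin_map_comp (@mult_lin _ d) spread_lin)).
- exact: mult_lin.
move=> [I J] _; rewrite mult_hk spread.unlock lin_hk /=.
rewrite (lin_map_sum (@mult_lin _ d)) (lin_map_sum gather_lin) /averaged /mean.
rewrite mulr_sumr scaler_suml; apply: eq_bigr => y _.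
rewrite (lin_map_sum (@mult_lin _ d)) (lin_map_sum gather_lin).
rewrite !mulr_sumr scaler_suml; apply: eq_bigr => z _.
rewrite (lin_mapZ (@mult_lin _ d)) mult_hk !(lin_mapZ gather_lin).
rewrite gather.unlock lin_hk /= !collapse_pre// /collapse_weight !lvl_pre !in_range_of_seq// !rankK//.
rewrite !rieszE !pre_bit.
have [->|_] := eqVneq (pre (lvl I) _) I; last by rewrite !(mul0r, mulr0, scale0r).
have [->|_] := eqVneq (pre (lvl J) _) J; last by rewrite !(mul0r, mulr0, scale0r).
rewrite !scalerA; congr (_ *: _); ring.
Qed.

Lemma gather_spread (f : V) : gather n m (spread n m f) = f.
Proof.
(* The case [d = 1], where the entries are means of Riesz products, hence 1. *)
rewrite -{1}[spread n m f]mult1 gather_mult_spread -[RHS]mult1; apply: eq_mult => I J.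
have hr (n' : nat -> nat) (I' : dyadic) : strict_incr n' ->
    mean (n' (lvl I')) (riesz R n' (lvl I') (bit I')) = 1.
  move=> hn'; rewrite -(mean_const (n' (lvl I')) (1 : R)).
  have := @mean_overwrite R n' hn' (n' (lvl I')) (bit I') (lvl I') (fun=> 1).
  move=> -> //; first by apply: eq_mean => s; rewrite mulr1.
  by move=> k ki; exact: iseq_lt.
rewrite /averaged.
under eq_mean => s do (under eq_mean => t do rewrite mulr1; rewrite meanZ hr// mulr1).
exact: hr.
Qed.

Lemma spread_coef1 (n' : nat -> nat) (I : dyadic) a s : strict_incr n' ->
  \sum_(y : cube (n' (lvl I))) (pre (lvl I) (sel n' (ext y)) == I)%:R *
    (pre (n' (lvl I)) (ext y) == pre a s)%:R
  = (a == n' (lvl I))%:R * (pre (lvl I) (sel n' s) == I)%:R :> R.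
Proof.
move=> hn'; have [->|ne] := eqVneq a (n' (lvl I)); last first.
  rewrite mul0r big1// => y _; rewrite (_ : (pre (n' _) _ == _) = false) ?mulr0//.
  by apply/eqP => /(congr1 lvl); rewrite !lvl_pre => e; rewrite e eqxx in ne.
rewrite (bigD1 (rest (n' (lvl I)) s))//= big1 ?addr0 => [|y ny].
  rewrite (eq_pre (@ext_rest _ s)) eqxx mulr1 mul1r.
  congr (nat_of_bool (_ == _))%:R; apply: eq_pre => k ki.
  by rewrite /sel ext_rest// iseq_lt.
rewrite (_ : (pre (n' _) _ == _) = false) ?mulr0//.
apply/eqP => /preP h; move/eqP: ny; apply; rewrite -[LHS]rest_ext; exact: eq_rest.
Qed.

Lemma spread_sum1 (n' : nat -> nat) (I : dyadic) a s L : strict_incr n' ->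
  (lvl I < L)%N ->
  (a == n' (lvl I))%:R * (pre (lvl I) (sel n' s) == I)%:R * (-1) ^+ s a =
  \sum_(i < L) (a == n' i)%:R * ((I == pre i (sel n' s))%:R * (-1) ^+ sel n' s i) :> R.
Proof.
move=> hn' IL; rewrite (bigD1 (Ordinal IL))//= big1 ?addr0 => [|i ni].
  rewrite [I == _]eq_sym /sel; case: eqP => [->|_] /=; ring.
rewrite (_ : (I == _) = false) ?mul0r ?mulr0//.
by apply/eqP => e; move/eqP: ni; apply; apply: val_inj; rewrite /= e.
Qed.

(** On a path, [spread n m f] has terms at selected levels only, and these are the terms of [f]
    along the selected digits. *)
Lemma path_coef_spread L (f : V) s t a b : supp_lt L f ->
  path_coef (spread n m f) s t a b =
  \sum_(i < L) \sum_(j < L) ((a == n i)%:R * (b == m j)%:R) *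
    path_coef f (sel n s) (sel m t) i j.
Proof.
move=> hf; apply: (@lin_map_ext _ R^o (fun f => path_coef (spread n m f) s t a b)
  (fun f => \sum_(i < L) \sum_(j < L) ((a == n i)%:R * (b == m j)%:R) *
    path_coef f (sel n s) (sel m t) i j)).
- exact: (lin_map_comp (lin_map_path_coef _ _ _ _) spread_lin).
- move=> c u v; rewrite scaler_sumr -big_split; apply: eq_bigr => i _.
  rewrite scaler_sumr -big_split; apply: eq_bigr => j _ /=.
  by rewrite lin_map_path_coef mulrDr /GRing.scale /= mulrCA.
move=> [I J] /(supp_lt_msupp hf)[/= IL JL]; rewrite unlock lin_hk /=.
transitivity (((a == n (lvl I))%:R * (pre (lvl I) (sel n s) == I)%:R * (-1) ^+ s a) *
  ((b == m (lvl J))%:R * (pre (lvl J) (sel m t) == J)%:R * (-1) ^+ t b) : R).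
  rewrite -!spread_coef1// (lin_map_sum (lin_map_path_coef _ _ _ _)).
  rewrite 2!mulr_suml; apply: eq_bigr => y _.
  rewrite (lin_map_sum (lin_map_path_coef _ _ _ _)) mulr_suml mulr_sumr.
  apply: eq_bigr => z _; rewrite (lin_mapZ (lin_map_path_coef _ _ _ _)) path_coef_hk.
  by rewrite /GRing.scale /=; ring.
rewrite (@spread_sum1 n I a s L)// (@spread_sum1 m J b t L)// big_distrlr/=.
apply: eq_bigr => i _; apply: eq_bigr => j _; rewrite path_coef_hk; ring.
Qed.

Lemma supp_lt_spread L (f : V) : supp_lt L f -> supp_lt (maxn (n L) (m L)) (spread n m f).
Proof.
move=> hf; rewrite unlock; apply: supp_lt_lin hf _ => -[I J] /= IL JL.
apply: supp_lt_sum => y _; apply: supp_lt_sum => z _; apply: supp_ltZ.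
by apply: supp_lt_hk; rewrite lvl_pre leq_max !iseq_lt// orbT.
Qed.

Lemma sum_delta L L' (n' : nat -> nat) (G : nat -> R) (F : nat -> R) :
  (forall i, (i < L)%N -> (n' i < L')%N) ->
  \sum_(a < L') F a * (\sum_(i < L) (nat_of_ord a == n' i)%:R * G i) =
  \sum_(i < L) F (n' i) * G i.
Proof.
move=> h; under eq_bigr do rewrite mulr_sumr.
rewrite exchange_big; apply: eq_bigr => i _ /=.
rewrite (bigD1 (Ordinal (h i (ltn_ord i))))//= eqxx mul1r big1 ?addr0// => a na.
rewrite (_ : (_ == _) = false) ?mul0r ?mulr0//.
by apply/eqP => e; move/eqP: na; apply; exact: val_inj.
Qed.

(** Besides the terms, the signs match: those at the selected levels have the law of the first [L]
    signs. *)
Lemma square_fun_spread S1 S2 L (f : V) s t : supp_lt L f ->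
  square_fun S1 S2 (maxn (n L) (m L)) (spread n m f) s t =
  square_fun S1 S2 L f (sel n s) (sel m t).
Proof.
move=> hf; set L' := maxn _ _.
have nL i : (i < L)%N -> (n i < L')%N by move=> iL; rewrite leq_max iseq_lt.
have mL i : (i < L)%N -> (m i < L')%N by move=> iL; rewrite leq_max (iseq_lt hm) ?orbT.
have inj1 k l : (k < L)%N -> (l < L)%N -> n k = n l -> k = l by move=> _ _ /iseq_inj ->.
have inj2 k l : (k < L)%N -> (l < L)%N -> m k = m l -> k = l by move=> _ _ /iseq_inj ->.
pose G (e d : bits) : R := `| \sum_(i < L) \sum_(j < L)
  (-1) ^+ e i * (-1) ^+ d j * path_coef f (sel n s) (sel m t) i j |.
transitivity (sign_mean S1 L' (fun e => sign_mean S2 L' (fun d => G (sel n e) (sel m d)))).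
  apply: eq_sign_mean => e; apply: eq_sign_mean => d; congr (`| _ |).
  transitivity (\sum_(a < L') (-1) ^+ e a * (\sum_(i < L) (nat_of_ord a == n i)%:R *
     (\sum_(b < L') (-1) ^+ d b * (\sum_(j < L) (nat_of_ord b == m j)%:R *
       path_coef f (sel n s) (sel m t) i j)))).
    apply: eq_bigr => a _.
    rewrite mulr_sumr.
    under [RHS]eq_bigr do rewrite mulr_sumr mulr_sumr.
    rewrite exchange_big; apply: eq_bigr => b _ /=.
    rewrite (path_coef_spread _ _ _ _ hf) mulr_sumr; apply: eq_bigr => i _.
    rewrite mulr_sumr !mulr_sumr; apply: eq_bigr => j _; ring.
  apply: (etrans (sum_delta (fun i => \sum_(b < L') (-1) ^+ d b *
    (\sum_(j < L) (nat_of_ord b == m j)%:R * path_coef f (sel n s) (sel m t) i j))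
    (fun a => (-1) ^+ e a) nL)).
  apply: eq_bigr => i _; rewrite (sum_delta (path_coef f (sel n s) (sel m t) i)
    (fun b => (-1) ^+ d b) mL).
  by rewrite mulr_sumr; apply: eq_bigr => j _; rewrite mulrA.
transitivity (sign_mean S1 L' (fun e => sign_mean S2 L (G (sel n e)))).
  apply: eq_sign_mean => e; apply: (@sign_mean_push R S2 L L' m _ inj2 mL) => d d' h.
  congr (`| _ |); apply: eq_bigr => i _; apply: eq_bigr => j _; congr (_ * _ * _).
  by rewrite h.
apply: (@sign_mean_push R S1 L L' n (fun e => sign_mean S2 L (G e)) inj1 nL) => e e' h.
apply: eq_sign_mean => d.
congr (`| _ |); apply: eq_bigr => i _; apply: eq_bigr => j _; congr (_ * _ * _).
by rewrite h.
Qed.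

Lemma mp_sel (n' : nat -> nat) L L' : strict_incr n' ->
  (forall i, (i < L)%N -> (n' i < L')%N) -> mp R L L' (sel n').
Proof.
move=> hn' h; split=> [s s' e k kL|g hg]; first by apply: e; exact: h.
by apply: mean_push hg => // k l _ _ /iseq_inj ->.
Qed.

Lemma spread_isometry (X Y : haar_system_space R) S1 S2
    (P : probability (signs * signs)%type R) f : is_haar_measure S1 S2 P ->
  hardy_norm P X Y (spread n m f) = hardy_norm P X Y f.
Proof.
move=> hP; have [L hf] := supp_lt_exists f.
apply: (@hardy_norm_mp R X Y S1 S2 P hP L (maxn (n L) (m L)) (sel n) (sel m) f) => //.
- exact: supp_lt_spread.
- by apply: mp_sel => // i iL; rewrite leq_max iseq_lt.
- by apply: mp_sel => // i iL; rewrite leq_max (iseq_lt hm) ?orbT.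
by move=> s t; exact: square_fun_spread.
Qed.

End Spread.

Section Gather.
Variable R : realType.
Local Notation V := (V2 R).

Definition mask_flip (n : nat -> nat) (y : bits) (K : dyadic) : bool :=
  ~~ in_range_of n (lvl K) && y (lvl K).

(** Random swaps at the unselected levels make the unselected digits of [K] uniform and keep the
    selected ones. If the level of [K] is itself unselected, the random sign averages to 0. *)
Lemma mask_flip_kernel n L K K' : strict_incr n -> (lvl K < L)%N ->
  flip_kernel R L (mask_flip n) K K' =
  collapse_weight R n K * ((lvl K' == lvl K) && (collapse n K' == collapse n K))%:R.
Proof.
move=> hn KL; rewrite /flip_kernel.
have actE y y' : agree (lvl K) y y' -> act (mask_flip n y) K = act (mask_flip n y') K.
  by move=> h; apply: eq_pre => k kK; rewrite /act_stream /mask_flip lvl_pre h.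
rewrite /collapse_weight; case: ifPn => [sK|nsK]; last first.
  rewrite mul0r; apply: (@mean_odd _ _ (lvl K)) => [y y' h|y].
    rewrite {1 3}/mask_flip h// (actE y y')//.
    by apply: agree_le h; exact: ltnW.
  rewrite (actE (flipb (lvl K) y) y); last first.
    by move=> k kK; rewrite /flipb /setb ltn_eqF.
  rewrite {1 3}/mask_flip nsK /flipb setb_eq /=; case: (y (lvl K)) => /=;
    rewrite ?expr0 ?expr1; ring.
set i := rank n (lvl K); have eK : lvl K = n i by move/eqP: sK.
transitivity (mean (lvl K) (fun y => (act (mask_flip n y) K == K')%:R : R)).
  rewrite -(@mean_dep R (lvl K) L) ?(ltnW KL)//; last by move=> y y' /actE ->.
  by apply: eq_mean => y; rewrite {1}/mask_flip sK expr0 mul1r.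
have [eK'|nK'] := eqVneq (lvl K') (lvl K); last first.
  rewrite mulr0 -[RHS](mean_const (lvl K)); apply: eq_mean => y.
  rewrite (_ : (_ == _) = false)//; apply/eqP => e.
  by rewrite -e lvl_act eqxx in nK'.
(* After translating [y] by the digits of [K], the unselected digits of the moved interval are those
   of [y], so it is described by [overwrite]. *)
rewrite -(@mean_xor R (lvl K) (bit K)); last by move=> y y' /actE ->.
pose G (s : bits) : R := (pre (lvl K) s == K')%:R.
transitivity (mean (lvl K) (fun y => G (overwrite n (sel n (bit K)) i y))).
  apply: eq_mean => y; congr (nat_of_bool (_ == _))%:R; apply: eq_pre => k kK.
  rewrite overwriteE// /act_stream /mask_flip lvl_pre /xorb_bits /=.
  case: ifPn => [/andP[sk _]|]; first by rewrite sk addbF /sel (eqP sk).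
  rewrite negb_and => /orP[->/=|].
    by rewrite addbC -addbA addbb addbF.
  have [sk|_] /= := boolP (in_range_of n k); last by rewrite addbC -addbA addbb addbF.
  by rewrite -leqNgt leqNgt -(iseq_ltE hn) (eqP sk) -eK kK.
rewrite mean_overwrite//; last 2 first.
- by move=> k ki; rewrite eK iseq_lt.
- by move=> s s' h; rewrite /G (eq_pre h).
rewrite /mean (bigD1 (rest (lvl K) (bit K')))//= big1 ?addr0 => [|y ny]; last first.
  rewrite /G (_ : (_ == _) = false) ?mulr0//; apply/eqP => e.
  move/eqP: ny; apply; rewrite -[LHS]rest_ext; apply: eq_rest => k kK.
  by rewrite -e bit_pre.
have -> : G (ext (rest (lvl K) (bit K'))) = 1.
  rewrite /G (_ : pre _ _ = K') ?eqxx// -[RHS]pre_bit eK'.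
  by apply: eq_pre => k kK; rewrite ext_rest.
rewrite mulr1 rieszE mulrCA mulrA; congr (_ / _ * (nat_of_bool (_ == _))%:R).
rewrite /collapse eK' -/i; apply: eq_pre => k ki; rewrite /sel ext_rest//.
by rewrite eK iseq_lt.
Qed.

Variable N : V -> R.
Hypothesis ND : forall f g : V, N (f + g) <= N f + N g.
Hypothesis NZ : forall a f, N (a *: f) = `|a| * N f.
Hypothesis NT : forall gam gam' f, N (tree_op gam gam' f) = N f.
Variables n m : nat -> nat.
Hypotheses (hn : strict_incr n) (hm : strict_incr m).
Hypothesis NB : forall f, N (spread n m f) = N f.

Lemma coef_spread_hk I J K M : coef (spread n m (hk R I J)) K M =
  ((lvl K == n (lvl I)) && (pre (lvl I) (sel n (bit K)) == I))%:R *
  ((lvl M == m (lvl J)) && (pre (lvl J) (sel m (bit M)) == J))%:R.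
Proof.
rewrite spread.unlock lin_hk /=.
have nb (b c : bool) : (b && c)%:R = b%:R * c%:R :> R by rewrite -mulnb natrM.
rewrite (nb (lvl K == _)) (nb (lvl M == _)).
rewrite -(spread_coef1 R I (lvl K) (bit K) hn) -(spread_coef1 R J (lvl M) (bit M) hm).
rewrite big_distrlr coef_sum; apply: eq_bigr => y _.
rewrite coef_sum; apply: eq_bigr => z _.
rewrite coefZ coef_hk -mulnb natrM -{1}(pre_bit K) -{1}(pre_bit M) /=; ring.
Qed.

(* [spread] after [gather] averages over the tree automorphisms that swap the
   halves of all intervals of given levels not in the range of [n], resp. [m]. *)
Lemma gather_contraction f : N (gather n m f) <= N f.
Proof.
rewrite -NB; have [L hf] := supp_lt_exists f.
(* The two variables need independent swaps. As [avg_op] uses one word for both, the outer average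
   supplies the word of the first variable. *)
have -> : spread n m (gather n m f) =
    2 ^- L *: \sum_(y : cube L) avg_op L (fun=> mask_flip n (ext y)) (mask_flip m) f.
  apply: (@lin_map_ext R V (fun f => spread n m (gather n m f)) (fun f => 2 ^- L *:
    \sum_(y : cube L) avg_op L (fun=> mask_flip n (ext y)) (mask_flip m) f) f).
  - exact: (lin_map_comp (@spread_lin R n m) (@gather_lin R n m)).
  - move=> a u v; rewrite scalerA mulrC -scalerA -scalerDr; congr (_ *: _).
    by rewrite scaler_sumr -big_split; apply: eq_bigr => y _; rewrite avg_op_lin.
  move=> [K M] /(supp_lt_msupp hf)[/= KL ML]; apply: coef_ext => K' M'.
  rewrite gather.unlock lin_hk /= (lin_mapZ (@spread_lin R n m)) coefZ.
  transitivity (flip_kernel R L (mask_flip n) K K' * flip_kernel R L (mask_flip m) M M').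
    rewrite !mask_flip_kernel// coef_spread_hk !lvl_pre /collapse_weight.
    case: ifPn => [/eqP ->|_]; last by rewrite !(mul0r, mulr0).
    case: ifPn => [/eqP ->|_]; last by rewrite !(mul0r, mulr0).
    have collE (n' : nat -> nat) K1 K2 : (lvl K1 == lvl K2) &&
        (pre (rank n' (lvl K2)) (sel n' (bit K1)) == collapse n' K2) =
        (lvl K1 == lvl K2) && (collapse n' K1 == collapse n' K2).
      by case: eqP => //= e; rewrite {2}/collapse e.
    by rewrite !collE; ring.
  rewrite coefZ coef_sum /flip_kernel /mean -!mulrA; congr (_ * _).
  rewrite mulr_suml; apply: eq_bigr => y _.
  rewrite /avg_op coefZ coef_sum mulrCA; congr (_ * _).
  rewrite mulr_sumr; apply: eq_bigr => z _.
  rewrite tree_op_hk coefZ coef_hk -mulnb natrM; ring.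
rewrite NZ ger0_norm ?invr_ge0 ?exprn_ge0//.
rewrite -ler_pdivlMl ?invr_gt0 ?exprn_gt0// invrK.
apply: (le_trans (N_sum ND NZ _ _ _)).
apply: (@le_trans _ _ (\sum_(y : cube L) N f)).
  by apply: ler_sum => y _; exact: N_avg_op.
by rewrite sumr_const card_cube -[leLHS]mulr_natl natrX.
Qed.

End Gather.

(** * Iterated limits *)

Section UltrafilterLimits.
Variable R : realType.
Variable U : set_system nat.
Context {UU : UltraFilter U}.
Implicit Types (u v : nat -> R) (c e l : R).

Definition uconv u l := forall e : R, 0 < e -> \forall n \near U, `|u n - l| <= e.

Definition ulim u : R := xget 0 [set l | uconv u l].

Lemma near_cst (Q : Prop) : (\forall n \near U, Q) -> Q.
Proof. by move=> h; have [x hx] := filter_ex h. Qed.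

(** Compactness gives a cluster point, and a cluster point along an ultrafilter is a limit. *)
Lemma uconv_exists u c : (\forall n \near U, `|u n| <= c) -> exists l, uconv u l.
Proof.
move=> hc.
have [l [_ hl]] : (`[- c, c]%classic `&` cluster (u @ U)) !=set0.
  apply: segment_compact; apply: filterS hc => n /=.
  by rewrite in_itv /= ler_norml.
exists l => e e0.
have [//|hC] := in_ultra_setVsetC [set n | `|u n - l| <= e] UU.
have : ([set y | e < `|y - l| ] `&` [set y | `|l - y| < e]) !=set0.
  apply: hl.
    change (U [set n | e < `|u n - l|]).
    by apply: (@filterS _ U _ _ _ _ hC) => n /= hn; rewrite ltNge; apply/negP.
  by apply/nbhs_ballP; exists e.
by case=> y /= [h1]; rewrite distrC => h2; have := lt_trans h1 h2; rewrite ltxx.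
Qed.

Lemma uconv_ulim u c : (\forall n \near U, `|u n| <= c) -> uconv u (ulim u).
Proof. by move=> /uconv_exists [l hl]; rewrite /ulim; case: xgetP => // /(_ l). Qed.

Lemma uconv_bound u l c : uconv u l -> (\forall n \near U, `|u n| <= c) -> `|l| <= c.
Proof.
move=> hl hc; apply/ler_addgt0Pr => e e0; apply: near_cst.
near=> n; have h1 : `|u n - l| <= e by near: n; exact: hl.
have h2 : `|u n| <= c by near: n.
rewrite -[l](subKr (u n)); apply: (le_trans (ler_normB _ _)); exact: lerD.
Unshelve. all: by end_near. Qed.

Lemma uconv_lin u v l k a : uconv u l -> uconv v k ->
  uconv (fun n => a * u n + v n) (a * l + k).
Proof.
move=> hu hv e e0; have a0 : 0 < `|a| + 1 by rewrite ltr_wpDl.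
have e2 : 0 < e / (`|a| + 1) / 2 by rewrite !divr_gt0.
have e2' : 0 < e / 2 by rewrite divr_gt0.
near=> n; have h1 : `|u n - l| <= e / (`|a| + 1) / 2 by near: n; exact: hu.
have h2 : `|v n - k| <= e / 2 by near: n; exact: hv.
have -> : a * u n + v n - (a * l + k) = a * (u n - l) + (v n - k) by ring.
apply: (le_trans (ler_normD _ _)); rewrite normrM.
apply: (@le_trans _ _ (`|a| * (e / (`|a| + 1) / 2) + e / 2)).
  by apply: lerD => //; rewrite ler_wpM2l.
rewrite [leRHS](_ : e = (`|a| + 1) * (e / (`|a| + 1) / 2) + e / 2); last first.
  by field; exact: lt0r_neq0.
rewrite lerD2r; apply: ler_wpM2r; first exact: ltW.
by rewrite lerDl.
Unshelve. all: by end_near. Qed.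

Lemma uconv_unique u l k : uconv u l -> uconv u k -> l = k.
Proof.
move=> hl hk; have h := uconv_lin (-1) hl hk.
apply/eqP; rewrite eq_sym -subr_eq0 -normr_le0.
rewrite (_ : k - l = -1 * l + k); last by ring.
apply: (uconv_bound h); apply: nearW => n.
by rewrite mulN1r addNr normr0.
Qed.

Lemma uconv_eq u l : uconv u l -> ulim u = l.
Proof.
by move=> h; rewrite /ulim; case: xgetP => [k _ hk|/(_ l)//]; exact: uconv_unique hk h.
Qed.

End UltrafilterLimits.

Definition cyl (R : realType) (al : bits -> R) := exists L, dep L al.

Section BoundedFunctionals.
Variable R : realType.
Implicit Types (al be : bits -> R) (d : dyadic -> dyadic -> R).

(** A crude bound for the supremum of a function of [L] digits; it suffices because it does not
    change with the level of the mean. *)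
Definition sup_bound (L : nat) al : R := \sum_(y : cube L) `|al (ext y)|.

Lemma sup_bound_ge0 L al : 0 <= sup_bound L al.
Proof. by apply: sumr_ge0. Qed.

Lemma mean_sup_bound L n al : dep L al -> mean n (fun s => `|al s|) <= sup_bound L al.
Proof.
move=> h; rewrite -(mean_const n (sup_bound L al)); apply: le_mean => s.
exact: mean_ge_dep.
Qed.

Lemma cyl_lin a al be : cyl al -> cyl be -> cyl (fun s => a * al s + be s).
Proof.
move=> [L h] [L' h']; exists (maxn L L') => s s' e.
by rewrite (h s s') ?(h' s s')//; apply: agree_le e; rewrite leq_max leqnn ?orbT.
Qed.

Lemma cyl_cst (c : R) : cyl (fun _ : bits => c).
Proof. by exists 0%N. Qed.

Definition l1_functional (c : R) (phi : (bits -> R) -> R) :=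
  (forall a al be, cyl al -> cyl be ->
     phi (fun s => a * al s + be s) = a * phi al + phi be) /\
  (forall L al, dep L al -> `|phi al| <= c * mean L (fun s => `|al s|)).

Lemma l1_functional0 c phi : l1_functional c phi -> phi (fun=> 0) = 0.
Proof.
move=> [h _]; have := h (-1) (fun=> 0) (fun=> 0) (cyl_cst 0) (cyl_cst 0).
rewrite (_ : (fun _ : bits => -1 * (0 : R) + 0) = (fun=> 0)); first lra.
by apply/funext => s; ring.
Qed.

Lemma l1_functional_sum c phi (xs : seq nat) (a : nat -> R) (al : nat -> bits -> R) :
  l1_functional c phi -> (forall x, x \in xs -> cyl (al x)) ->
  phi (fun s => \sum_(x <- xs) a x * al x s) = \sum_(x <- xs) a x * phi (al x).
Proof.
move=> h; elim: xs => [|x xs IH] hc.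
  rewrite big_nil -[RHS](l1_functional0 h); congr phi; apply/funext => s.
  by rewrite big_nil.
have hc' y : y \in xs -> cyl (al y) by move=> yx; apply: hc; rewrite inE yx orbT.
have cs : cyl (fun s => \sum_(x <- xs) a x * al x s).
  elim: xs hc' {IH hc} => [|y xs IH] hc'.
    by exists 0%N => s s' _; rewrite !big_nil.
  rewrite (_ : (fun s => _) = (fun s => a y * al y s + \sum_(x <- xs) a x * al x s)).
    apply: cyl_lin; first by apply: hc'; exact: mem_head.
    by apply: IH => z zx; apply: hc'; rewrite inE zx orbT.
  by apply/funext => s; rewrite big_cons.
rewrite big_cons -IH// -(h.1 (a x))//; last by apply: hc; exact: mem_head.
by congr phi; apply/funext => s; rewrite big_cons.
Qed.

Definition rad (x : nat) (s : bits) : R := (-1) ^+ s x.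

Lemma mean_rademacher_sq L (xs : seq nat) (sg : nat -> bool) : uniq xs ->
  {in xs, forall x, (x < L)%N} ->
  mean L (fun s => (\sum_(x <- xs) (-1) ^+ sg x * rad x s) ^+ 2) = (size xs)%:R.
Proof.
elim: xs => [|x xs IH] /=.
  move=> _ _; rewrite -[RHS](mean_const L); apply: eq_mean => s.
  by rewrite big_nil expr0n.
move=> /andP[nx ux] hL; have hL' : {in xs, forall x, (x < L)%N}.
  by move=> y yx; apply: hL; rewrite inE yx orbT.
set g := fun s : bits => \sum_(x <- xs) (-1) ^+ sg x * rad x s.
have gd : dep L g.
  move=> s s' e; rewrite /g big_seq [RHS]big_seq; apply: eq_bigr => y yx.
  by rewrite /rad e// hL'.
transitivity (mean L (fun s => g s ^+ 2) +
   (2 * (-1) ^+ sg x * mean L (fun s => rad x s * g s) + mean L (fun=> 1))).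
  rewrite -meanZ -!meanD; apply: eq_mean => s; rewrite big_cons -/(g s).
  by rewrite /rad; case: (sg x); case: (s x); rewrite ?expr0 ?expr1; ring.
rewrite mean_const.
rewrite IH// (@mean_odd _ _ x); first by rewrite mulr0 add0r -natr1 addrC.
  move=> s s' e; rewrite (gd _ _ e) /rad e//; apply: hL; exact: mem_head.
move=> s; rewrite /rad /flipb setb_eq signrN mulNr; congr (- (_ * _)).
rewrite /g big_seq [RHS]big_seq; apply: eq_bigr => y yx; congr (_ * _).
by rewrite /rad /setb; case: eqP => // e; rewrite -e yx in nx.
Qed.

Variable U : set_system nat.
Context {UU : UltraFilter U}.
Hypothesis Ufar : forall k, \forall x \near U, (k < x)%N.

Lemma many_elements (A : set nat) k N : U A ->
  exists xs, [/\ uniq xs, size xs = N, {in xs, forall x, A x} &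
                 {in xs, forall x, (k < x)%N}].
Proof.
move=> hA; elim: N => [|N [xs [uxs sxs hxs hk]]]; first by exists [::].
have [x [Ax xk]] : exists x, A x /\ (maxn k (\max_(y <- xs) y) < x)%N.
  by have [x [Ax hx]] := filter_ex (filterI hA (Ufar (maxn k (\max_(y <- xs) y))));
    exists x.
exists (x :: xs); split => /=; rewrite ?sxs//.
- rewrite uxs andbT; apply/negP => xin.
  have := leq_bigmax_seq (P := predT) (F := id) _ xin isT => /= h.
  by move: xk; rewrite gtn_max => /andP[_]; rewrite ltnNge h.
- by move=> y; rewrite inE => /orP[/eqP ->//|/hxs].
- move=> y; rewrite inE => /orP[/eqP ->|/hk//].
  by move: xk; rewrite gtn_max => /andP[].
Qed.

(* Otherwise a sum of N functions [+- rad x * al] would have L^1 norm of order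
   at most sqrt N, and a value at [phi] of order at least N. *)
Lemma rademacher_small c phi L al e : 0 <= c -> l1_functional c phi -> dep L al ->
  0 < e -> \forall x \near U, `|phi (fun s => rad x s * al s)| <= e.
Proof.
move=> c0 hphi hal e0.
have [//|hC] := in_ultra_setVsetC [set x | `|phi (fun s => rad x s * al s)| <= e] UU.
exfalso.
set A := sup_bound L al.
pose K := (Num.truncn (c * A / e)).+1.
(* A sum of [K ^ 2] functions will have L^1 norm at most [A * K] and value at least [K ^ 2 * e],
   which this inequality rules out. *)
have hK : c * A < K%:R * e.
  by rewrite -ltr_pdivrMr//; exact: truncnS_gt.
have [xs [uxs sxs hxs hk]] := many_elements 0 (K ^ 2) hC.
pose sg x := phi (fun s => rad x s * al s) < 0.
pose g s := \sum_(x <- xs) (-1) ^+ sg x * rad x s.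
pose L' := maxn L (\max_(y <- xs) y).+1.
have xsL : {in xs, forall x, (x < L')%N}.
  move=> x xin; rewrite leq_max ltnS.
  by rewrite (leq_bigmax_seq (P := predT) (F := id) _ xin isT) orbT.
have gd : dep L' g.
  move=> s s' h; rewrite /g big_seq [RHS]big_seq; apply: eq_bigr => y yx.
  by rewrite /rad h// xsL.
have ald : dep L' al by apply: dep_le hal; rewrite leq_max leqnn.
have lower : (K ^ 2)%:R * e <= phi (fun s => g s * al s).
  have -> : (fun s => g s * al s) =
      (fun s => \sum_(x <- xs) (-1) ^+ sg x * (rad x s * al s)).
    by apply/funext => s; rewrite /g mulr_suml; apply: eq_bigr => x _; rewrite mulrA.
  rewrite (l1_functional_sum _ hphi); last first.
    move=> x xin; exists L' => s s' h; rewrite (ald _ _ h) /rad h//; exact: xsL.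
  rewrite -sxs -sum1_size natr_sum mulr_suml big_seq [leRHS]big_seq.
  apply: ler_sum => x xin; rewrite mul1r.
  have /= /negP := hxs x xin; rewrite -ltNge => /ltW /le_trans; apply.
  rewrite /sg; case: ltP => h; first by rewrite ltr0_norm// expr1 mulN1r.
  by rewrite ger0_norm// expr0 mul1r.
have K0 : (0 : R) < K%:R by rewrite ltr0n.
have upper : phi (fun s => g s * al s) <= c * (A * K%:R).
  apply: (le_trans (ler_norm _)); apply: (le_trans (hphi.2 L' _ _)).
    by move=> s s' h; rewrite (gd _ _ h) (ald _ _ h).
  rewrite ler_wpM2l//.
  (* The inequality [|g| <= (g^2 + K^2) / (2 K)] stands in for Cauchy-Schwarz, as [g^2] has mean
     [K^2]. *)
  apply: (@le_trans _ _ (mean L' (fun s => A * ((2 * K%:R)^-1 * (g s ^+ 2 + K%:R ^+ 2))))).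
    apply: le_mean => s; rewrite normrM mulrC.
    apply: ler_pM => //; first exact: mean_ge_dep.
    rewrite mulrC ler_pdivlMr ?mulr_gt0// -[leRHS]addr0 -subr_ge0.
    have -> : g s ^+ 2 = `|g s| ^+ 2 by rewrite real_normK ?num_real.
    rewrite (_ : _ - _ = (`|g s| - K%:R) ^+ 2); last by ring.
    exact: sqr_ge0.
  rewrite meanZ meanZ meanD mean_const mean_rademacher_sq// sxs natrX.
  rewrite ler_wpM2l ?sup_bound_ge0// le_eqVlt; apply/orP; left; apply/eqP.
  by field; exact: lt0r_neq0.
have := le_trans lower upper; apply/negP; rewrite -ltNge natrX.
have -> : c * (A * K%:R) = K%:R * (c * A) by ring.
have -> : K%:R ^+ 2 * e = K%:R * (K%:R * e) by ring.
by rewrite ltr_pM2l.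
Qed.

(** The bound is asked only near [U], because the mean over [n] digits is known to agree with the
    one over [L] digits only once [n] is at least [L]. *)
Lemma l1_functional_ulim c (phi : nat -> (bits -> R) -> R) :
  (forall n a al be, cyl al -> cyl be ->
     phi n (fun s => a * al s + be s) = a * phi n al + phi n be) ->
  (forall L al, dep L al ->
     \forall n \near U, `|phi n al| <= c * mean L (fun s => `|al s|)) ->
  l1_functional c (fun al => ulim U (phi ^~ al)).
Proof.
move=> h1 h2; split=> [a al be|L al hal]; last first.
  exact: (uconv_bound (uconv_ulim (h2 _ _ hal)) (h2 _ _ hal)).
move=> ca cb; have [L hL] := ca; have [L' hL'] := cb; apply: uconv_eq.
rewrite (_ : (fun n => _) = (fun n => a * phi n al + phi n be)).
  by apply: uconv_lin; [apply: uconv_ulim (h2 _ _ hL)|apply: uconv_ulim (h2 _ _ hL')].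
by apply/funext => n; exact: h1.
Qed.

Definition pairing d (n m : nat) al be : R :=
  mean n (fun s => mean m (fun t => al s * be t * d (pre n s) (pre m t))).

Definition transpose d : dyadic -> dyadic -> R := fun K M => d M K.

(* [lim1 d m] is the limit of [pairing d n m] as [n] tends to infinity, and
   [lim2 d] the iterated limit where first [n] and then [m] tend to infinity; the
   limits in the opposite order are those of [transpose d]. *)
Definition lim1 d (m : nat) al be : R := ulim U (fun n => pairing d n m al be).

Definition lim2 d al be : R := ulim U (fun m => lim1 d m al be).

Lemma pairing_transpose d n m al be :
  pairing (transpose d) m n be al = pairing d n m al be.
Proof.
rewrite /pairing mean_exchange; apply: eq_mean => s; apply: eq_mean => t.
by rewrite /transpose [be t * _]mulrC.
Qed.

Lemma pairing_lin_l d n m a al al' be :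
  pairing d n m (fun s => a * al s + al' s) be =
  a * pairing d n m al be + pairing d n m al' be.
Proof.
rewrite /pairing -meanZ -meanD; apply: eq_mean => s.
rewrite -meanZ -meanD; apply: eq_mean => t; ring.
Qed.

Lemma pairing_lin_r d n m a al be be' :
  pairing d n m al (fun s => a * be s + be' s) =
  a * pairing d n m al be + pairing d n m al be'.
Proof. by rewrite -!(@pairing_transpose d) pairing_lin_l. Qed.

Variables (d : dyadic -> dyadic -> R) (D : R).
Hypothesis dD : forall K M, `|d K M| <= D.

Lemma D_ge0 : 0 <= D.
Proof. by apply: le_trans (dD (pre 0 xpred0) (pre 0 xpred0)). Qed.

Lemma pairing_bound n m al be : `|pairing d n m al be| <=
  D * (mean n (fun s => `|al s|) * mean m (fun t => `|be t|)).
Proof.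
rewrite -meanZr -meanZ; apply: (le_trans (norm_mean _ _)); apply: le_mean => s.
rewrite -meanZ -meanZ; apply: (le_trans (norm_mean _ _)); apply: le_mean => t.
by rewrite !normrM mulrC ler_wpM2r ?mulr_ge0.
Qed.

Lemma mean_norm_ge0 n al : 0 <= mean n (fun s => `|al s|).
Proof. by apply: mean_ge0 => s. Qed.

Lemma near_mean L al : dep L al ->
  \forall n \near U, mean n (fun s => `|al s|) = mean L (fun s => `|al s|).
Proof.
move=> h; apply: filterS (Ufar L) => n Ln; apply: mean_dep; first exact: ltnW.
by move=> s s' /h ->.
Qed.

Lemma pairing_sup_bound n m L L' al be : dep L al -> dep L' be ->
  `|pairing d n m al be| <= D * (sup_bound L al * sup_bound L' be).
Proof.
move=> ha hb; apply: (le_trans (pairing_bound _ _ _ _)).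
rewrite ler_wpM2l ?D_ge0//; apply: ler_pM; rewrite ?mean_norm_ge0//;
  exact: mean_sup_bound.
Qed.

Lemma lim1_conv m al be : cyl al -> cyl be ->
  uconv U (fun n => pairing d n m al be) (lim1 d m al be).
Proof.
move=> [L ha] [L' hb]; apply: uconv_ulim; apply: nearW => n.
exact: pairing_sup_bound ha hb.
Qed.

Lemma lim1_l1 m L be : dep L be ->
  l1_functional (D * sup_bound L be) (fun al => lim1 d m al be).
Proof.
move=> hb; apply: l1_functional_ulim => [n a al al' _ _|L' al ha].
  exact: pairing_lin_l.
apply: filterS (near_mean ha) => n <-; apply: (le_trans (pairing_bound _ _ _ _)).
rewrite -mulrA ler_wpM2l ?D_ge0// mulrC ler_wpM2r ?mean_norm_ge0//.
exact: mean_sup_bound.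
Qed.

Lemma lim1_bound m L al be : dep L al -> cyl be ->
  `|lim1 d m al be| <= D * sup_bound L al * mean m (fun t => `|be t|).
Proof.
move=> ha hb; have hc : cyl al by exists L.
apply: (uconv_bound (lim1_conv m hc hb)); apply: nearW => n.
apply: (le_trans (pairing_bound _ _ _ _)); rewrite -mulrA ler_wpM2l ?D_ge0//.
by rewrite ler_wpM2r ?mean_norm_ge0//; exact: mean_sup_bound.
Qed.

Lemma lim1_lin_r m a al be be' : cyl al -> cyl be -> cyl be' ->
  lim1 d m al (fun s => a * be s + be' s) = a * lim1 d m al be + lim1 d m al be'.
Proof.
move=> ca cb cb'; apply: uconv_eq.
rewrite (_ : (fun n => _) =
  (fun n => a * pairing d n m al be + pairing d n m al be')).
  by apply: uconv_lin; exact: lim1_conv.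
by apply/funext => n; exact: pairing_lin_r.
Qed.

Lemma lim2_conv al be : cyl al -> cyl be ->
  uconv U (fun m => lim1 d m al be) (lim2 d al be).
Proof.
move=> [L ha] [L' hb]; apply: (@uconv_ulim _ _ _ _ (D * sup_bound L al * sup_bound L' be)).
apply: nearW => m; apply: (le_trans (lim1_bound m ha _)); first by exists L'.
by rewrite ler_wpM2l ?mulr_ge0 ?D_ge0 ?sup_bound_ge0//; exact: mean_sup_bound.
Qed.

Lemma lim2_l1_l L be : dep L be ->
  l1_functional (D * sup_bound L be) (fun al => lim2 d al be).
Proof.
move=> hb; have h m := lim1_l1 m hb.
apply: l1_functional_ulim => [m|L' al ha]; first exact: (h m).1.
by apply: nearW => m; exact: (h m).2.
Qed.

Lemma lim2_l1_r L al : dep L al ->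
  l1_functional (D * sup_bound L al) (fun be => lim2 d al be).
Proof.
move=> ha; have ca : cyl al by exists L.
apply: l1_functional_ulim => [m a be be' cb cb'|L' be hb]; first exact: lim1_lin_r.
apply: filterS (near_mean hb) => m <-; apply: lim1_bound => //; by exists L'.
Qed.

End BoundedFunctionals.

(** * Choice of the levels *)

Section Selection.
Variable R : realType.
Implicit Types (al be : bits -> R) (d : dyadic -> dyadic -> R).
Variable U : set_system nat.
Context {UU : UltraFilter U}.
Hypothesis Ufar : forall k, \forall x \near U, (k < x)%N.

Lemma near_lt (Q : nat -> nat -> Prop) k : (forall l, \forall x \near U, Q l x) ->
  \forall x \near U, forall l, (l < k)%N -> Q l x.
Proof.
move=> h; have : \forall x \near U, forall l : 'I_k, Q l x.
  by apply: filter_forall => l; exact: h.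
by apply: filterS => x hx l lk; exact: (hx (Ordinal lk)).
Qed.

Lemma riesz_cyl n i w : cyl (riesz R n i w).
Proof.
exists (\max_(k < i) n k).+1%N; apply: riesz_dep => k ki.
by rewrite ltnS -[k]/(val (Ordinal ki)) leq_bigmax.
Qed.

(** Up to order [k] there are finitely many Riesz products, as only [k] digits of [w] enter; so the
    conditions on them can be intersected. *)
Lemma near_riesz n k (Q : (bits -> R) -> nat -> Prop) :
  (forall al, cyl al -> \forall x \near U, Q al x) ->
  \forall x \near U, forall i w, (i <= k)%N -> Q (riesz R n i w) x.
Proof.
move=> h.
have : \forall x \near U, forall (i : 'I_k.+1) (y : cube k), Q (riesz R n i (ext y)) x.
  by apply: filter_forall => i; apply: filter_forall => y; exact/h/riesz_cyl.
apply: filterS => x hx i w ik; have := hx (Ordinal (ik : (i < k.+1)%N)) (rest k w).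
congr (Q _ x); apply/funext => s; apply: riesz_agree => // j ji.
by rewrite ext_rest// (leq_trans ji).
Qed.

Lemma eq_riesz n n' i w : (forall k, (k < i)%N -> n k = n' k) ->
  riesz R n i w = riesz R n' i w.
Proof. by move=> h; apply/funext => s; apply: eq_bigr => k _; rewrite h. Qed.

(** Dependent choice: the condition on the value at [p] refers to earlier values only. *)
Lemma exists_selection (Q : nat -> (nat -> nat) -> nat -> Prop) :
  (forall p h, \forall x \near U, Q p h x) ->
  (forall p h h' x, (forall i, (i < p)%N -> h i = h' i) -> Q p h x -> Q p h' x) ->
  exists x : nat -> nat, forall p, Q p x (x p).
Proof.
move=> hQ ext_Q.
have hg p : {G : (nat -> nat) -> nat | forall h, Q p h (G h)}.
  have [G hG] := boolp.choice (fun h => filter_ex (hQ p h)); by exists G.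
pose g p := sval (hg p).
pose xs := fix xs p := if p is q.+1 then rcons (xs q) (g q (nth 0%N (xs q))) else [::].
have sxs p : size (xs p) = p by elim: p => //= p IH; rewrite size_rcons IH.
exists (fun p => g p (nth 0%N (xs p))) => p.
apply: ext_Q (svalP (hg p) _) => i; elim: p => // p IH; rewrite ltnS leq_eqVlt /= nth_rcons sxs.
by case: ltnP => [/IH ->//|_] /orP[/eqP -> |//]; rewrite eqxx.
Qed.

(* The requirements on a candidate [x] for the next level in the first variable,
   when the levels [m 0], .., [m (k - 1)] in the second one are already chosen; for
   the choice of levels in the second variable, use [transpose d]. *)
Definition good d (m : nat -> nat) (k : nat) al be (e : R) (x : nat) :=
  [/\ forall l, (l < k)%N -> `|pairing d x (m l) al be - lim1 U d (m l) al be| <= e /\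
        `|lim1 U d (m l) (fun s => rad R x s * al s) be| <= e,
      `|lim2 U d (fun s => rad R x s * al s) be| <= e,
      `|lim1 U (transpose d) x be al - lim2 U (transpose d) be al| <= e &
      `|lim2 U (transpose d) be (fun s => rad R x s * al s)| <= e].

Lemma near_good d (D : R) m k al be (e : R) : (forall K M, `|d K M| <= D) -> 0 < e ->
  cyl al -> cyl be -> \forall x \near U, good d m k al be e x.
Proof.
move=> dD e0 ca cb; have [L hL] := ca; have [L' hL'] := cb.
have tD K M : `|transpose d K M| <= D by exact: dD.
have hb : 0 <= D * sup_bound L' be by rewrite mulr_ge0 ?sup_bound_ge0// (D_ge0 dD).
have h1 : \forall x \near U, forall l, (l < k)%N ->
    `|pairing d x (m l) al be - lim1 U d (m l) al be| <= e /\
    `|lim1 U d (m l) (fun s => rad R x s * al s) be| <= e.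
  apply: near_lt => l; apply: (@filterI _ U); first exact: (lim1_conv dD (m l) ca cb e0).
  exact: (rademacher_small Ufar hb (lim1_l1 Ufar dD (m l) hL') hL e0).
have h2 : \forall x \near U, `|lim2 U d (fun s => rad R x s * al s) be| <= e.
  exact: (rademacher_small Ufar hb (lim2_l1_l Ufar dD hL') hL e0).
have h3 : \forall x \near U, `|lim1 U (transpose d) x be al - lim2 U (transpose d) be al| <= e.
  exact: (lim2_conv tD cb ca e0).
have h4 : \forall x \near U, `|lim2 U (transpose d) be (fun s => rad R x s * al s)| <= e.
  exact: (rademacher_small Ufar hb (lim2_l1_r Ufar tD hL') hL e0).
apply: (@filterS _ U _ _ _ _ (filterI (filterI h1 h2) (filterI h3 h4))).
by move=> x [[g1 g2] [g3 g4]]; split.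
Qed.

Lemma good_ext d m m' k al be e x : (forall l, (l < k)%N -> m l = m' l) ->
  good d m k al be e x -> good d m' k al be e x.
Proof.
by move=> h [h1 h2 h3 h4]; split=> // l lk; rewrite -h//; exact: h1.
Qed.

(* The levels are chosen in the order m 0, n 0, m 1, n 1, .. *)
Lemma selection d (D : R) (e : nat -> R) : (forall K M, `|d K M| <= D) ->
  (forall k, 0 < e k) -> exists n m : nat -> nat,
  [/\ strict_incr n, strict_incr m,
      forall k i w j v, (i <= k)%N -> (j <= k.+1)%N ->
        good d m k.+1 (riesz R n i w) (riesz R m j v) (e k) (n k) &
      forall k i w j v, (i <= k)%N -> (j <= k)%N ->
        good (transpose d) n k (riesz R m j v) (riesz R n i w) (e k) (m k)].
Proof.
move=> dD e0; have tD K M : `|transpose d K M| <= D by exact: dD.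
pose n_ (h : nat -> nat) k := h k.*2.+1.
pose m_ (h : nat -> nat) k := h k.*2.
(* Position [2k] holds [m k] and [2k + 1] holds [n k]. Before position [p], [p./2] levels [n] and
   [uphalf p] levels [m] are known, which limits the orders of the Riesz products. *)
pose Q p (h : nat -> nat) x := (forall i, (i < p)%N -> (h i < x)%N) /\
  forall i w j v, (i <= p./2)%N -> (j <= uphalf p)%N -> if odd p
    then good d (m_ h) p./2.+1 (riesz R (n_ h) i w) (riesz R (m_ h) j v) (e p./2) x
    else good (transpose d) (n_ h) p./2 (riesz R (m_ h) j v) (riesz R (n_ h) i w)
           (e p./2) x.
have [||x hx] := @exists_selection Q.
- move=> p h.
  have h1 : \forall x \near U, forall i, (i < p)%N -> (h i < x)%N.
    by apply: near_lt => i; exact: Ufar.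
  pose Q' al be x := if odd p then good d (m_ h) p./2.+1 al be (e p./2) x
    else good (transpose d) (n_ h) p./2 be al (e p./2) x.
  have h2 : \forall x \near U, forall i w, (i <= p./2)%N ->
      forall j v, (j <= uphalf p)%N -> Q' (riesz R (n_ h) i w) (riesz R (m_ h) j v) x.
    apply: (@near_riesz (n_ h) p./2 (fun al x => forall j v, (j <= uphalf p)%N ->
      Q' al (riesz R (m_ h) j v) x)) => al ca.
    apply: (@near_riesz (m_ h) (uphalf p) (Q' al)) => be cb.
    by rewrite /Q'; case: (odd p); [apply: (near_good _ _ dD)|apply: (near_good _ _ tD)].
  apply: (@filterS _ U _ _ _ _ (filterI h1 h2)) => x [hx1 hx2]; split=> // i w j v ip jp.
  exact: hx2.
- move=> p h h' x hh [h1 h2]; split=> [i ip|i w j v ip jp]; first by rewrite -hh// h1.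
  have := h2 i w j v ip jp.
  rewrite (@eq_riesz (n_ h) (n_ h')); last first.
    move=> k ki; apply: hh; rewrite -(odd_double_half p); move: ki ip; lia.
  rewrite (@eq_riesz (m_ h) (m_ h')); last first.
    move=> k ki; apply: hh; have := odd_double_half p.
    by move: ki jp; rewrite uphalf_half; case: (odd p); lia.
  case: ifPn => op; apply: good_ext => l lk; apply: hh;
    have := odd_double_half p; move: lk; [rewrite op|rewrite (negbTE op)]; lia.
exists (n_ x), (m_ x); split.
- by move=> k; apply: (hx k.+1.*2.+1).1; lia.
- by move=> k; apply: (hx k.+1.*2).1; lia.
- move=> k i w j v ik jk; have := (hx k.*2.+1).2 i w j v.
  rewrite /= odd_double /=. by rewrite uphalf_double doubleK; apply.
move=> k i w j v ik jk; have := (hx k.*2).2 i w j v.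
by rewrite odd_double /= uphalf_double doubleK; apply.
Qed.

End Selection.

(** * Multipliers with small increments *)

Section SmallIncrements.
Variable R : realType.

(** The size allowed is that of the index being increased. The regions overlap at [l = k] and
    [l = k + 1], so that every mixed second difference is a difference of two increments of the same
    kind. *)
Definition small_incr (G : nat -> bits -> nat -> bits -> R) (e : nat -> R) (c : R) :=
  [/\ forall k w l v, (l <= k.+1)%N -> `|G k.+1 w l v - G k w l v| <= e k,
      forall k w l v, (k <= l)%N -> `|G k w l.+1 v - G k w l v| <= e l &
      forall w v, `|G 0%N w 0%N v - c| <= e 0%N].

(* 16^-(k+2) is at most 4^-(k+2) * 4^-(l+2) for l <= k, cf. [mult_bound_incr2]. *)
Definition incr_size (kappa : R) (k : nat) : R := kappa / (2 * 16 ^+ k.+2).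

Variable N : V2 R -> R.
Hypothesis ND : forall f g, N (f + g) <= N f + N g.
Hypothesis NZ : forall a f, N (a *: f) = `|a| * N f.
Hypothesis NT : forall gam gam' f, N (tree_op gam gam' f) = N f.

(** A mixed second difference is split along the larger index into two increments, whence the 2 in
    [incr_size]. When an index is 0, a single increment or the distance to [c] is left. *)
Lemma mult_bound_small_incr G c kappa : 0 <= kappa ->
  (forall k w w' l v v', agree k w w' -> agree l v v' -> G k w l v = G k w' l v') ->
  small_incr G (incr_size kappa) c ->
  mult_bound N (fun K M => G (lvl K) (bit K) (lvl M) (bit M) - c) kappa.
Proof.
rewrite /incr_size => k0 dG [h1 h2 h3].
apply: (@mult_bound_incr2 R N ND NZ NT (fun k w l v => G k w l v - c)) => //.
  by move=> k w w' l v v' hw hv; rewrite (dG _ _ _ _ _ _ hw hv).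
have p4 i : (0 : R) < 4 ^+ i by rewrite exprn_gt0.
have e4 i j : (i <= j)%N -> (4 : R) ^+ i <= 4 ^+ j by move=> ij; rewrite ler_eXn2l// ltr1n.
have e16 k i j : (i <= k.+2)%N -> (j <= k.+2)%N ->
    2 * (kappa / (2 * 16 ^+ k.+2)) <= kappa * (4 ^- i * 4 ^- j).
  move=> ik jk; rewrite -invfM mulrA -mulf_div mulfV// mul1r.
  have p16 : (0 : R) < 16 ^+ k.+2 by exact: exprn_gt0.
  rewrite ler_wpM2l// lef_pV2 ?posrE ?p16 ?mulr_gt0//.
  have -> : (16 : R) = 4 * 4 by rewrite -natrM.
  by rewrite exprMn; apply: ler_pM; rewrite ?exprn_ge0//; exact: e4.
have pe k : 0 <= kappa / (2 * 16 ^+ k.+2) by apply: divr_ge0 => //; apply: mulr_ge0 => //; exact: exprn_ge0.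
have half k x : x <= kappa / (2 * 16 ^+ k.+2) -> x <= 2 * (kappa / (2 * 16 ^+ k.+2)).
  by move=> h; apply: (le_trans h); rewrite ler_peMl// ler1n.
move=> [|k] w [|l] v; rewrite /incr2 /incr.
- rewrite !subr0; apply: le_trans (half _ _ (h3 w v)) _; exact: e16.
- rewrite subr0 (_ : _ - c - _ = G 0%N w l.+1 v - G 0%N w l v); last by ring.
  by apply: le_trans (half _ _ (h2 0%N w l v isT)) _; exact: e16.
- rewrite !subr0 (_ : _ - c - _ = G k.+1 w 0%N v - G k w 0%N v); last by ring.
  by apply: le_trans (half _ _ (h1 k w 0%N v isT)) _; exact: e16.
have [lk|kl] := leqP l k.
  rewrite (_ : _ - _ = (G k.+1 w l.+1 v - G k w l.+1 v) - (G k.+1 w l v - G k w l v)); last by ring.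
  apply: (le_trans (ler_normB _ _)).
  have H1 := h1 k w l.+1 v lk; have H2 := h1 k w l v (leqW lk).
  apply: (le_trans (lerD H1 H2)); rewrite -mulr2n -[leLHS]mulr_natl.
  exact: e16.
rewrite (_ : _ - _ = (G k.+1 w l.+1 v - G k.+1 w l v) - (G k w l.+1 v - G k w l v)); last by ring.
apply: (le_trans (ler_normB _ _)).
have H1 := h2 k.+1 w l v kl; have H2 := h2 k w l v (ltnW kl).
apply: (le_trans (lerD H1 H2)); rewrite -mulr2n -[leLHS]mulr_natl.
by apply: e16; rewrite ?ltnS// ltnW// ltnW.
Qed.

End SmallIncrements.

Section Diagonalization.
Variable R : realType.
Variable U : set_system nat.
Context {UU : UltraFilter U}.
Hypothesis Ufar : forall k, \forall x \near U, (k < x)%N.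
Variables (d : dyadic -> dyadic -> R) (D : R).
Hypothesis dD : forall K M, `|d K M| <= D.
Variables (n m : nat -> nat) (e : nat -> R).
Hypothesis he : forall k, e k.+1 <= e k.
Hypothesis hgn : forall k i w j v, (i <= k)%N -> (j <= k.+1)%N ->
  good U d m k.+1 (riesz R n i w) (riesz R m j v) (e k) (n k).
Hypothesis hgm : forall k i w j v, (i <= k)%N -> (j <= k)%N ->
  good U (transpose d) n k (riesz R m j v) (riesz R n i w) (e k) (m k).

Let tD K M : `|transpose d K M| <= D. Proof. exact: dD. Qed.

(** One more digit adds a Rademacher function times the previous product, on which [phi] is made
    small by the choice of [x i]. *)
Lemma riesz_step c (phi : (bits -> R) -> R) x i w : l1_functional c phi ->
  `|phi (riesz R x i.+1 w) - phi (riesz R x i w)| =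
  `|phi (fun s => rad R (x i) s * riesz R x i w s)|.
Proof.
move=> hphi; have ca : cyl (fun s => rad R (x i) s * riesz R x i w s).
  have [L hL] := @riesz_cyl R x i w; exists (maxn L (x i).+1) => s s' h.
  rewrite (hL s s'); last by apply: agree_le h; rewrite leq_max leqnn.
  by rewrite /rad h// leq_max ltnSn orbT.
have -> : riesz R x i.+1 w = (fun s => (-1) ^+ w i * (rad R (x i) s * riesz R x i w s)
    + riesz R x i w s).
  by apply/funext => s; rewrite rieszS /rad; ring.
rewrite (hphi.1 _ _ _ ca (@riesz_cyl R x i w)) addrK normrM.
by rewrite normrX normrN1 expr1n mul1r.
Qed.

Definition entry k w l v := pairing d (n k) (m l) (riesz R n k w) (riesz R m l v).

(* The two iterated limits of [entry]: [n k] tends to infinity first in [row_limit]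
   and last in [col_limit]. *)
Definition row_limit k w l v := lim2 U d (riesz R n k w) (riesz R m l v).

Definition col_limit k w l v := lim2 U (transpose d) (riesz R m l v) (riesz R n k w).

(** Continuing by 0 would create large increments at the diagonal; continuing by the limit that the
    entries approach does not. *)
Definition lower_part k w l v := if (l <= k)%N then entry k w l v else row_limit k w l v.

Definition upper_part k w l v := if (l <= k)%N then col_limit k w l v else entry k w l v.

Lemma entry_dep k w w' l v v' : agree k w w' -> agree l v v' ->
  (riesz R n k w = riesz R n k w') * (riesz R m l v = riesz R m l v').
Proof. by move=> hw hv; split; apply/funext => s; exact: riesz_agree. Qed.

Lemma row_limit_k k w l v : (l <= k.+1)%N ->
  `|row_limit k.+1 w l v - row_limit k w l v| <= e k.
Proof.
move=> lk; have [L hL] := @riesz_cyl R m l v.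
rewrite (@riesz_step _ (fun al => lim2 U d al (riesz R m l v)) _ _ _ (lim2_l1_l Ufar dD hL)).
by have [] := hgn w v (leqnn k) lk.
Qed.

Lemma row_limit_l k w l v : (k <= l)%N ->
  `|row_limit k w l.+1 v - row_limit k w l v| <= e l.
Proof.
move=> kl; have [L hL] := @riesz_cyl R n k w.
rewrite (@riesz_step _ (lim2 U d (riesz R n k w)) _ _ _ (lim2_l1_r Ufar dD hL)).
by have [] := hgm w v kl (leqnn l).
Qed.

Lemma col_limit_k k w l v : (l <= k.+1)%N ->
  `|col_limit k.+1 w l v - col_limit k w l v| <= e k.
Proof.
move=> lk; have [L hL] := @riesz_cyl R m l v.
rewrite (@riesz_step _ (lim2 U (transpose d) (riesz R m l v)) _ _ _ (lim2_l1_r Ufar tD hL)).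
by have [] := hgn w v (leqnn k) lk.
Qed.

Lemma col_limit_l k w l v : (k <= l)%N ->
  `|col_limit k w l.+1 v - col_limit k w l v| <= e l.
Proof.
move=> kl; have [L hL] := @riesz_cyl R n k w.
rewrite (@riesz_step _ (fun be => lim2 U (transpose d) be (riesz R n k w)) _ _ _
  (lim2_l1_l Ufar tD hL)).
by have [] := hgm w v kl (leqnn l).
Qed.

(** Three errors: each entry is close to its limit in the first level at the same [m l], and the two
    limits differ by a Rademacher term. *)
Lemma entry_k k w l v : (l <= k)%N ->
  `|entry k.+1 w l v - entry k w l v| <= 3 * e k.
Proof.
move=> lk; have [L hL] := @riesz_cyl R m l v.
have [/(_ l (leqW lk))[h1 _] _ _ _] := hgn w v (leqnn k.+1) (leqW (leqW lk)).
have [/(_ l lk)[h2 h3] _ _ _] := hgn w v (leqnn k) (leqW lk).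
have h4 := riesz_step n k w (lim1_l1 Ufar dD (m l) hL).
rewrite -h4 in h3; have := he k; rewrite /entry.
move: h1 h2 h3; rewrite !ler_norml => /andP[? ?] /andP[? ?] /andP[? ?] ?.
by apply/andP; split; lra.
Qed.

Lemma entry_l k w l v : (k < l)%N ->
  `|entry k w l.+1 v - entry k w l v| <= 3 * e l.
Proof.
move=> kl; have [L hL] := @riesz_cyl R n k w.
have [/(_ k (leqW kl))[h1 _] _ _ _] := hgm w v (leqW (ltnW kl)) (leqnn l.+1).
have [/(_ k kl)[h2 h3] _ _ _] := hgm w v (ltnW kl) (leqnn l).
have h4 := riesz_step m l v (lim1_l1 Ufar tD (n k) hL).
rewrite -h4 in h3; have := he l; rewrite /entry -!(pairing_transpose d).
move: h1 h2 h3; rewrite !ler_norml => /andP[? ?] /andP[? ?] /andP[? ?] ?.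
by apply/andP; split; lra.
Qed.

(** The level [n k] is chosen after [m k], so the entry is near its limit in the first level; [m k]
    was chosen so that this limit is near the iterated one. *)
Lemma entry_row_limit k w v : `|entry k w k v - row_limit k w k v| <= 2 * e k.
Proof.
have [/(_ k (ltnSn k))[h1 _] _ _ _] := hgn w v (leqnn k) (leqnSn k).
have [_ _ h2 _] := hgm w v (leqnn k) (leqnn k).
rewrite /entry /row_limit; move: h1 h2; rewrite /transpose.
rewrite !ler_norml => /andP[? ?] /andP[? ?].
by apply/andP; split; lra.
Qed.

(** The same with the roles exchanged: the first [m] chosen after [n k] is [m k.+1], hence the shift
    in the second index. *)
Lemma entry_col_limit k w v : `|entry k w k.+1 v - col_limit k w k.+1 v| <= 2 * e k.
Proof.
have [/(_ k (ltnSn k))[h1 _] _ _ _] := hgm w v (leqnSn k) (leqnn k.+1).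
have [_ _ h2 _] := hgn w v (leqnn k) (leqnn k.+1).
have := he k; rewrite /entry /col_limit -(pairing_transpose d).
move: h1 h2; rewrite !ler_norml => /andP[? ?] /andP[? ?] ?.
by apply/andP; split; lra.
Qed.

Lemma e_ge0 k : 0 <= e k.
Proof. exact: le_trans (normr_ge0 _) (@row_limit_k k xpred0 0%N xpred0 isT). Qed.

Lemma riesz0 x u : riesz R x 0 u = (fun=> 1).
Proof. by apply/funext => s; rewrite /riesz big_ord0. Qed.

Lemma row_limit_small : small_incr row_limit (fun k => 3 * e k) (lim2 U d (fun=> 1) (fun=> 1)).
Proof.
have h k : e k <= 3 * e k by have := e_ge0 k; lra.
split=> [k w l v lk|k w l v kl|w v].
- exact: le_trans (row_limit_k w v lk) (h k).
- exact: le_trans (row_limit_l w v kl) (h l).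
by rewrite /row_limit !riesz0 subrr normr0 mulr_ge0// e_ge0.
Qed.

Lemma lower_part_small : small_incr lower_part (fun k => 3 * e k) (lim2 U d (fun=> 1) (fun=> 1)).
Proof.
split=> [k w l v|k w l v|w v]; rewrite /lower_part.
- move=> lk1; have [lk|kl] := leqP l k.
    by rewrite (leqW lk); exact: entry_k.
  (* The diagonal is crossed, from a limit to an entry: two errors for replacing the entry by its
     limit, one for the increment of the limit. *)
  have -> : l = k.+1 by apply/eqP; rewrite eqn_leq lk1.
  rewrite leqnn; apply: (le_trans (ler_distD (row_limit k.+1 w k.+1 v) _ _)).
  apply: (le_trans (lerD (entry_row_limit _ _ _) (row_limit_k _ _ (leqnn _)))).
  by have := he k; lra.
- move=> kl1; have [kl|lk] := ltnP k l.
    rewrite ltnNge (ltnW kl) /=; apply: (le_trans (row_limit_l w v (ltnW kl))).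
    by have := e_ge0 l; lra.
  have -> : l = k by apply/eqP; rewrite eqn_leq lk.
  rewrite ltnn; apply: (le_trans (ler_distD (row_limit k w k v) _ _)).
  rewrite [X in _ + X <= _]distrC.
  apply: (le_trans (lerD (row_limit_l _ _ (leqnn _)) (entry_row_limit _ _ _))).
  lra.
have := entry_row_limit 0%N w v; rewrite /row_limit !riesz0 => h; apply: (le_trans h).
by have := e_ge0 0%N; lra.
Qed.

Lemma upper_part_small : small_incr upper_part (fun k => 3 * e k)
  (lim2 U (transpose d) (fun=> 1) (fun=> 1)).
Proof.
split=> [k w l v|k w l v|w v]; rewrite /upper_part.
- move=> lk1; have [lk|kl] := leqP l k.
    rewrite (leqW lk); apply: (le_trans (col_limit_k w v (leqW lk))).
    by have := e_ge0 k; lra.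
  have -> : l = k.+1 by apply/eqP; rewrite eqn_leq lk1.
  rewrite leqnn; apply: (le_trans (ler_distD (col_limit k w k.+1 v) _ _)).
  rewrite [X in _ + X <= _]distrC.
  apply: (le_trans (lerD (col_limit_k _ _ (leqnn _)) (entry_col_limit _ _ _))).
  lra.
- move=> kl1; have [kl|lk] := ltnP k l.
    by rewrite ltnNge (ltnW kl) /=; exact: entry_l.
  have -> : l = k by apply/eqP; rewrite eqn_leq lk.
  rewrite ltnn; apply: (le_trans (ler_distD (col_limit k w k.+1 v) _ _)).
  apply: (le_trans (lerD (entry_col_limit _ _ _) (col_limit_l _ _ (leqnn _)))).
  lra.
by rewrite /= /col_limit !riesz0 subrr normr0 mulr_ge0// e_ge0.
Qed.

End Diagonalization.

(** * Reduction of multipliers *)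

Section Reduction.
Variable R : realType.
Implicit Types (al be : bits -> R) (d : dyadic -> dyadic -> R) (c : R).
Variable U : set_system nat.
Context {UU : UltraFilter U}.
Hypothesis Ufar : forall k, \forall x \near U, (k < x)%N.

Lemma uconv_near (u v : nat -> R) l : (\forall x \near U, u x = v x) ->
  uconv U u l -> uconv U v l.
Proof.
move=> h hu e e0; apply: (@filterS _ U _ _ _ _ (filterI h (hu e e0))).
by move=> x [<-].
Qed.

Lemma lim2_eq_far d d' (D D' : R) L L' al be al' be' :
  (forall K M, `|d K M| <= D) -> (forall K M, `|d' K M| <= D') ->
  cyl al -> cyl be -> cyl al' -> cyl be' ->
  (forall n m, (L < n)%N -> (L' < m)%N -> pairing d n m al be = pairing d' n m al' be') ->
  lim2 U d al be = lim2 U d' al' be'.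
Proof.
move=> dD dD' ca cb ca' cb' h.
have h1 m : (L' < m)%N -> lim1 U d m al be = lim1 U d' m al' be'.
  move=> Lm; apply/esym/uconv_eq.
  apply: uconv_near (lim1_conv dD m ca cb).
  by apply: (@filterS _ U _ _ _ _ (Ufar L)) => n Ln; exact: h.
apply/esym/uconv_eq; apply: uconv_near (lim2_conv dD ca cb).
by apply: (@filterS _ U _ _ _ _ (Ufar L')) => m; exact: h1.
Qed.

Variable N : V2 R -> R.
Hypothesis ND : forall f g, N (f + g) <= N f + N g.
Hypothesis NZ : forall a f, N (a *: f) = `|a| * N f.
Hypothesis NT : forall gam gam' f, N (tree_op gam gam' f) = N f.
Hypothesis NB : forall n m f, strict_incr n -> strict_incr m -> N (spread n m f) = N f.
Hypothesis Nhk : forall I J, 0 < N (hk R I J).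

Lemma mult_bound_entry d c K M : mult_bound N d c -> `|d K M| <= c.
Proof. by move=> /(_ (hk R K M)); rewrite mult_hk NZ ler_pM2r. Qed.

Lemma mult_bound_averaged n m d c : strict_incr n -> strict_incr m ->
  mult_bound N d c -> mult_bound N (averaged n m d) c.
Proof.
move=> hn hm h f; rewrite -gather_mult_spread// -[leRHS](congr1 _ (NB f hn hm)).
apply: le_trans (h _); apply: gather_contraction => // g; exact: NB.
Qed.

Definition restricted d L al L' be (K M : dyadic) : R :=
  ((L <= lvl K)%:R * al (bit K)) * ((L' <= lvl M)%:R * be (bit M)) * d K M.

(** The weight is a finite combination of restrictions to rectangles of levels [(L, L')]. *)
Lemma mult_bound_restricted d c L al L' be : 0 <= c -> dep L al -> dep L' be ->
  mult_bound N d c -> exists c', mult_bound N (restricted d L al L' be) c'.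
Proof.
move=> c0 ha hb hd.
pose s : R := \sum_(y : cube L) \sum_(z : cube L') `|al (ext y) * be (ext z)| * 4.
exists (s * c); apply: mult_boundM => //.
  by apply: sumr_ge0 => y _; apply: sumr_ge0 => z _; rewrite mulr_ge0.
apply: (@eq_mult_bound R N (fun K M => \sum_(y : cube L) \sum_(z : cube L')
  al (ext y) * be (ext z) * ((below (pre L (ext y)) K)%:R * (below (pre L' (ext z)) M)%:R))).
  move=> K M; rewrite -sum_below// -sum_below// big_distrlr/=.
  by apply: eq_bigr => y _; apply: eq_bigr => z _; ring.
do 2 ! [apply: mult_bound_sum => // ?]; apply: mult_boundZ => //.
exact: mult_bound_below.
Qed.

Lemma pairing_restricted d L al L' be n m : dep L al -> dep L' be ->
  (L < n)%N -> (L' < m)%N ->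
  pairing (restricted d L al L' be) n m (fun=> 1) (fun=> 1) = pairing d n m al be.
Proof.
move=> ha hb Ln Lm; apply: eq_mean => s; apply: eq_mean => t.
rewrite /restricted !lvl_pre (ltnW Ln) (ltnW Lm) !mul1r.
rewrite (ha _ s) ?(hb _ t)// => k kL; rewrite bit_pre//.
  exact: ltn_trans kL Lm.
exact: ltn_trans kL Ln.
Qed.

(** The entries of the Capon projection, see [capon_mult]: a larger level means a shorter
    interval. *)
Definition low (K M : dyadic) : R := (lvl M <= lvl K)%N%:R.

Lemma diagonal_approximation d c kappa : mult_bound N d c -> 0 < kappa ->
  exists n m : nat -> nat, [/\ strict_incr n, strict_incr m,
    mult_bound N (fun K M => lower_part U d n m (lvl K) (bit K) (lvl M) (bit M)
       - lim2 U d (fun=> 1) (fun=> 1)) kappa,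
    mult_bound N (fun K M => upper_part U d n m (lvl K) (bit K) (lvl M) (bit M)
       - lim2 U (transpose d) (fun=> 1) (fun=> 1)) kappa &
    mult_bound N (fun K M => row_limit U d n m (lvl K) (bit K) (lvl M) (bit M)
       - lim2 U d (fun=> 1) (fun=> 1)) kappa].
Proof.
move=> hd k0; have dD K M : `|d K M| <= c := mult_bound_entry K M hd.
(* The 3 is undone by the factor 3 in the three [small_incr] statements. *)
pose e k : R := incr_size kappa k / 3.
have p16 k : (0 : R) < 16 ^+ k by rewrite exprn_gt0.
have q16 k : (0 : R) < 2 * 16 ^+ k by rewrite pmulr_rgt0.
have e0 k : 0 < e k by apply: divr_gt0 => //; exact: divr_gt0.
have [n [m [hn hm hgn hgm]]] := selection Ufar dD e0.
have he k : e k.+1 <= e k.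
  rewrite /e /incr_size ler_pM2r ?invr_gt0// ler_pM2l// lef_pV2 ?posrE ?q16//.
  by rewrite ler_pM2l// ler_eXn2l// ltr1n.
have e3 : (fun k => 3 * e k) = incr_size kappa.
  by apply/funext => k; rewrite /e mulrC divfK.
have h1 := lower_part_small Ufar dD he hgn hgm.
have h2 := upper_part_small Ufar dD he hgn hgm.
have h3 := row_limit_small Ufar dD hgn hgm.
rewrite e3 in h1 h2 h3.
have dep_G k w w' l v v' (hw : agree k w w') (hv : agree l v v') :=
  (@entry_dep R n m k w w' l v v' hw hv).
exists n, m; split=> //.
- apply: (@mult_bound_small_incr R N ND NZ NT _ _ _ (ltW k0) _ (h1 UU)) => k w w' l v v' hw hv.
  by rewrite /lower_part /row_limit /entry !(dep_G _ _ _ _ _ _ hw hv).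
- apply: (@mult_bound_small_incr R N ND NZ NT _ _ _ (ltW k0) _ (h2 UU)) => k w w' l v v' hw hv.
  by rewrite /upper_part /col_limit /entry !(dep_G _ _ _ _ _ _ hw hv).
apply: (@mult_bound_small_incr R N ND NZ NT _ _ _ (ltW k0) _ (h3 UU)) => k w w' l v v' hw hv.
by rewrite /row_limit !(dep_G _ _ _ _ _ _ hw hv).
Qed.

Lemma averaged_parts n m d K M : averaged n m d K M =
  low K M * lower_part U d n m (lvl K) (bit K) (lvl M) (bit M) +
  (1 - low K M) * upper_part U d n m (lvl K) (bit K) (lvl M) (bit M).
Proof.
by rewrite /low /lower_part /upper_part; case: ifP => _;
  rewrite ?(subrr, subr0, mul1r, mul0r, addr0, add0r).
Qed.

(* [(a - b) l] is [A - y], which is bounded, up to a multiple of [l] of norm at most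
   2 k times that of [l]. *)
Lemma mult_bound_separated (A x y l : dyadic -> dyadic -> R) (a b c k : R) :
  (forall K M, A K M = l K M * x K M + (1 - l K M) * y K M) ->
  mult_bound N A c -> mult_bound N (fun K M => x K M - a) k ->
  mult_bound N (fun K M => y K M - b) k -> 0 < k -> `|a - b| = 4 * k ->
  mult_bound N l ((c + `|b| + k) / (2 * k)).
Proof.
move=> eA hA; set e1 := fun K M => x K M - a; set e2 := fun K M => y K M - b.
move=> h1 h2 k0 ab f; set g := mult l f.
have eg : (a - b) *: g = mult A f - mult e2 f - b *: f - mult e1 g + mult e2 g.
  apply: coef_ext => K M; rewrite coefD 3!coefB 2!coefZ /g !coef_mult eA /e1 /e2; ring.
have hN f1 f2 : N (f1 - f2) <= N f1 + N f2.
  by apply: (le_trans (ND _ _)); rewrite -scaleN1r NZ normrN1 mul1r.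
have : `|a - b| * N g <= c * N f + k * N f + `|b| * N f + k * N g + k * N g.
  rewrite -NZ eg; apply: (le_trans (ND _ _)); apply: lerD; last exact: h2.
  apply: (le_trans (hN _ _)); apply: lerD; last exact: h1.
  apply: (le_trans (hN _ _)); apply: lerD; last by rewrite NZ.
  apply: (le_trans (hN _ _)); apply: lerD; last exact: h2.
  exact: hA.
(* As [N g] is a finite number, the two terms [k * N g] can be absorbed on the left, where 4 k - 2 k
   = 2 k remains. *)
by rewrite ab => h; rewrite mulrAC ler_pdivlMr ?mulr_gt0//; lra.
Qed.

Hypothesis NC : forall c, ~ mult_bound N low c.

Lemma lim2_transpose_cst d c : mult_bound N d c ->
  lim2 U d (fun=> 1) (fun=> 1) = lim2 U (transpose d) (fun=> 1) (fun=> 1).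
Proof.
move=> hd; set a := lim2 U d _ _; set b := lim2 U _ _ _.
have [//|ab] := eqVneq a b; exfalso.
have k0 : 0 < `|a - b| / 4 by rewrite divr_gt0// normr_gt0 subr_eq0.
have [n [m [hn hm h1 h2 _]]] := diagonal_approximation hd k0.
have ha := mult_bound_averaged hn hm hd.
apply: (NC (mult_bound_separated (@averaged_parts n m d) ha h1 h2 k0 _)).
by rewrite mulrC divfK.
Qed.

(* The multiplier [restricted d] turns the case of arbitrary [al] and [be] into that of
   constants. *)
Lemma lim2_transpose d c al be : mult_bound N d c -> cyl al -> cyl be ->
  lim2 U d al be = lim2 U (transpose d) be al.
Proof.
move=> hd ca cb; have [L ha] := ca; have [L' hb] := cb.
have dD K M : `|d K M| <= c := mult_bound_entry K M hd.
have [c' hr] := mult_bound_restricted (D_ge0 dD) ha hb hd.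
have rD K M := mult_bound_entry K M hr.
have c1 := @cyl_cst R 1.
rewrite -(@lim2_eq_far _ d _ _ L L' _ _ al be rD dD c1 c1 ca cb); last first.
  by move=> n m; exact: pairing_restricted.
rewrite (lim2_transpose_cst hr); set d' := restricted _ _ _ _ _ in rD *.
have rT K M : `|transpose d' K M| <= c' by exact: rD.
have dT K M : `|transpose d K M| <= c by exact: dD.
apply: (@lim2_eq_far _ _ _ _ L' L _ _ _ _ rT dT c1 c1 cb ca) => m n Lm Ln.
rewrite (pairing_transpose d') (pairing_transpose d); exact: (pairing_restricted d ha hb Ln Lm).
Qed.

(** By [lim2_transpose], [row_limit] and [col_limit] coincide. Hence the averaged entries are
    exactly [lower_part + upper_part - row_limit]: on either side of the diagonal one part is the
    entry and the other the limit. Each of the three arrays is within [kappa / 3] of [lam] in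
    multiplier norm. *)
Lemma scalar_reduction d c kappa : mult_bound N d c -> 0 < kappa ->
  exists n m (lam : R), [/\ strict_incr n, strict_incr m &
    mult_bound N (fun K M => averaged n m d K M - lam) kappa].
Proof.
move=> hd k0; have k3 : 0 < kappa / 3 by rewrite divr_gt0.
have [n [m [hn hm]]] := diagonal_approximation hd k3.
rewrite -(lim2_transpose_cst hd); set a := lim2 U d _ _ => h1 h2 h3.
exists n, m, a; split; [exact: hn|exact: hm|].
have h := mult_boundD ND (mult_boundD ND h1 h2) (mult_boundZ NZ (-1) h3).
rewrite normrN1 mul1r in h.
rewrite (_ : kappa = kappa / 3 + kappa / 3 + kappa / 3); last by field.
apply: eq_mult_bound h => K M; rewrite averaged_parts /low /lower_part /upper_part.
rewrite /col_limit -(lim2_transpose hd (@riesz_cyl R _ _ _) (@riesz_cyl R _ _ _)).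
rewrite -/(row_limit U d n m (lvl K) (bit K) (lvl M) (bit M)).
move: (entry _ _ _ _ _ _ _) (row_limit _ _ _ _ _ _ _ _) => x y.
by case: ifP => _ /=; rewrite ?subrr ?subr0 ?mul0r ?mul1r; ring.
Qed.

End Reduction.

Section CaponReduction.
Variable R : realType.
Variable U : set_system nat.
Context {UU : UltraFilter U}.
Hypothesis Ufar : forall k, \forall x \near U, (k < x)%N.
Variable N : V2 R -> R.
Hypothesis ND : forall f g, N (f + g) <= N f + N g.
Hypothesis NZ : forall a f, N (a *: f) = `|a| * N f.
Hypothesis NT : forall gam gam' f, N (tree_op gam gam' f) = N f.
Hypothesis Nhk : forall I J, 0 < N (hk R I J).

(** Here the cut along the diagonal is affordable: it costs [c'] for the Capon projection and
    [1 + c'] for its complement, whence the precision [kappa / (c' + c' + 1)]. *)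
Lemma capon_reduction d (c c' kappa : R) : mult_bound N (@low R) c' ->
  mult_bound N d c -> 0 < kappa ->
  exists n m (lam mu : R), [/\ strict_incr n, strict_incr m &
    mult_bound N (fun K M => averaged n m d K M
      - (lam * low R K M + mu * (1 - low R K M))) kappa].
Proof.
move=> hC hd k0; have c0 : 0 <= c'.
  exact: le_trans (normr_ge0 _) (mult_bound_entry NZ Nhk (pre 0 xpred0) (pre 0 xpred0) hC).
have k1 : 0 < kappa / (c' + c' + 1) by rewrite divr_gt0// ltr_wpDl// addr_ge0.
have [n [m [hn hm]]] := diagonal_approximation Ufar ND NZ NT Nhk hd k1.
move: (lim2 U d _ _) (lim2 U (transpose d) _ _) => a b h1 h2 _.
exists n, m, a, b; split; [exact: hn|exact: hm|].
have hC' : mult_bound N (fun K M => 1 + -1 * low R K M) (1 + c').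
  by have h := mult_boundD ND (mult_bound1 N) (mult_boundZ NZ (-1) hC);
    rewrite normrN1 mul1r in h.
have h := mult_boundD ND (mult_boundM c0 hC h1) (mult_boundM (addr_ge0 ler01 c0) hC' h2).
rewrite (_ : kappa = c' * (kappa / (c' + c' + 1)) + (1 + c') * (kappa / (c' + c' + 1))); last first.
  by field; rewrite gt_eqF// ltr_wpDl// addr_ge0.
apply: eq_mult_bound h => K M; rewrite (averaged_parts U).
by move: (low R K M) (lower_part _ _ _ _ _ _ _ _) (upper_part _ _ _ _ _ _ _ _) => x y z; ring.
Qed.

End CaponReduction.

(** * Extension to the completion *)

(** At a point of [I] times [J] one term of modulus 1 is left for every choice of signs, so
    [square_fun] is 1 there, whereas a zero norm would make it vanish. *)
Lemma hardy_norm_hk_neq0 (R : realType) (X Y : haar_system_space R) S1 S2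
    (P : probability (signs * signs)%type R) I J : is_haar_measure S1 S2 P ->
  hardy_norm P X Y (hk R I J) != 0.
Proof.
move=> hP; apply/eqP; set L := (maxn (lvl I) (lvl J)).+1.
have IL : (lvl I < L)%N by rewrite ltnS leq_max leqnn.
have JL : (lvl J < L)%N by rewrite ltnS leq_max leqnn orbT.
rewrite (hardy_normE X Y hP (supp_lt_hk R IL JL)) => h.
have [x ux xI] := rbit_surj R I; have [y uy yJ] := rbit_surj R J.
have dX : dep L (fun s => NX Y (fun t => square_fun S1 S2 L (hk R I J) s t)).
  by move=> s s' e; congr (NX Y _); apply/funext => t; exact: square_fun_agree.
have dY : dep L (square_fun S1 S2 L (hk R I J) (rbit x)).
  by move=> t t' e; exact: square_fun_agree.
have := NX_eq0 dY (NX_eq0 dX h ux) uy.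
have sum1 (a b : bits) : `| \sum_(n < L) \sum_(m < L) (-1) ^+ a n * (-1) ^+ b m *
    path_coef (hk R I J) (rbit x) (rbit y) n m | = 1 :> R.
  have pI n : (I == pre n (rbit x)) = (n == lvl I).
    apply/eqP/eqP => [->|->]; [exact: lvl_pre|by rewrite xI].
  have pJ m : (J == pre m (rbit y)) = (m == lvl J).
    apply/eqP/eqP => [->|->]; [exact: lvl_pre|by rewrite yJ].
  rewrite (bigD1 (Ordinal IL))//= [X in _ + X]big1 ?addr0 => [|n nI]; last first.
    apply: big1 => m _; rewrite path_coef_hk pI.
    by rewrite (_ : (_ == lvl I) = false) ?mul0r ?mulr0//; apply: contraNF nI => /eqP e;
      apply/eqP/val_inj.
  rewrite (bigD1 (Ordinal JL))//= big1 ?addr0 => [|m mJ]; last first.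
    rewrite path_coef_hk pJ (_ : (_ == lvl J) = false) ?mul0r ?mulr0//.
    by apply: contraNF mJ => /eqP e; apply/eqP/val_inj.
  rewrite path_coef_hk pI pJ !eqxx !mul1r !normrM !normrX !normrN1 !expr1n !mulr1//.
rewrite /square_fun.
under eq_sign_mean do (under eq_sign_mean do rewrite sum1; rewrite sign_mean_const).
by rewrite sign_mean_const => /eqP; rewrite oner_eq0.
Qed.

Section BoundedLinear.
Variables (R : realType) (Z : normedModType R).
Implicit Types T : Z -> Z.

Definition bdd_lin (c : R) T := lin_map T /\ forall z, `|T z| <= c * `|z|.

Lemma bdd_lin_bop (T : bounded_operator Z) : exists2 c, 0 <= c & bdd_lin c T.
Proof.
case: T => T [M hM]; exists `|M| => //; split=> [a u v|z]; first exact: linearP.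
by apply: le_trans (hM z) _; rewrite ler_wpM2r// ler_norm.
Qed.

Lemma bop_exists c T : bdd_lin c T -> exists S : bounded_operator Z, forall z, S z = T z.
Proof.
move=> [hT bT]; pose TL : {linear Z -> Z} := HB.pack T (GRing.isLinear.Build R Z Z *:%R T hT).
have hb : exists M : R, forall z, `|TL z| <= M * `|z| by exists c.
by exists (BoundedOperator hb).
Qed.

Lemma bdd_lin_comp c c' T T' : 0 <= c -> bdd_lin c T -> bdd_lin c' T' ->
  bdd_lin (c * c') (T \o T').
Proof.
move=> c0 [hT bT] [hT' bT']; split=> [|z]; first exact: lin_map_comp.
by apply: le_trans (bT _) _; rewrite -mulrA ler_wpM2l.
Qed.

Lemma bdd_lin_sub c c' T T' : bdd_lin c T -> bdd_lin c' T' ->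
  bdd_lin (c + c') (fun z => T z - T' z).
Proof.
move=> [hT bT] [hT' bT']; split=> [a u v|z].
  by rewrite hT hT' scalerBr opprD addrACA.
by rewrite mulrDl; apply: le_trans (ler_normB _ _) _; exact: lerD.
Qed.

Lemma bdd_lin_scale (a : R) : bdd_lin `|a| (fun z => a *: z).
Proof.
split=> [b u v|z]; last by rewrite normrZ.
by rewrite scalerDr !scalerA mulrC.
Qed.

Lemma bdd_lin_id : bdd_lin 1 (fun z => z).
Proof. by split=> // z; rewrite mul1r. Qed.

Lemma opnorm_le c T : 0 <= c -> (forall z, `|T z| <= c * `|z|) -> opnorm T <= c.
Proof.
move=> c0 h; apply: ge_sup; first by exists `|T 0|, 0 => //=; rewrite normr0.
move=> _ [z /= z1 <-]; apply: le_trans (h z) _.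
by rewrite -[leRHS]mulr1 ler_wpM2l.
Qed.

Lemma opnorm_ge0 c T : 0 <= c -> (forall z, `|T z| <= c * `|z|) -> 0 <= opnorm T.
Proof.
move=> c0 h; apply: le_trans (normr_ge0 (T 0)) _; apply: ub_le_sup.
  exists c => _ [z /= z1 <-]; apply: le_trans (h z) _.
  by rewrite -[leRHS]mulr1 ler_wpM2l.
by exists 0 => //=; rewrite normr0.
Qed.

End BoundedLinear.

Section Extension.
Variables (R : realType) (V : lmodType R) (Z : completeNormedModType R).
Variable iota : {linear V -> Z}.
Hypothesis dense : closure (range iota) = setT.

Lemma dense_approx z (e : R) : 0 < e -> exists f, `|z - iota f| < e.
Proof.
move=> e0; have : closure (range iota) z by rewrite dense.
have hb : nbhs z (ball z e) by exact: nbhsx_ballx.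
by move=> /(_ _ hb)[_ [[f _ <-]]]; rewrite -ball_normE /= => hf; exists f.
Qed.

(** The bound [c] provides continuity; the sharp constant [eta] is then read off on the range of
    [iota]. With [eta = 0] this proves identities between operators. *)
Lemma bdd_lin_dense c (eta : R) (T : Z -> Z) : 0 <= c -> 0 <= eta -> bdd_lin c T ->
  (forall f, `|T (iota f)| <= eta * `|iota f|) -> forall z, `|T z| <= eta * `|z|.
Proof.
move=> c0 eta0 [hT bT] h z; apply/ler_addgt0Pr => e e0.
have s0 : 0 < c + eta + 1 by rewrite ltr_wpDl// addr_ge0.
have [f hf] := dense_approx z (divr_gt0 e0 s0).
have -> : T z = T (z - iota f) + T (iota f) by rewrite -(lin_mapD hT) subrK.
apply: le_trans (ler_normD _ _) _.
apply: le_trans (lerD (bT _) (h _)) _.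
have h1 : `|iota f| <= `|z| + `|z - iota f|.
  by rewrite -{1}[iota f](subKr z); exact: ler_normB.
have h2 : eta * `|iota f| <= eta * (`|z| + `|z - iota f|) by rewrite ler_wpM2l.
have h3 : (c + eta) * `|z - iota f| <= e.
  apply: (@le_trans _ _ ((c + eta + 1) * `|z - iota f|)).
    by rewrite ler_wpM2r// lerDl.
  by rewrite mulrC -ler_pdivlMr// ltW.
by move: h2 h3; rewrite !mulrDr !mulrDl; lra.
Qed.

Variables (phi : V -> V) (c : R).
Hypothesis hphi : lin_map phi.
Hypothesis c0 : 0 <= c.
Hypothesis bphi : forall f, `|iota (phi f)| <= c * `|iota f|.

(* The closure of the graph of [phi] in Z x Z. *)
Let graph z w := forall e : R, 0 < e ->
  exists f, `|z - iota f| <= e /\ `|w - iota (phi f)| <= e.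

Let graph_iota f : graph (iota f) (iota (phi f)).
Proof. by move=> e e0; exists f; rewrite !subrr normr0 ltW. Qed.

Let graph_lin a z w z' w' : graph z w -> graph z' w' -> graph (a *: z + z') (a *: w + w').
Proof.
move=> h h' e e0; have a0 : 0 < `|a| + 1 by rewrite ltr_wpDl.
have [f [hf1 hf2]] := h _ (divr_gt0 e0 a0).
have e1 : 0 < e - `|a| * (e / (`|a| + 1)).
  rewrite [X in X - _](_ : e = (`|a| + 1) * (e / (`|a| + 1))); last first.
    by rewrite mulrC divfK// gt_eqF.
  by rewrite -mulrBl addrAC subrr add0r mul1r divr_gt0.
have [g [hg1 hg2]] := h' _ e1; exists (a *: f + g).
have key (x y x' y' : Z) : `|x - y| <= e / (`|a| + 1) ->
    `|x' - y'| <= e - `|a| * (e / (`|a| + 1)) -> `|a *: x + x' - (a *: y + y')| <= e.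
  move=> h1 h2; rewrite opprD addrACA -scalerBr; apply: le_trans (ler_normD _ _) _.
  rewrite normrZ; apply: le_trans (lerD (ler_wpM2l (normr_ge0 a) h1) h2) _.
  by rewrite addrC subrK.
by rewrite hphi !(linearP iota); split; exact: key.
Qed.

Let graph_bound z w : graph z w -> `|w| <= c * `|z|.
Proof.
move=> h; apply/ler_addgt0Pr => e e0.
have s0 : 0 < c + 1 by rewrite ltr_wpDl.
have [f [h1 h2]] := h _ (divr_gt0 e0 s0).
rewrite -[w](subrK (iota (phi f))); apply: le_trans (ler_normD _ _) _.
have h3 : `|iota f| <= `|z| + `|z - iota f|.
  by rewrite -{1}[iota f](subKr z); exact: ler_normB.
apply: le_trans (lerD h2 (bphi f)) _.
have h4 : c * `|iota f| <= c * (`|z| + e / (c + 1)).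
  by rewrite ler_wpM2l//; apply: le_trans h3 _; rewrite lerD2l.
have h5 : e = (c + 1) * (e / (c + 1)) by rewrite mulrC divfK// gt_eqF.
by rewrite [in leRHS]h5; move: h4; rewrite mulrDr mulrDl; lra.
Qed.

Let graph_exists z : exists w, graph z w.
Proof.
(* The images of the approximants of [z]; boundedness of [phi] makes this filter Cauchy. *)
pose F : set_system Z := [set A | exists2 e : R, 0 < e &
  forall f, `|z - iota f| < e -> A (iota (phi f))].
have FF : ProperFilter F.
  apply: Build_ProperFilter => [[e e0 h]|]; first by have [f /h] := dense_approx z e0.
  split=> [|A B [e e0 hA] [e' e0' hB]|A B AB [e e0 hA]].
  - by exists 1.
  - exists (Num.min e e'); first by rewrite lt_min e0.
    by move=> f; rewrite lt_min => /andP[/hA ? /hB ?].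
  - by exists e => // f /hA; exact: AB.
have : cvg F.
  apply: cauchy_cvg; apply: cauchy_exP => e e0.
  (* Two approximants within delta of [z] have images within 2 c delta of each other. *)
  have s0 : 0 < c + c + 1 by rewrite ltr_wpDl// addr_ge0.
  have d0 := divr_gt0 e0 s0; have [f hf] := dense_approx z d0.
  exists (iota (phi f)), (e / (c + c + 1)) => // g hg.
  rewrite -ball_normE /= -linearB -(lin_mapB hphi).
  apply: le_lt_trans (bphi _) _; rewrite linearB.
  have h : `|iota f - iota g| <= e / (c + c + 1) + e / (c + c + 1).
    apply: le_trans (ler_distD z _ _) _; apply: lerD; last exact: ltW.
    by rewrite distrC ltW.
  apply: (@le_lt_trans _ _ (c * (e / (c + c + 1) + e / (c + c + 1)))).
    by rewrite ler_wpM2l.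
  rewrite -mulrDl mulrA mulrDr ltr_pdivrMr// mulrDr mulr1 mulrDr.
  by rewrite [c * e]mulrC; lra.
move=> /cvg_ex[w hw]; exists w => e e0.
have [e' e0' h] : F (ball w e) by apply: hw; exact: nbhsx_ballx.
have m0 : 0 < Num.min e e' by rewrite lt_min e0.
have [f] := dense_approx z m0; rewrite lt_min => /andP[h1 /h].
by rewrite -ball_normE /= => h2; exists f; split; exact: ltW.
Qed.

Lemma extension_exists : exists2 T : bounded_operator Z,
  (forall f, T (iota f) = iota (phi f)) & (forall z, `|T z| <= c * `|z|).
Proof.
have [T hT] := boolp.choice graph_exists.
have uniq_graph z w w' : graph z w -> graph z w' -> w = w'.
  move=> h h'; apply/eqP; rewrite -subr_eq0 -normr_le0 -(mulr0 c) -(@normr0 _ Z).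
  have := graph_lin (-1) h' h; rewrite !scaleN1r addNr addrC.
  by move=> /graph_bound.
have bT : bdd_lin c T.
  split=> [a u v|z]; last exact: graph_bound.
  exact: uniq_graph (hT _) (graph_lin a (hT u) (hT v)).
have [S hS] := bop_exists bT; exists S => [f|z]; rewrite hS.
  exact: uniq_graph (hT _) (graph_iota f).
exact: graph_bound.
Qed.

End Extension.

Lemma capon_mult (R : realType) (f : V2 R) : capon f = mult (@low R) f.
Proof.
rewrite /capon mult.unlock lin.unlock big_mkcond; apply: eq_bigr => p _.
rewrite /low /len lef_pV2 ?posrE ?exprn_gt0// ler_eXn2l ?ltr1n//.
by case: leqP => _; rewrite ?scale1r ?scale0r ?scaler0.
Qed.

Lemma far_ultrafilter : exists U : set_system nat,
  UltraFilter U /\ forall k, \forall x \near U, (k < x)%N.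
Proof.
have [U [UU hU]] := @ultraFilterLemma nat \oo _.
by exists U; split=> // k; apply: hU; exact: nbhs_infty_gt.
Qed.

(** * Factorization through averaged multipliers *)

Section Factorization.
Variable R : realType.
Variable N : V2 R -> R.
Variables (Z : completeNormedModType R) (iota : {linear V2 R -> Z}).
Hypothesis hZ : is_completion N iota.
Hypothesis NT : forall gam gam' f, N (tree_op gam gam' f) = N f.
Hypothesis NB : forall n m f, strict_incr n -> strict_incr m -> N (spread n m f) = N f.
Hypothesis Nhk : forall I J, N (hk R I J) != 0.

Let iotaE f : `|iota f| = N f. Proof. exact: hZ.1. Qed.
Let dense : closure (range iota) = setT. Proof. exact: hZ.2. Qed.

Let ND f g : N (f + g) <= N f + N g.
Proof. by rewrite -!iotaE linearD ler_normD. Qed.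

Let NZ a f : N (a *: f) = `|a| * N f.
Proof. by rewrite -!iotaE linearZ normrZ. Qed.

Let Nhk_gt0 I J : 0 < N (hk R I J).
Proof. by rewrite lt_neqAle eq_sym Nhk -iotaE /=. Qed.

Lemma HM_mult T : HM N iota T ->
  exists d c, mult_bound N d c /\ forall f, T (iota f) = iota (mult d f).
Proof.
move=> [D [hD [c hc] eT]].
pose d I J := coef (D (hk R I J)) I J.
have eD f : D f = mult d f.
  apply: lin_map_ext; [by move=> a u v; exact: linearP|exact: mult_lin|].
  move=> [I J] _; have [a ea] := hD I J.
  by rewrite mult_hk /d /= ea coefZ coef_hk !eqxx mulr1.
by exists d, c; split=> f; [rewrite -eD|rewrite eT eD].
Qed.

Section Conjugation.
Variables n m : nat -> nat.
Hypotheses (hn : strict_incr n) (hm : strict_incr m).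

Lemma spread_extension : exists2 B : bounded_operator Z,
  (forall f, B (iota f) = iota (spread n m f)) & (forall z, `|B z| <= 1 * `|z|).
Proof.
by apply: (extension_exists dense (@spread_lin R n m) ler01 _) => f; rewrite mul1r !iotaE NB.
Qed.

Lemma gather_extension : exists2 A : bounded_operator Z,
  (forall f, A (iota f) = iota (gather n m f)) & (forall z, `|A z| <= 1 * `|z|).
Proof.
apply: (extension_exists dense (@gather_lin R n m) ler01 _) => f.
rewrite mul1r !iotaE; apply: (gather_contraction ND NZ NT hn hm) => g; exact: NB.
Qed.

Lemma projectional_factor (T S : bounded_operator Z) d e eta : 0 <= eta ->
  (forall f, T (iota f) = iota (mult d f)) -> (forall f, S (iota f) = iota (mult e f)) ->
  mult_bound N (fun K M => averaged n m d K M - e K M) eta ->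
  is_projectional_factor 1 eta T S.
Proof.
move=> eta0 eT eS h.
have [A eA bA] := gather_extension; have [B eB bB] := spread_extension.
have [cT cT0 lT] := bdd_lin_bop T; have [cS cS0 lS] := bdd_lin_bop S.
have [cA cA0 lA] := bdd_lin_bop A; have [cB cB0 lB] := bdd_lin_bop B.
exists A, B; split.
- rewrite -[leRHS]mulr1; apply: ler_pM; do ?[exact: opnorm_ge0 bA|exact: opnorm_ge0 bB];
    exact: opnorm_le.
- move=> z; have lAB := bdd_lin_sub (bdd_lin_comp cA0 lA lB) (bdd_lin_id Z).
  have := bdd_lin_dense dense _ (lexx 0) lAB _ z.
  rewrite mul0r normr_le0 subr_eq0 => /(_ _ _)/eqP; apply.
    by rewrite addr_ge0// mulr_ge0.
  by move=> f /=; rewrite eB eA gather_spread// subrr normr0 mul0r.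
have lATB := bdd_lin_sub lS (bdd_lin_comp cA0 lA (bdd_lin_comp cT0 lT lB)).
apply: opnorm_le => //; apply: (bdd_lin_dense dense _ eta0 lATB).
  by rewrite addr_ge0// !mulr_ge0.
move=> f /=; rewrite eB eT eA eS gather_mult_spread// -linearB !iotaE.
have -> : mult e f - mult (averaged n m d) f =
    (-1) *: mult (fun K M => averaged n m d K M - e K M) f.
  by apply: coef_ext => K M; rewrite coefB coefZ !coef_mult; ring.
by rewrite NZ normrN1 mul1r.
Qed.

(* The inverse of a multiplier close to the identity multiple [lam] is a
   multiplier on V(delta^2), and extends to [Z] by density. *)
Lemma factor_identity (T : Z -> Z) d cT lam eta C : 0 <= cT -> bdd_lin cT T ->
  (forall f, T (iota f) = iota (mult d f)) -> eta < `|lam| ->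
  (`|lam| - eta)^-1 <= C ->
  mult_bound N (fun K M => averaged n m d K M - lam) eta ->
  is_factor C T idfun.
Proof.
move=> cT0 lT eT etal hC h; set k := (`|lam| - eta)^-1 in hC.
have k0 : 0 < k by rewrite invr_gt0 subr_gt0.
set g := averaged n m d in h.
have g0 K M : g K M != 0.
  apply: contraTneq etal => gKM; rewrite -leNgt.
  have := mult_bound_entry NZ Nhk_gt0 K M h.
  by rewrite gKM sub0r normrN.
(* No Neumann series is summed: the inverse is known entrywise, and
   [lam *: f' = f - mult (g - lam) f'] gives an a priori bound for it. *)
have hinv f : N (mult (fun K M => (g K M)^-1) f) <= k * N f.
  set f' := mult _ f; have ef : f = mult g f'.
    by apply: coef_ext => K M; rewrite !coef_mult mulVKf.
  have : `|lam| * N f' <= N f + eta * N f'.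
    rewrite -NZ; have -> : lam *: f' = f + (-1) *: mult (fun K M => g K M - lam) f'.
      apply: coef_ext => K M; rewrite coefD !coefZ {1}ef !coef_mult; ring.
    by apply: le_trans (ND _ _) _; rewrite NZ normrN1 mul1r lerD2l.
  by move=> hf; rewrite /k mulrC ler_pdivlMr ?subr_gt0// mulrBr; lra.
have [A eA bA] := gather_extension; have [B eB bB] := spread_extension.
have [G eG bG] : exists2 G : bounded_operator Z,
    (forall f, G (iota f) = iota (mult (fun K M => (g K M)^-1) f)) &
    (forall z, `|G z| <= k * `|z|).
  by apply: (extension_exists dense (@mult_lin R _) (ltW k0) _) => f; rewrite !iotaE.
have [cA cA0 lA] := bdd_lin_bop A; have [cB cB0 lB] := bdd_lin_bop B.
have [cG cG0 lG] := bdd_lin_bop G.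
have bGA z : `|G (A z)| <= k * `|z|.
  by apply: le_trans (bG _) _; rewrite ler_wpM2l ?(ltW k0)// -[leRHS]mul1r.
have [A' eA'] := bop_exists (bdd_lin_comp cG0 lG lA).
have bA' z : `|A' z| <= k * `|z| by rewrite eA' bGA.
exists A', B; split.
  apply: le_trans hC; rewrite -[leRHS]mulr1; apply: ler_pM;
    do ?[exact: opnorm_ge0 bA'|exact: opnorm_ge0 bB|exact: opnorm_le (ltW k0) bA'].
  - exact: opnorm_ge0 (ltW k0) bA'.
  exact: opnorm_le bB.
have lI := bdd_lin_sub (bdd_lin_id Z)
  (bdd_lin_comp cG0 lG (bdd_lin_comp cA0 lA (bdd_lin_comp cT0 lT lB))).
move=> z; apply/eqP; rewrite eA' -subr_eq0 -normr_le0 -(mul0r `|z|).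
apply: (bdd_lin_dense dense _ (lexx 0) lI); first by rewrite addr_ge0// !mulr_ge0.
move=> f /=; rewrite eB eT eA gather_mult_spread// -/g eG mult_comp.
rewrite (@eq_mult _ _ (fun _ _ => 1)) ?mult1 ?subrr ?normr0 ?mul0r// => K M.
by rewrite mulVf.
Qed.

End Conjugation.
End Factorization.

(** Averaging is linear in [d], and it preserves the constant 1 because [gather] inverts
    [spread]. *)
Lemma mult_averaged_compl (R : realType) n m (d : dyadic -> dyadic -> R) f :
  strict_incr n -> strict_incr m ->
  mult (averaged n m (fun K M => 1 - d K M)) f = f - mult (averaged n m d) f.
Proof.
move=> hn hm; rewrite -!gather_mult_spread// -{2}[f](gather_spread hn hm).
rewrite -(lin_mapB (@gather_lin R n m)); congr (gather n m _).
by apply: coef_ext => K M; rewrite coefB !coef_mult; ring.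
Qed.

Theorem theorem2p14 (R : realType) (X Y : haar_system_space R)
    (S1 S2 : sign_choice) (P : probability (signs * signs)%type R)
    (hP : is_haar_measure S1 S2 P)
    (Z : completeNormedModType R) (iota : {linear V2 R -> Z})
    (hZ : is_completion (hardy_norm P X Y) iota) :
  (~ bounded_for (hardy_norm P X Y) (@capon R) ->
     approx_projectionally_reduces 1
       (HM (hardy_norm P X Y) iota) (@scalar_operators R Z)
     /\ forall C : R, 2 < C ->
       primary_factorization_property C (HM (hardy_norm P X Y) iota))
  /\
  (bounded_for (hardy_norm P X Y) (@capon R) ->
     approx_projectionally_reduces 1
       (HM (hardy_norm P X Y) iota) (capon_algebra iota)).
Proof.
have [U [UU Ufar]] := far_ultrafilter.
have NT gam gam' f : hardy_norm P X Y (tree_op gam gam' f) = hardy_norm P X Y f.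
  exact: (tree_op_isometry X Y hP).
have NB n m f : strict_incr n -> strict_incr m ->
    hardy_norm P X Y (spread n m f) = hardy_norm P X Y f.
  by move=> hn hm; exact: (spread_isometry hn hm X Y f hP).
have Nhk I J := hardy_norm_hk_neq0 X Y I J hP.
move: (hardy_norm P X Y) hZ NT NB Nhk => N {}hZ NT NB Nhk.
have iotaE f : `|iota f| = N f by exact: hZ.1.
have ND f g : N (f + g) <= N f + N g by rewrite -!iotaE linearD ler_normD.
have NZ a f : N (a *: f) = `|a| * N f by rewrite -!iotaE linearZ normrZ.
have Npos I J : 0 < N (hk R I J) by rewrite lt_neqAle eq_sym Nhk -iotaE /=.
split=> hC; [split|].
- have NC c : ~ mult_bound N (@low R) c.
    by move=> h; apply: hC; exists c => f; rewrite capon_mult.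
  move=> T /(HM_mult)[d [c [hd eT]]] eta eta0.
  have [n [m [lam [hn hm h]]]] :=
    scalar_reduction Ufar ND NZ NT NB Npos NC hd eta0.
  have [S eS] := bop_exists (bdd_lin_scale Z lam).
  exists S; first by exists lam.
  apply: (projectional_factor hZ NT NB hn hm (ltW eta0) eT _ h) => f.
  by rewrite eS -linearZ; congr (iota _); apply: coef_ext => K M; rewrite coefZ coef_mult.
- have NC c : ~ mult_bound N (@low R) c.
    by move=> h; apply: hC; exists c => f; rewrite capon_mult.
  move=> C C2 T /(HM_mult)[d [c [hd eT]]].
  have C0 : 0 < C by lra.
  have CV : C^-1 < 2^-1 by rewrite ltf_pV2 ?posrE.
  (* With this error, a scalar of modulus at least 1/2 exceeds it by at least [C^-1], so the inverse
     costs at most [C]. *)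
  have eta0 : 0 < 2^-1 - C^-1 by rewrite subr_gt0.
  have VC : 0 < C^-1 by rewrite invr_gt0.
  have [n [m [lam [hn hm h]]]] :=
    scalar_reduction Ufar ND NZ NT NB Npos NC hd eta0.
  have large (x : R) : 2^-1 <= `|x| ->
      2^-1 - C^-1 < `|x| /\ (`|x| - (2^-1 - C^-1))^-1 <= C.
    move=> hx; have hx' : C^-1 <= `|x| - (2^-1 - C^-1) by lra.
    split; first lra.
    by rewrite -[leRHS]invrK lef_pV2 ?posrE// (lt_le_trans VC).
  have [cT cT0 lT] := bdd_lin_bop T.
  have [hl|hl] := leP 2^-1 `|lam|; [left|right].
    have [l1 l2] := large _ hl.
    exact: (factor_identity hZ NT NB Nhk hn hm cT0 lT eT l1 l2 h).
  have hl' : 2^-1 <= `|1 - lam|.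
    have : `|1 : R| <= `|1 - lam| + `|lam| by rewrite -{1}[1](subrK lam) ler_normD.
    by rewrite normr1; lra.
  have [l1 l2] := large _ hl'.
  apply: (factor_identity hZ NT NB Nhk hn hm (addr_ge0 ler01 cT0)
    (bdd_lin_sub (bdd_lin_id Z) lT) (d := fun K M => 1 - d K M) _ l1 l2).
    move=> f; rewrite eT -linearB; congr (iota _).
    by apply: coef_ext => K M; rewrite coefB !coef_mult mulrBl mul1r.
  (* Up to sign, the averaged entries of [1 - d] minus [1 - lam] form the multiplier already
     estimated in [h]. *)
  move=> f; apply: le_trans (h f).
  set g := mult _ f; have -> : g = (-1) *: mult (fun K M => averaged n m d K M - lam) f.
    apply: coef_ext => K M; rewrite /g coefZ !coef_mult mulrBl.
    rewrite -(coef_mult (averaged n m _)) mult_averaged_compl// coefB coef_mult; ring.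
  by rewrite NZ normrN1 mul1r.
move=> T /(HM_mult)[d [c [hd eT]]] eta eta0.
case: hC => c' hC; have hlow : mult_bound N (@low R) c'.
  by move=> f; rewrite -capon_mult.
have c'0 : 0 <= c'.
  exact: le_trans (normr_ge0 _)
    (mult_bound_entry NZ Npos (pre 0 xpred0) (pre 0 xpred0) hlow).
have [n [m [lam [mu [hn hm h]]]]] := capon_reduction Ufar ND NZ NT Npos hlow hd eta0.
have [Cz eCz bCz] : exists2 Cz : bounded_operator Z,
    (forall f, Cz (iota f) = iota (mult (@low R) f)) & (forall z, `|Cz z| <= c' * `|z|).
  by apply: (extension_exists hZ.2 (@mult_lin R _) c'0 _) => f; rewrite !iotaE.
have [cC cC0 lC] := bdd_lin_bop Cz.
have lS := bdd_lin_sub (bdd_lin_comp (normr_ge0 lam) (bdd_lin_scale Z lam) lC)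
  (bdd_lin_comp (normr_ge0 (- mu)) (bdd_lin_scale Z (- mu))
    (bdd_lin_sub (bdd_lin_id Z) lC)).
have [S eS] := bop_exists lS.
have eS' z : S z = lam *: Cz z + mu *: (z - Cz z) by rewrite eS /= scaleNr opprK.
exists S.
  exists Cz; split; first by move=> f; rewrite eCz capon_mult.
  by exists lam, mu.
apply: (projectional_factor hZ NT NB hn hm (ltW eta0) eT _ h) => f.
rewrite eS' eCz -linearB -!linearZ -linearD; congr (iota _); apply: coef_ext => K M.
rewrite coefD !coefZ coefB !coef_mult; ring.
Qed.
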